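(* Let $L$ satisfy assumptions (L1), (L2), (L3) stated in the context. Let $x_0,x\in\mathbb{R}^n$, $t>0$ and $u_0\in\mathbb{R}$. Then the functional $$J(\xi)=\int_0^t L(\xi(s),u_\xi(s),\dot\xi(s))\,ds,$$ where $u_\xi$ is determined by $\dot u_\xi(s)=L(\xi(s),u_\xi(s),\dot\xi(s))$ for a.e. $s\in[0,t]$ and $u_\xi(0)=u_0$, admits a minimizer in $\Gamma^t_{x_0,x}$; that is, there exists $\xi^*\in\mathcal{A}$ such that $J(\xi^* )\leqslant J(\xi)$ for all $\xi\in\mathcal{A}$.
   Context: Standing assumptions: $L:\mathbb{R}^n\times\mathbb{R}\times\mathbb{R}^n\to\mathbb{R}$, $(x,r,v)\mapsto L(x,r,v)$, is of class $C^2$ and satisfies: (L1) $L(x,r,\cdot)$ is strictly convex for all $(x,r)\in\mathbb{R}^n\times\mathbb{R}$. (L2) There exist two superlinear nondecreasing functions $\overline\theta_0,\theta_0:[0,+\infty)\to[0,+\infty)$ with $\theta_0(0)=0$, and $c_0>0$, such that $\overline\theta_0(|v|)\geqslant L(x,0,v)\geqslant\theta_0(|v|)-c_0$ for all $(x,v)\in\mathbb{R}^n\times\mathbb{R}^n$. (Superlinear: $\theta(\rho)/\rho\to+\infty$ as $\rho\to+\infty$.) (L3) There exists $K>0$ such that $|L_r(x,r,v)|\leqslant K$ for all $(x,r,v)$, where $L_r=\partial L/\partial r$. Notation: $\Gamma^t_{x_0,x}=\{\xi\in W^{1,1}([0,t],\mathbb{R}^n):\xi(0)=x_0,\ \xi(t)=x\}$.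 $\mathcal{A}$ is the set of $\xi\in\Gamma^t_{x_0,x}$ for which the Carathéodory equation $\dot u_\xi(s)=L(\xi(s),u_\xi(s),\dot\xi(s))$ a.e. on $[0,t]$, $u_\xi(0)=u_0$, admits an absolutely continuous solution $u_\xi$ on $[0,t]$; this solution is unique. $J$ is defined on $\mathcal{A}$, and $J(\xi)=u_\xi(t)-u_0$. *)

(* Defs.v *)
From mathcomp Require Import all_boot all_order all_algebra.
From mathcomp Require Import all_classical all_reals all_analysis.
Import Order.TTheory GRing.Theory Num.Theory.
Import numFieldNormedType.Exports.

Set Implicit Arguments.
Unset Strict Implicit.
Unset Printing Implicit Defensive.

Local Open Scope ring_scope.
Local Open Scope classical_set_scope.

(* Class C^k for a real function on a finite-dimensional space.  Continuity of
   the differential p |-> 'd f p is stated vector by vector, which in finite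
   dimension is the same as continuity in operator norm. *)
Fixpoint Ck (R : realType) (V : normedModType R) (k : nat) (f : V -> R) : Prop :=
  if k is k'.+1
  then (forall p, differentiable f p) /\ (forall v, Ck k' (fun p => 'd f p v))
  else continuous f.

Definition strictly_convex (R : realType) (E : lmodType R) (f : E -> R) : Prop :=
  forall (v w : E) (l : R), v != w -> 0 < l < 1 ->
    f (l *: v + (1 - l) *: w) < l * f v + (1 - l) * f w.

(* The norm the library puts on 'rV[R]_n is the sup norm. *)
Definition enorm (R : realType) (n : nat) (v : 'rV[R]_n) : R :=
  Num.sqrt (\sum_(i < n) v ord0 i ^+ 2).

(* Superlinear nondecreasing functions from [0, +oo[ to itself; the values at
   negative arguments are irrelevant. *)
Definition superlinear_nondecreasing (R : realType) (theta : R -> R) : Prop :=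
  [/\ forall rho : R, 0 <= rho -> 0 <= theta rho,
      forall rho1 rho2 : R, 0 <= rho1 -> rho1 <= rho2 -> theta rho1 <= theta rho2
    & theta rho / rho @[rho --> +oo%R] --> +oo%R].

Definition growth_condition (R : realType) (n : nat)
    (L : 'rV[R]_n -> R -> 'rV[R]_n -> R) : Prop :=
  exists (thetabar0 theta0 : R -> R) (c0 : R),
    [/\ superlinear_nondecreasing thetabar0,
        superlinear_nondecreasing theta0,
        theta0 0 = 0,
        0 < c0
      & forall x v, theta0 (enorm v) - c0 <= L x 0 v <= thetabar0 (enorm v)].

Definition bounded_r_derivative (R : realType) (n : nat)
    (L : 'rV[R]_n -> R -> 'rV[R]_n -> R) : Prop :=
  exists2 K : R, 0 < K &
    forall x r v, `| derive1 (fun r' : R => L x r' v) r | <= K.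

(* Absolute continuity on [a, b]; I i is the pair of endpoints of the i-th
   interval of a finite family of pairwise nonoverlapping intervals. *)
Definition abs_continuous (R : realType) (V : normedModType R) (a b : R)
    (f : R -> V) : Prop :=
  forall e : R, 0 < e -> exists2 d : R, 0 < d &
    forall (m : nat) (I : 'I_m -> R * R),
      (forall i, a <= (I i).1 /\ (I i).1 <= (I i).2 /\ (I i).2 <= b) ->
      trivIset [set: 'I_m] (fun i => `](I i).1, (I i).2[ : set R) ->
      \sum_(i < m) ((I i).2 - (I i).1) < d ->
      \sum_(i < m) `| f (I i).2 - f (I i).1 | < e.

(* Curves of class W^{1,1} on [0, t] from x0 to x.  Since the endpoint values
   are prescribed, an element of W^{1,1}([0, t], R^n) is given by its absolutely
   continuous representative, whose a.e. derivative is its weak derivative.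
   Curves are functions on R of which only the restriction to [0, t] matters. *)
Definition Gamma (R : realType) (n : nat) (t : R) (x0 x : 'rV[R]_n) :
    set (R -> 'rV[R]_n) :=
  [set xi | [/\ abs_continuous 0 t xi, xi 0 = x0 & xi t = x]].

Definition caratheodory_solution (R : realType) (n : nat)
    (L : 'rV[R]_n -> R -> 'rV[R]_n -> R) (t u0 : R) (xi : R -> 'rV[R]_n)
    (u : R -> R) : Prop :=
  [/\ abs_continuous 0 t u,
      {ae @lebesgue_measure R, forall s : R, s \in `[0, t] ->
         is_derive s 1 u (L (xi s) (u s) (derive1 xi s))}
    & u 0 = u0].

Definition admissible (R : realType) (n : nat)
    (L : 'rV[R]_n -> R -> 'rV[R]_n -> R) (t : R) (x0 x : 'rV[R]_n) (u0 : R) :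
    set (R -> 'rV[R]_n) :=
  [set xi | Gamma t x0 x xi /\
            exists u, caratheodory_solution L t u0 xi u].

(* For an admissible xi this is the Carathéodory solution, which is unique on
   [0, t]; the values elsewhere play no role. *)
Definition u_sol (R : realType) (n : nat)
    (L : 'rV[R]_n -> R -> 'rV[R]_n -> R) (t u0 : R) (xi : R -> 'rV[R]_n) :
    R -> R :=
  get [set u : R -> R | caratheodory_solution L t u0 xi u].

Definition J (R : realType) (n : nat)
    (L : 'rV[R]_n -> R -> 'rV[R]_n -> R) (t u0 : R) (xi : R -> 'rV[R]_n) : R :=
  \int[@lebesgue_measure R]_(s in `[0, t])
    L (xi s) (u_sol L t u0 xi s) (derive1 xi s).

(* Main.v *)
(* The direct method, with superlinearity replacing reflexivity, set up so that weak
   compactness in L^1 is never needed.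

   Monotonicity: multiplying [u] by exp (K s) turns [L] into a time-dependent
   Lagrangian M that is nondecreasing in [u], and comparison of solutions makes the
   final value of the rescaled [u] an increasing function of the original one.  So it
   suffices to minimize y(t) over pairs (xi, y) with y' = M(s, xi, y, xi').

   Compactness: along a minimizing sequence the lower bound on M yields uniform bounds
   on y and, by superlinearity, uniform absolute continuity of xi.  A limit along an
   ultrafilter on [nat] gives pointwise limits, an absolutely continuous xi* and a
   function y*, which may be discontinuous.

   Semicontinuity: convexity bounds M from below by functions affine in v, whose
   integrals along xi are increments of xi and pass to the limit.  At almost every s
   this bounds from below the difference quotients of y* over intervals straddling s:
   y* is a supersolution along xi*.  Iterating the integral equation monotonically
   below y* gives a genuine solution along xi* that lies below y*, hence a minimizer.

   Absolutely continuous functions are differentiated by means of straddling difference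
   quotients: a Vitali covering argument shows that an absolutely continuous function
   whose straddling quotients are nonnegative in the limit almost everywhere is
   nondecreasing. *)
Require Import Defs.
From mathcomp Require Import finmap all_boot all_order all_algebra.
From mathcomp Require Import all_classical all_reals all_analysis.
From mathcomp Require Import measurable_realfun ring lra.
Import Order.TTheory GRing.Theory Num.Theory.
Import numFieldNormedType.Exports.
Local Open Scope ring_scope.
Local Open Scope classical_set_scope.
Set Implicit Arguments.
Unset Strict Implicit.
Unset Printing Implicit Defensive.

(** * Finite families of intervals *)

Section families.
Context {R : realType}.
Implicit Types (a b c d : R) (S T : seq (R * R)) (p q : R * R).

(** The obstacle is that the running cost depends on the curve through the state as well: along a
    minimizing sequence action may concentrate, and then the limit of the states jumps upwards. All
    estimates are therefore one-sided. Growth bounds y' from below only; y is bounded above by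
    running backwards from the final value, which is bounded along a minimizing sequence, and
    Gronwall's lemma takes the form of a monotonicity statement for [arsinh] of y. In the limit, y*
    plus a linear function is still nondecreasing, which gives the one-sided absolute continuity
    [lower_ac] that the covering argument needs. A supersolution is enough because the solution
    placed below it can only have a smaller final value. The ultrafilter gives limits at all times
    at once, with no Helly selection, but no uniformity: each comparison with an approximating curve
    uses finitely many times, and equicontinuity supplies the rest. Exceptional sets are measured by
    outer measure, so their measurability never has to be shown. *)

Definition apart p q : bool := (p.2 <= q.1) || (q.2 <= p.1).

(** A list of nondegenerate intervals rather than an indexed family, so that complements are again
    lists and permuting, filtering and concatenating are list operations. *)
Definition itv_family a b S : bool :=
  all (fun p => [&& a <= p.1, p.1 < p.2 & p.2 <= b]) S && pairwise apart S.

Definition increments (f : R -> R) S : R := \sum_(p <- S) (f p.2 - f p.1).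

Lemma apart_sym p q : apart p q = apart q p.
Proof. by rewrite /apart orbC. Qed.

Lemma apart_sub p q p' q' : apart p q ->
  p.1 <= p'.1 -> p'.2 <= p.2 -> q.1 <= q'.1 -> q'.2 <= q.2 -> apart p' q'.
Proof.
rewrite /apart => /orP[h|h] h1 h2 h3 h4; apply/orP; [left|right]; lra.
Qed.

Lemma pairwise_perm_sym (T : eqType) (r : rel T) (s1 s2 : seq T) :
  symmetric r -> perm_eq s1 s2 -> pairwise r s1 = pairwise r s2.
Proof.
move=> rC s12; suff H t1 t2 : perm_eq t1 t2 -> pairwise r t1 -> pairwise r t2.
  by apply/idP/idP; [exact: H|apply: H; rewrite perm_sym].
elim: t2 t1 => [|x t2 IH] t1 /=; first by move=> /perm_nilP ->.
move=> t12; have xt1 : x \in t1 by rewrite (perm_mem t12) mem_head.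
case/splitPr: xt1 t12 => u1 u2.
rewrite perm_catC cat_cons perm_cons => t12.
rewrite pairwise_cat /= allrel_consr => /and3P[/andP[xu1 u12] pu1 /andP[xu2 pu2]].
apply/andP; split.
  rewrite -(perm_all _ t12) all_cat xu2/=; apply: sub_all xu1 => y.
  by rewrite rC.
apply: (IH _ t12).
rewrite pairwise_cat pu1 pu2 !andbT; apply/allrelP => y z yu zu.
by rewrite rC; move/allrelP: u12; apply.
Qed.

Lemma itv_family_perm a b S T :
  perm_eq S T -> itv_family a b S = itv_family a b T.
Proof.
move=> ST; rewrite /itv_family (perm_all _ ST).
by rewrite (@pairwise_perm_sym _ _ S T)// => p q; rewrite apart_sym.
Qed.

Lemma increments_perm f S T : perm_eq S T -> increments f S = increments f T.
Proof. by move=> ST; rewrite /increments (perm_big _ ST). Qed.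

Lemma increments_cat f S T :
  increments f (S ++ T) = increments f S + increments f T.
Proof. by rewrite /increments big_cat. Qed.

Lemma increments_cons f p S :
  increments f (p :: S) = f p.2 - f p.1 + increments f S.
Proof. by rewrite /increments big_cons. Qed.

Lemma itv_family_sub a b a' b' S : a' <= a -> b <= b' ->
  itv_family a b S -> itv_family a' b' S.
Proof.
move=> aa' bb' /andP[/allP h ?]; apply/andP; split=> //.
apply/allP => p /h /and3P[? ? ?]; apply/and3P; split; lra.
Qed.

Lemma itv_family_filter a b (P : pred (R * R)) S :
  itv_family a b S -> itv_family a b [seq p <- S | P p].
Proof.
move=> /andP[h1 h2]; apply/andP; split.
  by rewrite all_filter; apply: sub_all h1 => p h; apply/implyP.
by rewrite pairwise_filter.
Qed.

(* Induction on the leftmost interval of the family. *)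
Lemma complement_family a b S : a <= b -> itv_family a b S ->
  exists2 T, itv_family a b T &
    forall f, f b - f a = increments f S + increments f T.
Proof.
move: {2}(size S) (erefl (size S)) => k; elim: k a S => [|k IH] a S.
  move=> /size0nil -> ab _; move: ab; rewrite le_eqVlt => /predU1P[<-|ab].
    by exists [::] => // f; rewrite /increments !big_nil; lra.
  exists [:: (a, b)]; first by rewrite /itv_family/= ab !lexx.
  by move=> f; rewrite /increments big_nil big_seq1/=; lra.
move=> Sk ab famS.
have [p pS pmin] : exists2 p, p \in S & forall q, q \in S -> p.1 <= q.1.
  clear -Sk; elim: S k Sk => // p [|q S] IH k.
    by move=> _; exists p; rewrite ?mem_head// => q; rewrite inE => /eqP ->.
  move=> _; have [r rS rmin] := IH (size S) erefl.
  have [pr|rp] := leP p.1 r.1.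
    exists p; rewrite ?mem_head// => s; rewrite inE => /predU1P[->//|/rmin].
    exact: le_trans.
  exists r; first by rewrite inE rS orbT.
  by move=> s; rewrite inE => /predU1P[->|/rmin//]; exact: ltW.
have permS := perm_to_rem pS.
move: (famS); rewrite (itv_family_perm _ _ permS) => /andP[/= /andP[/and3P[ap p12 pb] hS]].
move=> /andP[apS pwS].
have famS' : itv_family p.2 b (rem p S).
  apply/andP; split=> //; apply/allP => q qS.
  have := allP hS _ qS; have := allP apS _ qS.
  have := pmin q (mem_rem qS).
  rewrite /apart => h1 /orP h2 /and3P[? ? ?]; apply/and3P; split=> //.
  by case: h2 => //; lra.
have [|T famT hT] := IH p.2 (rem p S) _ pb famS'.
  by rewrite size_rem// Sk.
move: ap; rewrite le_eqVlt => /predU1P[ap|ap].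
  exists T; first by apply: itv_family_sub famT => //; lra.
  move=> f; rewrite (increments_perm _ permS) increments_cons -addrA -hT ap; lra.
exists ((a, p.1) :: T).
  apply/andP; split=> /=.
    apply/andP; split; first by apply/and3P; split=> //; lra.
    apply/allP => q qT; case/andP: famT => /allP /(_ _ qT) /and3P[? ? ?] _.
    by apply/and3P; split=> //; lra.
  case/andP: famT => /allP hT' ->; rewrite andbT; apply/allP => q qT.
  by have /and3P[? ? ?] := hT' _ qT; rewrite /apart/=; apply/orP; left; lra.
by move=> f; rewrite (increments_perm _ permS) !increments_cons/=; have := hT f; lra.
Qed.

Definition sub_itv p q : bool := (q.1 <= p.1) && (p.2 <= q.2).

(** Induction on [S]: the members of [T] inside the head [q] are complemented within [q] by
    [complement_family]; the others lie in intervals of the tail. With this, a Vitali family chosen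
    inside another one splits increments exactly. *)
Lemma relative_complement_family a b S T :
  itv_family a b S -> itv_family a b T ->
  (forall p, p \in T -> exists2 q, q \in S & sub_itv p q) ->
  exists2 U, itv_family a b U &
    (forall p, p \in U -> exists2 q, q \in S & sub_itv p q) /\
    forall f, increments f S = increments f T + increments f U.
Proof.
elim: S T => [|q S IH] T famS famT TS.
  exists [::] => //; split=> // f.
  case: T TS {famT} => [|p T] TS; first by rewrite /increments !big_nil addr0.
  by have [] := TS p (mem_head _ _).
case/andP: (famS) => /= /andP[/and3P[aq q12 qb] aS] /andP[apS pwS].
have famS' : itv_family a b S by apply/andP.
have permT : perm_eq T ([seq p <- T | sub_itv p q] ++
    [seq p <- T | predC (sub_itv^~ q) p]) by rewrite perm_sym; apply/permPl/perm_filterC.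
have [|U2 famU2 [U2S hU2]] := IH _ famS' (itv_family_filter (predC (sub_itv^~ q)) famT).
  move=> p; rewrite mem_filter /= => /andP[pq pT].
  have [r] := TS _ pT; rewrite inE => /predU1P[->|rS pr]; first by rewrite (negbTE pq).
  by exists r.
have fam1 : itv_family q.1 q.2 [seq p <- T | sub_itv p q].
  have /andP[h1 h2] := itv_family_filter (sub_itv^~ q) famT.
  apply/andP; split=> //; apply/allP => p pT.
  have /and3P[_ -> _] := allP h1 _ pT.
  by move: pT; rewrite mem_filter => /andP[/andP[-> ->]].
have [U1 famU1 hU1] := complement_family (ltW q12) fam1.
exists (U1 ++ U2).
  case/andP: (famU1) => /allP aU1 pU1; case/andP: famU2 => /allP aU2 pU2.
  apply/andP; split; first rewrite all_cat; last first.
    rewrite pairwise_cat pU1 pU2 !andbT; apply/allrelP => x y xU yU.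
    have [r rS /andP[ry yr]] := U2S _ yU.
    have /and3P[? ? ?] := aU1 _ xU.
    by apply: (apart_sub (allP apS _ rS)).
  apply/andP; split; apply/allP => x.
    move=> /aU1 /and3P[h1 h2 h3]; apply/and3P; split=> //.
      exact: le_trans h1.
    exact: le_trans qb.
  exact: aU2.
split=> [p|f].
  rewrite mem_cat => /orP[pU|/U2S[r rS pr]].
    exists q; first exact: mem_head.
    by case/andP: famU1 => /allP /(_ _ pU) /and3P[? ? ?] _; apply/andP.
  by exists r => //; rewrite inE rS orbT.
rewrite increments_cons hU1 hU2 increments_cat.
by rewrite (increments_perm _ permT) increments_cat; lra.
Qed.

Lemma increments_le a b (f : R -> R) S : a <= b ->
  (forall s s', a <= s -> s <= s' -> s' <= b -> f s <= f s') ->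
  itv_family a b S -> increments f S <= f b - f a.
Proof.
move=> ab fh famS; have [T /andP[/allP aT _] hT] := complement_family ab famS.
rewrite hT lerDl /increments big_seq; apply: sumr_ge0 => p /aT /and3P[? ? ?].
by rewrite subr_ge0; apply: fh => //; exact: ltW.
Qed.

Definition ac_on {V : normedModType R} a b (f : R -> V) :=
  forall e, 0 < e -> exists2 d, 0 < d & forall S, itv_family a b S ->
    increments idfun S < d -> \sum_(p <- S) `|f p.2 - f p.1| < e.

(** Degenerate intervals contribute nothing to either sum and may be filtered out; for nondegenerate
    ones, disjointness of the open intervals is the same as [apart]. *)
Lemma abs_continuousP {V : normedModType R} a b (f : R -> V) :
  abs_continuous a b f <-> ac_on a b f.
Proof.
split=> h e e0; have [d d0 H] := h e e0; exists d => //.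
  move=> S /andP[/allP aS pS] Sd.
  pose I (i : 'I_(size S)) := tnth (in_tuple S) i.
  have := H (size S) I; rewrite /I -!(big_tnth _ _ S predT (fun p => p.2 - p.1)).
  rewrite -!(big_tnth _ _ S predT (fun p => `|f p.2 - f p.1|)); apply=> //.
    by move=> i; have /and3P[? ? ?] := aS _ (mem_tnth i (in_tuple S)); split=> //; split=> //; exact: ltW.
  apply/trivIsetP => i j _ _ ij.
  have pij : apart (tnth (in_tuple S) i) (tnth (in_tuple S) j).
    rewrite !(tnth_nth (0, 0))/=.
    move/(pairwiseP (0, 0)): pS => pS.
    have [ltij|] := ltnP i j; first by apply: pS => //; rewrite inE.
    rewrite leq_eqVlt => /orP[/eqP ji|ltji]; last by rewrite apart_sym; apply: pS => //; rewrite inE.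
    by move: ij; rewrite -(inj_eq val_inj)/= ji eqxx.
  rewrite -subset0 => x /= [] /[!in_itv]/= /andP[? ?] /andP[? ?].
  by case/orP: pij; lra.
move=> m I aI tI Id.
pose S := [seq I i | i <- enum 'I_m & (I i).1 < (I i).2].
have sumS (F : R -> R -> R) : (forall x, F x x = 0) ->
    \sum_(i < m) F (I i).1 (I i).2 = \sum_(p <- S) F p.1 p.2.
  move=> F0; rewrite /S big_map big_filter big_enum_cond /=.
  rewrite (bigID (fun i => (I i).1 < (I i).2))/= [X in _ + X]big1 ?addr0// => i.
  rewrite -leNgt => ii; have [_ [ii' _]] := aI i.
  by rewrite (@le_anti _ _ (I i).1 (I i).2) ?F0//; apply/andP.
rewrite (sumS (fun x y => `|f y - f x|)); last by move=> x; rewrite subrr normr0.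
apply: H; last first.
  by rewrite /increments /= -(sumS (fun x y => y - x))// => x; rewrite subrr.
apply/andP; split.
  apply/allP => p /mapP[i]; rewrite mem_filter => /andP[ii _] ->.
  by have [? [? ?]] := aI i; apply/and3P.
rewrite /S pairwise_map.
apply: (@sub_in_pairwise _ [pred i | (I i).1 < (I i).2] [rel x y | x != y]); last first.
- by rewrite -uniq_pairwise filter_uniq// enum_uniq.
- by apply/allP => i; rewrite mem_filter => /andP[].
move=> i j /[!inE] ii jj /= ij.
rewrite /apart; apply/negPn/negP; rewrite negb_or -!ltNge => /andP[h1 h2].
move/trivIsetP: tI => /(_ i j Logic.I Logic.I ij).
apply/eqP/set0P.
(* If two intervals were not apart, the midpoint of their overlap would lie in both. *)
exists ((Num.max (I i).1 (I j).1 + Num.min (I i).2 (I j).2) / 2).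
split; rewrite /= in_itv/=; case: (leP (I i).1 (I j).1); case: (leP (I i).2 (I j).2) => *; apply/andP; split; lra.
Qed.

End families.

(** * Vitali coverings and almost everywhere differentiability *)

Section vitali.
Context {R : realType}.
Implicit Types (a b c d : R) (S T : seq (R * R)) (p q : R * R) (A O : set R).
Local Notation mu := (@lebesgue_measure R).
Local Notation lam := ((wlength idfun)^*%mu : set R -> \bar R).

(** Open intervals, so that a further Vitali family can be chosen inside this set. *)
Definition int_union S : set R := [set x | exists2 p, p \in S & p.1 < x < p.2].

Lemma int_unionE S : int_union S = \big[setU/set0]_(p <- S) `]p.1, p.2[.
Proof.
rewrite -bigcup_seq; apply/seteqP; split=> x /=.
  by move=> [p pS xp]; exists p => //=; rewrite in_itv.
by move=> [p pS]; rewrite /= in_itv => xp; exists p.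
Qed.

Lemma increments_ge0 a b S : itv_family a b S -> 0 <= increments idfun S.
Proof.
move=> /andP[/allP aS _]; rewrite /increments big_seq sumr_ge0// => p /aS.
by move=> /and3P[_ ? _]; rewrite subr_ge0 ltW.
Qed.

Lemma measure_int_union a b S : itv_family a b S ->
  mu (int_union S) = (increments idfun S)%:E.
Proof.
elim: S => [|p S IH]; first by rewrite int_unionE /increments !big_nil measure0.
move=> /andP[/= /andP[/and3P[? p12 ?] aS] /andP[apS pS]].
rewrite int_unionE big_cons measureU//=.
- rewrite increments_cons EFinD -IH; last by apply/andP.
  by rewrite -int_unionE lebesgue_measure_itv/= lte_fin p12 EFinN.
- by apply: bigsetU_measurable.
- rewrite -int_unionE -subset0 => x [/=]; rewrite in_itv/= => xp [q qS xq].
  by move/allP: apS => /(_ _ qS); rewrite /apart => /orP[]; lra.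
Qed.

Lemma lam_int_union a b S : itv_family a b S ->
  lam (int_union S) = (increments idfun S)%:E.
Proof. by move=> /measure_int_union <-. Qed.

Lemma increments_le_measure a b S A (e : R) : itv_family a b S ->
  int_union S `<=` A -> (lam A <= e%:E)%E -> increments idfun S <= e.
Proof.
move=> famS SA Ae; rewrite -lee_fin -(lam_int_union famS).
by apply: le_trans Ae; exact: le_outer_measure.
Qed.

Lemma measure_le_increments a b S A (e : R) : itv_family a b S ->
  (lam (A `\` int_union S) <= e%:E)%E ->
  (lam A <= (increments idfun S + e)%:E)%E.
Proof.
move=> famS h; rewrite EFinD -(lam_int_union famS).
apply: (@le_trans _ _ (lam (int_union S `|` (A `\` int_union S)))).
  by apply: le_outer_measure => x Ax; case: (pselect (int_union S x)); [left|right].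
apply: le_trans (outer_measureU2 _ _ _) _.
exact: leeD2l.
Qed.

(** Enumerates the rational centres and positive rational radii; codes that decode to nothing or to
    a nonpositive radius go to the dummy ball of centre 0 and radius 1. *)
Let cr (k : nat) : rat * rat :=
  if (unpickle k : option (rat * rat)) is Some u
  then (if 0 < u.2 then u else (0, 1)) else (0, 1).

Let cr_gt0 k : (0 < (cr k).2).
Proof. by rewrite /cr; case: unpickle => [u|//]; case: ifP. Qed.

Definition rat_itv (c r : rat) : R * R := (ratr c - ratr r, ratr c + ratr r).

(* Only intervals with rational centre and radius are used, because the
   library's covering theorem takes a countable family of balls. *)
Lemma vitali_family a b A O (P : R -> R -> Prop) (e : R) :
  0 < e -> open O -> A `<=` O -> O `<=` `]a, b[ ->
  (forall s d, A s -> 0 < d -> exists c r : rat,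
     [/\ 0 < r, (ratr r : R) < d, `|s - ratr c| < ratr r &
         P (rat_itv c r).1 (rat_itv c r).2]) ->
  exists S, [/\ itv_family a b S, int_union S `<=` O,
    (forall p, p \in S -> P p.1 p.2) &
    (lam (A `\` int_union S) < e%:E)%E].
Proof.
move=> e0 oO AO Oab HP.
pose B k : set R := ball (ratr (cr k).1 : R) (ratr (cr k).2 : R).
have r0 k : (0 : R) < ratr (cr k).2 by rewrite ltr0q cr_gt0.
have radB k : (radius (B k))%:num = ratr (cr k).2.
  by rewrite /B radius_ball_num// ltW.
pose F : set nat := [set k | P (rat_itv (cr k).1 (cr k).2).1 (rat_itv (cr k).1 (cr k).2).2 /\
   closure (B k) `<=` O].
have clB k : closure (B k) = `[(rat_itv (cr k).1 (cr k).2).1, (rat_itv (cr k).1 (cr k).2).2].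
  by rewrite closure_ballE closed_ball_itv.
have B0 k : 0 < (radius (B k))%:num by rewrite radB.
have vit : vitali_cover A B F.
  split; first by move=> i; exact: is_ball_ball.
  move=> x Ax d d0.
  have [d1 /= d10 xd1] := open_subball oO (AO _ Ax).
  (* With radius below [d1 / 4], a closed ball around a centre that close to [x] stays within
     distance [d1 / 2] of [x], hence in [O]. *)
  have m0 : 0 < Num.min d (d1 / 4) by rewrite lt_min d0/= divr_gt0.
  have [c [r [r00 rd xc Pcr]]] := HP x _ Ax m0.
  move: rd; rewrite lt_min => /andP[rd rd1].
  have [k crE] : exists k, cr k = (c, r).
    by exists (pickle (c, r)); rewrite /cr pickleK/= r00.
  exists k; split.
  - rewrite /F/= crE; split=> // y; rewrite clB crE /= in_itv/= => /andP[y1 y2].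
    have d120 : 0 < d1 / 2 by rewrite divr_gt0.
    apply: (xd1 (d1 / 2)) => //=.
      by rewrite sub0r normrN gtr0_norm//; lra.
    move: xc; rewrite /ball/= !ltr_norml => /andP[? ?]; apply/andP; split; lra.
  - by rewrite /B crE /ball/= distrC.
  - by rewrite radB crE.
have muA : (lam A < +oo)%E.
  apply: (@le_lt_trans _ _ (mu `]a, b[)).
    apply: le_outer_measure; exact: subset_trans Oab.
  by rewrite lebesgue_measure_itv/=; case: ifP => // _; rewrite -EFinB ltry.
have [G [GF tG GE]] := vitali_theorem_corollary B0 muA vit e0.
pose S := [seq rat_itv (cr k).1 (cr k).2 | k <- enum_fset G].
have SO x p : p \in S -> p.1 <= x <= p.2 -> O x.
  move=> /mapP[k kG ->] xk; have [_] := GF k kG; apply.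
  by rewrite clB /= in_itv.
have SP p : p \in S -> P p.1 p.2.
  by move=> /mapP[k kG ->]; have [] := GF k kG.
have S12 p : p \in S -> p.1 < p.2.
  by move=> /mapP[k kG ->] /=; have := r0 k; lra.
have famS : itv_family a b S.
  apply/andP; split.
    apply/allP => p pS; have p12 := S12 _ pS.
    have := Oab _ (SO p.1 _ pS _); rewrite lexx (ltW p12)/= in_itv/= => /(_ isT).
    have := Oab _ (SO p.2 _ pS _); rewrite lexx (ltW p12)/= in_itv/= => /(_ isT).
    by move=> /andP[_ /ltW ->] /andP[/ltW -> _]; rewrite p12.
  rewrite pairwise_map.
  apply: (@sub_in_pairwise _ [pred k | k \in enum_fset G] [rel x y | x != y]); last first.
  - by rewrite -uniq_pairwise fset_uniq.
  - by apply/allP => i.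
  move=> i j iG jG /= ij.
  rewrite /relpre /apart; apply/negPn/negP; rewrite negb_or -!ltNge => /andP[/= h1 h2].
  move/trivIsetP: tG => /(_ i j iG jG ij)/=.
  apply/eqP/set0P; rewrite !clB.
  exists (Num.max (rat_itv (cr i).1 (cr i).2).1 (rat_itv (cr j).1 (cr j).2).1).
  have := r0 i; have := r0 j.
  split; rewrite /= in_itv/= le_max lexx ?orbT/= ge_max /=; lra.
exists S; split=> //.
  by move=> x [p pS /andP[x1 x2]]; apply: (SO x p pS); rewrite !ltW.
(* The covering theorem speaks of closed balls, the family of open intervals; they differ by the
   finite set of endpoints, which is null. *)
pose ends : set R := [set` [seq p.1 | p <- S] ++ [seq p.2 | p <- S]].
have lamends : lam ends = 0%E.
  by apply: (@countable_lebesgue_measure0 R); apply: finite_set_countable; exact: finite_seq.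
apply: le_lt_trans GE.
rewrite -[leRHS]adde0 -lamends.
apply: le_trans (outer_measureU2 _ _ _).
apply: le_outer_measure => x [Ax xS].
case: (pselect (ends x)) => xe; [by right|left]; split=> //.
rewrite -bigcup_seq => -[k /= kG]; rewrite clB /= in_itv/= => xk.
have kS : rat_itv (cr k).1 (cr k).2 \in S by apply: map_f.
move: xe; rewrite /ends /= mem_cat => /negP; rewrite negb_or => /andP[e1 e2].
apply: xS; exists (rat_itv (cr k).1 (cr k).2) => //.
case/andP: xk => xk1 xk2; rewrite !lt_neqAle xk1 xk2 !andbT.
apply/andP; split.
  by apply: contra e1 => /eqP <-; apply/mapP; exists (rat_itv (cr k).1 (cr k).2).
by apply: contra e2 => /eqP ->; apply/mapP; exists (rat_itv (cr k).1 (cr k).2).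
Qed.

End vitali.

(** * Monotonicity from straddling difference quotients *)

Section straddle.
Context {R : realType}.
Implicit Types (a b c d s : R) (S T : seq (R * R)) (p q : R * R) (A O : set R).
Local Notation mu := (@lebesgue_measure R).
Local Notation lam := ((wlength idfun)^*%mu : set R -> \bar R).

Lemma ae_sub (P Q : R -> Prop) : (forall s, P s -> Q s) ->
  {ae mu, forall s, P s} -> {ae mu, forall s, Q s}.
Proof. by move=> PQ; apply: filterS; first exact: (ae_filter_ringOfSetsType mu). Qed.

Lemma ae_and (P Q : R -> Prop) : {ae mu, forall s, P s} ->
  {ae mu, forall s, Q s} -> {ae mu, forall s, P s /\ Q s}.
Proof. by move=> hP hQ; apply: filterI => //; exact: (ae_filter_ringOfSetsType mu). Qed.

(** The lower straddling derivate of [g] at [s] is at least [c]; an upward jump at [s] does no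
    harm. *)
Definition straddle_ge (g : R -> R) s c := forall e, 0 < e ->
  exists2 d, 0 < d & forall x y, s - d < x -> x <= s -> s <= y -> y < s + d ->
    (c - e) * (y - x) <= g y - g x.

(** Absolute continuity from below: short families cannot lose much, while upward jumps are allowed,
    since limits of states may have them. *)
Definition lower_ac a b (g : R -> R) := forall e, 0 < e ->
  exists2 d, 0 < d & forall S, itv_family a b S ->
    increments idfun S < d -> - e < increments g S.

Lemma rat_itv_near x y s e : x <= s -> s <= y -> 0 < e ->
  exists c r : rat, [/\ 0 < r, `|s - ratr c| < ratr r,
    x - e < (rat_itv c r).1 < x & y < (rat_itv c r).2 < y + e].
Proof.
move=> xs sy e0.
have [u] : exists u : rat, (ratr u : R) \in `]x - e, x[%R by apply: rat_in_itvoo; lra.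
rewrite in_itv/= => ux.
have [v] : exists v : rat, (ratr v : R) \in `]y, y + e[%R by apply: rat_in_itvoo; lra.
rewrite in_itv/= => vy.
have H1 : (@rat_itv R ((u + v) / 2) ((v - u) / 2)).1 = ratr u.
  by rewrite /rat_itv/= -rmorphB/=; congr ratr; lra.
have H2 : (@rat_itv R ((u + v) / 2) ((v - u) / 2)).2 = ratr v.
  by rewrite /rat_itv/= -rmorphD/=; congr ratr; lra.
exists ((u + v) / 2), ((v - u) / 2); rewrite /= in H1 H2; rewrite /= H1 H2; split=> //.
  have : (ratr u : R) < ratr v by lra.
  by rewrite ltr_rat => ?; lra.
by rewrite ltr_norml; apply/andP; split; lra.
Qed.

Lemma lam_le_full a b A : a <= b -> A `<=` `]a, b[ ->
  {ae mu, forall s, a < s < b -> A s} -> lam A = (b - a)%:E.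
Proof.
move=> ab Aab [N [mN N0 NA]].
have lamab : lam `]a, b[ = (b - a)%:E.
  have : mu `]a, b[ = (b - a)%:E.
    rewrite lebesgue_measure_itv/= lte_fin; case: ltP => ba; first by rewrite -EFinB.
    by congr EFin; lra.
  by [].
apply/eqP; rewrite eq_le -lamab le_outer_measure//=.
have lamN : lam N = 0%E by exact: N0.
rewrite -[leRHS]adde0 -lamN; apply: le_trans (outer_measureU2 _ _ _).
apply: le_outer_measure => x xab; case: (pselect (A x)); [by left|right].
by apply: NA => /= /(_ xab).
Qed.

(** A Vitali family fills almost all of [a, b] with intervals on which [g] drops at slope at most
    [e]; the complementary family is shorter than [d], so [g] drops there by less than [e]. The
    total drop tends to 0 with [e]. *)
Lemma ae_straddle_ge0 a b g : a <= b -> lower_ac a b g ->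
  {ae mu, forall s, a < s < b -> straddle_ge g s 0} -> g a <= g b.
Proof.
move=> ab lacg ae.
suff H e : 0 < e -> - e * (b - a) - e <= g b - g a.
  rewrite leNgt; apply/negP => ba.
  (* The [e] below makes the permitted drop e (b - a) + e equal to half of the assumed drop
     [g a - g b]. *)
  have ba1 : 0 < b - a + 1 by lra.
  have [e0 ed] : 0 < (g a - g b) / (2 * (b - a + 1)) /\
      (g a - g b) / (2 * (b - a + 1)) * (b - a + 1) = (g a - g b) / 2.
    by split; [apply: divr_gt0; lra|field; lra].
  by have := H _ e0; move: ed; nra.
move=> e0; have [d d0 Hd] := lacg _ e0.
pose A := [set s | a < s < b /\ straddle_ge g s 0].
have d20 : 0 < d / 2 by lra.
have Aab : A `<=` `]a, b[ by move=> s [].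
have [||S [famS _ SP SA]] := @vitali_family R a b A `]a, b[
  (fun x y => - e * (y - x) <= g y - g x) _ d20 _ Aab (@subset_refl _ _).
- exact: interval_open.
- move=> s r [_ /(_ _ e0)[d1 d10 Hd1] r0].
  have m0 : 0 < Num.min (r / 2) d1 by rewrite lt_min; apply/andP; split; lra.
  have [c [q [q0 sq]]] := rat_itv_near (lexx s) (lexx s) m0.
  rewrite /rat_itv/= => /andP[h1 h2] /andP[h3 h4].
  have m1 : Num.min (r / 2) d1 <= d1 by rewrite ge_min lexx orbT.
  have m2 : Num.min (r / 2) d1 <= r / 2 by rewrite ge_min lexx.
  exists c, q; split=> //; first lra.
  rewrite -[- e]add0r; apply: Hd1; lra.
have [T famT hT] := complement_family ab famS.
have : (lam A <= (increments idfun S + d / 2)%:E)%E.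
  by apply: measure_le_increments famS _; exact: ltW.
rewrite (lam_le_full ab Aab); last first.
  by apply: ae_sub ae => s h sab; split=> //; exact: h.
rewrite lee_fin => baS.
have Td : increments idfun T < d by have /= := hT idfun; lra.
have gT := Hd _ famT Td.
have gS : - e * increments idfun S <= increments g S.
  rewrite /increments mulr_sumr big_seq [leRHS]big_seq; apply: ler_sum => p pS.
  exact: SP.
have := hT idfun; have := hT g; have := increments_ge0 famT.
by move=> /=; nra.
Qed.

Lemma ac_on_uniform {V : normedModType R} a b (f : R -> V) : ac_on a b f ->
  forall e, 0 < e -> exists2 d, 0 < d & forall x y, a <= x -> x <= y -> y <= b ->
    y - x < d -> `|f y - f x| < e.
Proof.
move=> acf e e0; have [d d0 H] := acf e e0; exists d => // x y ax.
rewrite le_eqVlt => /predU1P[->|xy] yb yxd; first by rewrite subrr normr0.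
have := H [:: (x, y)]; rewrite /increments !big_seq1/=; apply=> //.
by rewrite /itv_family/= ax xy yb.
Qed.

(** The upper straddling derivate of [f] at [s] is at least [r], tested on rational intervals, in
    the form that [vitali_family] takes. *)
Definition upper_ge (f : R -> R) s r := forall d, 0 < d -> exists c q : rat,
  [/\ 0 < q, (ratr q : R) < d, `|s - ratr c| < ratr q &
    r * ((rat_itv c q).2 - (rat_itv c q).1) < f (rat_itv c q).2 - f (rat_itv c q).1].

(** The negation speaks of rational intervals; continuity of [f] carries the bound to all straddling
    intervals, which are approximated by rational ones from outside. *)
Lemma not_upper_ge a b f s r : ac_on a b f -> a < s < b -> ~ upper_ge f s r ->
  exists2 d, 0 < d & forall x y, s - d < x -> x <= s -> s <= y -> y < s + d ->
    f y - f x <= r * (y - x).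
Proof.
move=> acf /andP[sa sb] nup.
have [d d0 Hd] : exists2 d, 0 < d & forall c q : rat, 0 < q -> (ratr q : R) < d ->
    `|s - ratr c| < ratr q -> f (rat_itv c q).2 - f (rat_itv c q).1 <=
     r * ((rat_itv c q).2 - (rat_itv c q).1).
  apply: contrapT => h; apply: nup => d d0.
  apply: contrapT => h'; apply: h; exists d => // c q q0 qd scq.
  by rewrite leNgt; apply/negP => h2; apply: h'; exists c, q.
pose d1 := Num.min (d / 4) (Num.min ((s - a) / 2) ((b - s) / 2)).
have [d10 d1d d1a d1b] : [/\ 0 < d1, d1 <= d / 4, d1 <= (s - a) / 2 & d1 <= (b - s) / 2].
  rewrite /d1; split; rewrite ?lt_min ?ge_min ?lexx ?orbT//.
  by apply/and3P; split; lra.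
clearbody d1.
exists d1 => // x y xs1 xs sy sy1.
rewrite leNgt; apply/negP => xy.
pose k := f y - f x - r * (y - x).
have k0 : 0 < k by rewrite subr_gt0.
have k40 : 0 < k / 4 by lra.
have [d2 d20 Hd2] := ac_on_uniform acf k40.
(* If the bound failed by [k], moving both endpoints by less than [e] would change each value of [f]
   by less than k / 4 and r (y - x) by at most k / 2, so the bound would fail on a rational interval
   too. *)
pose e := Num.min d1 (Num.min d2 (k / (4 * (`|r| + 1)))).
have r1 : 0 < 4 * (`|r| + 1) by have := normr_ge0 r; lra.
have [e0 ed1 ed2 ek] : [/\ 0 < e, e <= d1, e <= d2 & e <= k / (4 * (`|r| + 1))].
  rewrite /e; split; rewrite ?ge_min ?lexx ?orbT//.
  by rewrite !lt_min d10 d20 divr_gt0.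
clearbody e.
have [c [q [q0 scq]]] := rat_itv_near xs sy e0.
move=> /andP[c1 c2] /andP[c3 c4].
have := Hd c q q0 _ scq; move: c1 c2 c3 c4; rewrite /rat_itv/=.
set x' := ratr c - ratr q; set y' := ratr c + ratr q => c1 c2 c3 c4.
have qE : (ratr q : R) = (y' - x') / 2 by rewrite /x' /y'; lra.
have qd : (ratr q : R) < d by rewrite qE; lra.
move=> /(_ qd).
have fx : `|f x - f x'| < k / 4 by apply: Hd2; lra.
have fy : `|f y' - f y| < k / 4 by apply: Hd2; lra.
have : r * (y' - x') <= r * (y - x) + k / 2.
  have : `|r * ((y' - y) + (x - x'))| <= k / 2.
    rewrite normrM [X in _ * X]gtr0_norm; last lra.
    apply: (@le_trans _ _ (`|r| * (2 * e))).
      by rewrite ler_wpM2l//; lra.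
    move: ek; rewrite ler_pdivlMr// => ek.
    by have := normr_ge0 r; nra.
  by rewrite ler_norml => /andP[_ ?]; nra.
move: fx fy; rewrite !ltr_norml /k => /andP[? ?] /andP[? ?]; lra.
Qed.

End straddle.

Section straddle_diff.
Context {R : realType}.

Definition straddle_diff {V : normedModType R} (f : R -> V) s D :=
  forall e, 0 < e -> exists2 d, 0 < d &
    forall x y, s - d < x -> x <= s -> s <= y -> y < s + d ->
      `|f y - f x - (y - x) *: D| <= e * (y - x).

(** Because [s] lies between [x] and [y], the errors at the two endpoints add up to exactly e (y -
    s) + e (s - x) = e (y - x). The converse takes [s] as one of the endpoints. *)
Lemma straddle_diffP {V : normedModType R} (f : R -> V) (s : R) D :
  is_derive s 1 f D <-> straddle_diff f s D.
Proof.
split=> [[df Df] e e0|h].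
  have : h^-1 *: (f (h *: (1 : R) + s) - f s) @[h --> 0^'] --> D.
    by rewrite -Df; exact: df.
  move=> /cvgrPdist_le /(_ _ e0)[d /= d0 H].
  have K h : `|h| < d -> `|f (s + h) - f s - h *: D| <= e * `|h|.
    move=> hd; have [->|h0] := eqVneq h 0.
      by rewrite addr0 subrr scale0r subrr !normr0 mulr0.
    have := H h _ h0; rewrite /ball_/= sub0r normrN => /(_ hd).
    rewrite -(ler_pM2r (_ : 0 < `|h|)) ?normr_gt0//.
    rewrite mulrC -normrZ scalerBr scalerA divff// scale1r distrC.
    by rewrite [h *: 1]mulr1 [h + s]addrC.
  exists d => // x y xs1 xs2 ys1 ys2.
  have /K K1 : `|y - s| < d by rewrite ger0_norm; lra.
  have /K K2 : `|x - s| < d by rewrite ler0_norm; lra.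
  rewrite !subrKC in K1 K2.
  have -> : f y - f x - (y - x) *: D =
      (f y - f s - (y - s) *: D) - (f x - f s - (x - s) *: D).
    have -> : y - x = (y - s) - (x - s) by lra.
    rewrite scalerBl -[f y - f x](subrKA (f s)) -[f s - f x]opprB.
    by rewrite !opprD !opprK addrACA.
  apply: le_trans (ler_normB _ _) _.
  have -> : y - x = (y - s) + (s - x) by lra.
  move: K1 K2; rewrite [ `|y - s|]ger0_norm ?[ `|x - s|]ler0_norm; [|lra|lra].
  by move=> K1 K2; rewrite mulrDr lerD// -[s - x]opprB.
have cv : h^-1 *: (f (h *: (1 : R) + s) - f s) @[h --> 0^'] --> D.
  apply/cvgrPdist_le => e e0; have [d d0 Hd] := h _ e0.
  exists d => //= k; rewrite /ball_/= sub0r normrN => kd k0.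
  rewrite -(ler_pM2r (_ : 0 < `|k|)) ?normr_gt0//.
  rewrite mulrC -normrZ scalerBr scalerA divff// scale1r distrC.
  rewrite [k *: 1]mulr1.
  move: kd k0; rewrite ltr_norml neq_lt => /andP[? ?] /orP[k0|k0].
    have := Hd (k + s) s; rewrite [ `|k|]ltr0_norm//.
    have -> : s - (k + s) = - k by lra.
    by rewrite scaleNr opprK addrC -normrN opprD opprB addrC; apply; lra.
  have := Hd s (k + s); rewrite [ `|k|]gtr0_norm// addrK; apply; lra.
apply: DeriveDef; first by apply/cvg_ex; exists D.
exact/cvg_lim.
Qed.

End straddle_diff.

(** * Lebesgue's differentiation theorem for absolutely continuous functions *)

Section null_sets.
Context {R : realType}.
Implicit Types (a b c d s : R) (S T : seq (R * R)) (p q : R * R) (A O : set R).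
Local Notation mu := (@lebesgue_measure R).
Local Notation lam := ((wlength idfun)^*%mu : set R -> \bar R).

Lemma lam_fin a b A : A `<=` `]a, b[ -> exists2 m : R, 0 <= m & lam A = m%:E.
Proof.
move=> Aab.
have : (lam A <= mu `]a, b[)%E by exact: le_outer_measure.
have : (0 <= lam A)%E by exact: outer_measure_ge0.
have : (mu `]a, b[ < +oo)%E.
  by rewrite lebesgue_measure_itv/=; case: ifP => // _; rewrite -EFinB ltry.
case: (lam A) => [m||] //; first by rewrite lee_fin => _ m0 _; exists m.
by move=> h _ /le_lt_trans/(_ h); rewrite ltxx.
Qed.

Lemma increments_normr (f : R -> R) S :
  `|increments f S| <= \sum_(p <- S) `|f p.2 - f p.1|.
Proof. exact: ler_norm_sum. Qed.

(** If arbitrarily large slopes occurred on a set of outer measure m > 0, intervals of slope above 2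
    / m covering half of it would raise [f] by at least 1 over a family too short for that. *)
Lemma upper_infty_null a b f : ac_on a b f ->
  {ae mu, forall s, a < s < b -> exists r, ~ upper_ge f s r}.
Proof.
move=> acf; have [d d0 Hd] := acf 1 ltr01.
(* Windows of length d / 2 at step d / 4: they overlap, so each [s] lies strictly inside one, and a
   family inside one window is shorter than [d]. *)
pose A (k : nat) := [set s | [/\ a < s < b, a + (k%:R - 1) * (d / 4) < s,
   s < a + (k%:R - 1) * (d / 4) + d / 2 & forall r, upper_ge f s r]].
suff H k : lam (A k) = 0%E.
  have : mu.-negligible (\bigcup_k A k).
    by apply: negligible_bigcup => k; exact/negligible_outer_measure.
  apply: negligibleS => s /= /not_implyP[/andP[sa sb] /forallNP h].
  have x0 : 0 <= (s - a) / (d / 4) by apply: divr_ge0; lra.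
  have /andP[h1 h2] := truncn_itv x0.
  move: h1 h2; rewrite ler_pdivlMr ?ltr_pdivrMr; [|lra|lra].
  set k := Num.truncn _; rewrite -[k.+1%:R]natr1 => h1 h2.
  exists k => //; split; [by rewrite sa sb|nra|nra|].
  by move=> r; apply: contrapT; exact: h.
have Aab : A k `<=` `]a, b[ by move=> s []; rewrite /= in_itv.
have [m m0 mE] := lam_fin Aab; rewrite mE; congr EFin.
apply/eqP; rewrite eq_le m0 andbT leNgt; apply/negP => {}m0.
pose l : R := a + (k%:R - 1) * (d / 4); pose u : R := l + d / 2.
pose O : set R := `]a, b[ `&` `]l, u[.
have m20 : 0 < m / 2 by lra.
have [|s|s []|s e []|S [famS SO SP SA]] := @vitali_family R a b (A k) O
  (fun x y => 2 / m * (y - x) < f y - f x) _ m20.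
- by apply: openI; exact: interval_open.
- by move=> [/= h1 h2 h3 _]; split => /=; rewrite in_itv/= ?h2.
- by [].
- by move=> _ _ _ /(_ (2 / m) e).
have Sd : increments idfun S <= d / 2.
  apply: (@increments_le_measure _ _ _ _ `]l, u[ _ famS).
    by apply: subset_trans SO _ => s [].
  have : (mu `]l, u[ <= (d / 2)%:E)%E.
    rewrite lebesgue_measure_itv/= lte_fin /u ifT; last by lra.
    by rewrite -EFinB lee_fin; lra.
  by [].
have mS : m <= increments idfun S + m / 2.
  rewrite -lee_fin -mE; apply: (measure_le_increments famS); exact: ltW.
have := Hd _ famS; have /[swap] /[apply] : increments idfun S < d by lra.
have : 2 / m * increments idfun S <= increments f S.
  rewrite /increments mulr_sumr big_seq [leRHS]big_seq; apply: ler_sum => p pS.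
  exact/ltW/SP.
have : 1 <= 2 / m * increments idfun S.
  rewrite -ler_pdivrMl ?divr_gt0// invf_div mulr1; lra.
have := increments_normr f S; have := ler_norm (increments f S).
lra.
Qed.

(** The exceptional set [E] is covered twice: by [I], where [f] grows with slope at most [q], and
    inside [I] by [J], where the slope is at least [r]. Both have length close to the outer measure
    of [E], so the family between them is short, and absolute continuity makes the two growth rates
    incompatible. *)
Lemma upper_lower_null a b (f : R -> R) (r q : R) : ac_on a b f -> q < r ->
  {ae mu, forall s, a < s < b -> upper_ge f s r ->
     ~ upper_ge (fun s => - f s) s (- q)}.
Proof.
move=> acf qr.
pose E := [set s | [/\ a < s < b, upper_ge f s r & upper_ge (fun s => - f s) s (- q)]].
suff lamE : lam E = 0%E.
  have : mu.-negligible E by apply/negligible_outer_measure.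
  apply: negligibleS => s /= /not_implyP[sab /not_implyP[h1 h2]].
  by split=> //; exact: contrapT.
have Eab : E `<=` `]a, b[ by move=> s [].
have [m m0 mE] := lam_fin Eab; rewrite mE; congr EFin.
apply/eqP; rewrite eq_le m0 andbT leNgt; apply/negP => {}m0.
have rq0 : 0 < (r - q) * m / 4 by rewrite divr_gt0// mulr_gt0// subr_gt0.
have [d d0 Hd] := acf _ rq0.
have q1 : 0 < 12 * (`|q| + 1) by have := normr_ge0 q; lra.
(* The three bounds ensure in turn that [J] has length at least 3 m / 4, that the relative
   complement [U], of length at most 3 e, is shorter than [d], and that |q| times 3 e is at most (r
   - q) m / 4. *)
pose e := Num.min (m / 8) (Num.min (d / 4) ((r - q) * m / (12 * (`|q| + 1)))).
have [e0 em ed eq] : [/\ 0 < e, e <= m / 8, e <= d / 4 & e * (12 * (`|q| + 1)) <= (r - q) * m].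
  rewrite -ler_pdivlMr// /e; split; rewrite ?ge_min ?lexx ?orbT//.
  rewrite !lt_min; apply/and3P; split; [lra|lra|].
  by rewrite divr_gt0// mulr_gt0// subr_gt0.
clearbody e.
have [W [oW EW WE]] := outer_measure_open_le E e0.
pose O : set R := W `&` `]a, b[.
have oO : open O by apply: openI => //; exact: interval_open.
have EO : E `<=` O by move=> s Es; split; [exact: EW|exact: Eab].
have Oab : O `<=` `]a, b[ by move=> s [].
have lamO : (lam O <= (m + e)%:E)%E.
  apply: (@le_trans _ _ (lam W)); first by apply: le_outer_measure => s [].
  by apply: le_trans WE _; rewrite mE EFinD.
have [|I [famI IO IP IE]] := @vitali_family R a b E O
  (fun x y => (- q) * (y - x) < - f y - - f x) _ e0 oO EO Oab.
  by move=> s k [_ _ /(_ k)] h /h.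
have [||J [famJ JO JP JE]] := @vitali_family R a b (E `&` int_union I) (int_union I)
  (fun x y => r * (y - x) < f y - f x /\ exists2 p, p \in I & sub_itv (x, y) p) _ e0 _ (@subIsetr _ _ _) (subset_trans IO Oab).
- by rewrite int_unionE -bigcup_seq; apply: bigcup_open => p _; exact: interval_open.
- move=> s k [[_ Es _] [p pI /andP[ps sp]]] k0.
  have k10 : 0 < Num.min k (Num.min ((s - p.1) / 2) ((p.2 - s) / 2)).
    by rewrite !lt_min k0/=; apply/andP; split; lra.
  have [c [v [v0 vk sv H]]] := Es _ k10; exists c, v.
  move: vk; rewrite !lt_min => /and3P[vk vp1 vp2]; split=> //; split=> //.
  exists p => //; move: sv; rewrite ltr_norml => /andP[? ?].
  by apply/andP; rewrite /rat_itv/=; split; lra.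
have I1 : increments idfun I <= m + e by exact: (increments_le_measure famI IO lamO).
have J1 : m - 2 * e <= increments idfun J.
  have H1 : (lam (E `&` int_union I) <= (increments idfun J + e)%:E)%E.
    by apply: (measure_le_increments famJ); exact: ltW.
  have H2 : (lam E <= lam (E `&` int_union I) + lam (E `\` int_union I))%E.
    apply: le_trans (outer_measureU2 _ _ _); apply: le_outer_measure => s Es.
    by case: (pselect (int_union I s)); [left|right].
  have H3 : (lam E <= (increments idfun J + e + e)%:E)%E.
    by apply: le_trans H2 _; rewrite EFinD; apply: leeD => //; exact: ltW.
  by move: H3; rewrite mE lee_fin; lra.
have [|U famU [_ hU]] := relative_complement_family famI famJ.
  by move=> p pJ; have [_] := JP _ pJ; case: p pJ.
have Ud : increments idfun U < d by have /= := hU idfun; lra.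
have := Hd _ famU Ud.
have qI : increments f I <= q * increments idfun I.
  rewrite /increments mulr_sumr big_seq [leRHS]big_seq; apply: ler_sum => p pI.
  by have := IP _ pI => /=; lra.
have rJ : r * increments idfun J <= increments f J.
  rewrite /increments mulr_sumr big_seq [leRHS]big_seq; apply: ler_sum => p pJ.
  by have [/= h _] := JP _ pJ; exact: ltW.
have := increments_normr f U; rewrite ler_norml => /andP[U1 _].
have U0 := increments_ge0 famU.
have := hU f; have /= := hU idfun.
set iI := increments idfun I in qI I1 *; set iJ := increments idfun J in rJ J1 *.
set iU := increments idfun U in Ud U0 *.
move=> iE fE U2.
have qU : q * iU <= `|q| * (3 * e).
  apply: (@le_trans _ _ (`|q| * iU)); first by rewrite ler_wpM2r// ler_norm.
  by rewrite ler_wpM2l//; lra.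
have : r * iJ - (r - q) * m / 4 < q * iJ + q * iU by rewrite -mulrDr -iE; lra.
have qn := normr_ge0 q.
have : `|q| * (3 * e) <= (r - q) * m / 4 by nra.
have : (r - q) * (m - 2 * e) <= (r - q) * iJ by rewrite ler_wpM2l//; lra.
have : (r - q) * (2 * e) <= (r - q) * (m / 4) by rewrite ler_wpM2l//; lra.
nra.
Qed.

End null_sets.

Section ae_derivable.
Context {R : realType}.
Implicit Types (a b c d s : R).
Local Notation mu := (@lebesgue_measure R).

Lemma ac_on_dominated {V1 V2 W : normedModType R} a b (f : R -> V1) (g : R -> V2)
    (h : R -> W) (C : R) :
  (forall x y, a <= x -> x <= y -> y <= b ->
     `|h y - h x| <= C * (`|f y - f x| + `|g y - g x|)) ->
  ac_on a b f -> ac_on a b g -> ac_on a b h.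
Proof.
move=> hC acf acg e e0.
have C1 : 0 < `|C| + 1 by have := normr_ge0 C; lra.
have e1 : 0 < e / (2 * (`|C| + 1)) by rewrite divr_gt0// mulr_gt0.
have [d1 d10 H1] := acf _ e1; have [d2 d20 H2] := acg _ e1.
exists (Num.min d1 d2) => [|S famS]; first by rewrite lt_min d10.
rewrite lt_min => /andP[/H1-/(_ famS) S1 /H2-/(_ famS) S2].
apply: (@le_lt_trans _ _ ((`|C| + 1) *
    \sum_(p <- S) (`|f p.2 - f p.1| + `|g p.2 - g p.1|))).
  rewrite mulr_sumr big_seq [leRHS]big_seq; apply: ler_sum => p pS.
  case/andP: famS => /allP /(_ _ pS) /and3P[p1 p2 p3] _.
  apply: le_trans (hC _ _ p1 (ltW p2) p3) _.
  apply: ler_wpM2r; first exact: addr_ge0.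
  by have := ler_norm C; lra.
rewrite big_split/= -ltr_pdivlMl//.
apply: lt_le_trans (ltrD S1 S2) _.
move: C1; set k := `|C| + 1 => k0.
by rewrite le_eqVlt; apply/orP; left; apply/eqP; field; rewrite gt_eqF.
Qed.

Lemma ac_on_id a b : ac_on a b (@idfun R).
Proof.
move=> e e0; exists e => // S famS; rewrite /increments big_seq => h.
rewrite big_seq (eq_bigr (fun p => p.2 - p.1))// => p pS.
case/andP: famS => /allP /(_ _ pS) /and3P[_ p12 _] _.
by rewrite /= gtr0_norm// subr_gt0.
Qed.

Lemma ac_on_lipschitz {V W : normedModType R} a b (f : R -> V) (h : R -> W) (C : R) :
  (forall x y, a <= x -> x <= y -> y <= b -> `|h y - h x| <= C * `|f y - f x|) ->
  ac_on a b f -> ac_on a b h.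
Proof.
move=> hC acf; apply: (@ac_on_dominated _ _ _ a b f f h (C / 2)) => // x y ax xy yb.
by apply: le_trans (hC _ _ ax xy yb) _; rewrite -mulr2n -mulr_natl; lra.
Qed.

Lemma ac_on_lower a b (f : R -> R) : ac_on a b f -> lower_ac a b f.
Proof.
move=> acf e e0; have [d d0 H] := acf e e0; exists d => // S famS /H-/(_ famS).
by move=> /(le_lt_trans (increments_normr _ _)); rewrite ltr_norml => /andP[].
Qed.

Lemma ac_onS {V : normedModType R} a b c d (f : R -> V) : a <= c -> d <= b ->
  ac_on a b f -> ac_on c d f.
Proof.
move=> ac db acf e e0; have [k k0 H] := acf e e0; exists k => // S famS.
by apply: H; exact: itv_family_sub famS.
Qed.

(** The derivative is the infimum of the slopes at which [upper_ge] fails: the bound for [- f] makes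
    it finite, and the hypothesis on rational pairs brings the lower derivate up to it. *)
Lemma straddle_diff_exists a b (f : R -> R) s : ac_on a b f -> a < s < b ->
  (exists r, ~ upper_ge f s r) -> (exists r, ~ upper_ge (fun s => - f s) s r) ->
  (forall q r : rat, q < r -> upper_ge f s (ratr r) ->
     ~ upper_ge (fun s => - f s) s (- ratr q)) ->
  exists D, straddle_diff f s D.
Proof.
move=> acf sab [r0 ur0] [r1 ur1] H.
have acNf : ac_on a b (fun s => - f s).
  apply: (ac_on_lipschitz (C := 1) _ acf) => x y _ _ _.
  by rewrite mul1r -opprD normrN.
pose E := [set r | ~ upper_ge f s r].
have lbE : lbound E (- r1).
  move=> r Er; have [d1 d10 H1] := not_upper_ge acf sab Er.
  have [d2 d20 H2] := not_upper_ge acNf sab ur1.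
  pose d := Num.min d1 d2 / 2.
  have [d0 dd1 dd2] : [/\ 0 < d, d < d1 & d < d2].
    have m0 : 0 < Num.min d1 d2 by rewrite lt_min d10.
    have : Num.min d1 d2 <= d1 by rewrite ge_min lexx.
    have : Num.min d1 d2 <= d2 by rewrite ge_min lexx orbT.
    by rewrite /d; split; lra.
  have := H1 s (s + d); have := H2 s (s + d).
  move=> /(_ ltac:(lra) (lexx _) ltac:(lra) ltac:(lra)) h2.
  move=> /(_ ltac:(lra) (lexx _) ltac:(lra) ltac:(lra)) h1.
  have : 0 <= (r + r1) * d by lra.
  by rewrite pmulr_lge0//; lra.
have hE : has_inf E by split; [exists r0|exists (- r1)].
exists (inf E) => e e0.
have [r Er rD] := inf_adherent e0 hE.
have [d1 d10 H1] := not_upper_ge acf sab Er.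
have [u] : exists u : rat, (ratr u : R) \in `]inf E - e, inf E[%R.
  by apply: rat_in_itvoo; lra.
rewrite in_itv/= => /andP[u1 u2].
have [v] : exists v : rat, (ratr v : R) \in `]ratr u, inf E[%R.
  by apply: rat_in_itvoo; lra.
rewrite in_itv/= => /andP[v1 v2].
have uv : upper_ge f s (ratr v).
  by apply: contrapT => /(ge_inf hE.2); lra.
have [d2 d20 H2] := not_upper_ge acNf sab (H u v ltac:(by rewrite -(ltr_rat R)) uv).
exists (Num.min d1 d2) => [|x y]; first by rewrite lt_min d10.
have : Num.min d1 d2 <= d1 by rewrite ge_min lexx.
have : Num.min d1 d2 <= d2 by rewrite ge_min lexx orbT.
move=> m2 m1 x1 x2 y1 y2.
have := H1 x y ltac:(lra) x2 y1 ltac:(lra).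
have := H2 x y ltac:(lra) x2 y1 ltac:(lra).
move=> h2 h1; rewrite ler_norml /GRing.scale/=.
have : 0 <= (y - x) * (ratr u - (inf E - e)) by rewrite mulr_ge0//; lra.
have : 0 <= (y - x) * (inf E + e - r) by rewrite mulr_ge0//; lra.
by move=> h3 h4; apply/andP; split; nra.
Qed.

Lemma ac_ae_derivable a b (f : R -> R) : ac_on a b f ->
  {ae mu, forall s, a < s < b -> derivable f s 1}.
Proof.
move=> acf.
have acNf : ac_on a b (fun s => - f s).
  apply: (ac_on_lipschitz (C := 1) _ acf) => x y _ _ _.
  by rewrite mul1r -opprD normrN.
(* Pairs of rationals are run through by their codes, so that the exceptional set is a countable
   union of null sets. *)
pose P (n : nat) s := forall q r : rat, (unpickle n : option (rat * rat)) = Some (q, r) ->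
  a < s < b -> q < r -> upper_ge f s (ratr r) ->
     ~ upper_ge (fun s => - f s) s (- ratr q).
have H n : {ae mu, forall s, P n s}.
  case E : (unpickle n : option (rat * rat)) => [[q r]|].
    have [qr|qr] := ltP q r.
      have : (ratr q : R) < ratr r by rewrite ltr_rat.
      move=> /(upper_lower_null acf); apply: ae_sub => s h q' r'.
      by rewrite E => -[<- <-] sab _; exact: h.
    apply: aeW => s q' r'; rewrite E => -[<- <-] _ qr'.
    by move: qr; rewrite leNgt qr'.
  by apply: aeW => s q r; rewrite E.
have := ae_and (upper_infty_null acf) (upper_infty_null acNf).
move/(ae_and (ae_foralln H)); apply: ae_sub => s [HP [H1 H2]] sab.
have [|D] := straddle_diff_exists acf sab (H1 sab) (H2 sab).
  move=> q r qr; apply: (HP (pickle (q, r))) => //; exact: pickleK.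
by move=> /straddle_diffP[].
Qed.

Lemma ac_row_ae_derivable n a b (f : R -> 'rV[R]_n) : ac_on a b f ->
  {ae mu, forall s, a < s < b -> derivable f s 1}.
Proof.
move=> acf.
have H (i : 'I_n) : {ae mu, forall s, a < s < b -> derivable (fun s => f s ord0 i) s 1}.
  apply: ac_ae_derivable; apply: (ac_on_lipschitz (C := 1) _ acf) => x y _ _ _.
  rewrite mul1r [leRHS]/Num.Def.normr/= mx_normrE.
  apply: le_trans (le_bigmax _ _ (ord0, i)).
  by rewrite !mxE.
have K k : {ae mu, forall s, forall i : 'I_n, i = k :> nat ->
    a < s < b -> derivable (fun s => f s ord0 i) s 1}.
  have [kn|nk] := ltnP k n.
    apply: ae_sub (H (Ordinal kn)) => s hs i ik.
    by rewrite (_ : i = Ordinal kn)//; exact: val_inj.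
  by apply: aeW => s i ik; move: nk; rewrite -ik leqNgt ltn_ord.
move: (ae_foralln K); apply: ae_sub => s h sab; apply/derivable_mxP => i j.
by rewrite (ord1 i); exact: (h j).
Qed.

End ae_derivable.

(** * Primitives *)

Section primitive.
Context {R : realType}.
Implicit Types (a b c d s t x y : R) (f g : R -> R).
Local Notation mu := (@lebesgue_measure R).

(** The cut-off outside [0, t] turns integrability on [0, t] into the local integrability on the
    line that [FTC1] asks for. *)
Definition primitive t f s := \int[mu]_(z in `[0, s]) (f \_ `[0, t]) z.

Lemma integrable_restrict t f y : mu.-integrable `[0, t] (EFin \o f) ->
  mu.-integrable `[0, y] (EFin \o (f \_ `[0, t])).
Proof.
move=> /integrable_mkcond -/(_ (measurable_itv _)); rewrite -restrict_EFin.
exact: integrableS.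
Qed.

Lemma primitiveB t f x y : mu.-integrable `[0, t] (EFin \o f) ->
  0 <= x -> x <= y -> y <= t ->
  primitive t f y - primitive t f x = \int[mu]_(z in `]x, y]) f z.
Proof.
move=> intf x0 xy yt; rewrite /primitive Rintegral_itvB ?bnd_simp//; last first.
  exact: integrable_restrict.
apply: eq_Rintegral => z; rewrite inE/= in_itv/= => /andP[xz zy].
by rewrite patchE mem_set//= in_itv/=; apply/andP; split; lra.
Qed.

Lemma primitive0 t f : primitive t f 0 = 0.
Proof. by rewrite /primitive set_itv1 Rintegral_set1. Qed.

Lemma le_primitive t f g x y : mu.-integrable `[0, t] (EFin \o f) ->
  mu.-integrable `[0, t] (EFin \o g) ->
  (forall z, 0 <= z <= t -> f z <= g z) ->
  0 <= x -> x <= y -> y <= t ->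
  primitive t f y - primitive t f x <= primitive t g y - primitive t g x.
Proof.
move=> intf intg fg x0 xy yt.
have sub : `]x, y] `<=` `[0, t].
  by move=> z /=; rewrite !in_itv/= => /andP[? ?]; apply/andP; split; lra.
rewrite !primitiveB//; apply: le_Rintegral => //.
- exact: integrableS intf.
- exact: integrableS intg.
- by move=> z /sub /=; rewrite in_itv/= => /fg.
Qed.

Lemma integrable_cst_itv t c : mu.-integrable `[0, t] (EFin \o cst c).
Proof.
apply: measurable_bounded_integrable => //.
  by rewrite /= lebesgue_measure_itv/=; case: ifP => // _; rewrite -EFinB ltry.
exists `|c|; split=> // M cM z _ /=; exact: ltW.
Qed.

Lemma primitive_cst t c x y : 0 <= x -> x <= y -> y <= t ->
  primitive t (cst c) y - primitive t (cst c) x = c * (y - x).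
Proof.
move=> x0 xy yt; rewrite primitiveB//; last exact: integrable_cst_itv.
rewrite Rintegral_cst//= lebesgue_measure_itv/= lte_fin.
by case: ltP => // yx /=; rewrite (_ : y = x) ?subrr//; apply: le_anti; rewrite yx.
Qed.

Lemma primitive_ge t f c x y : mu.-integrable `[0, t] (EFin \o f) ->
  (forall z, 0 <= z <= t -> c <= f z) -> 0 <= x -> x <= y -> y <= t ->
  c * (y - x) <= primitive t f y - primitive t f x.
Proof.
move=> intf cf x0 xy yt; rewrite -(primitive_cst c x0 xy yt).
by apply: le_primitive => //; exact: integrable_cst_itv.
Qed.

Lemma primitive_le t f c x y : mu.-integrable `[0, t] (EFin \o f) ->
  (forall z, 0 <= z <= t -> f z <= c) -> 0 <= x -> x <= y -> y <= t ->
  primitive t f y - primitive t f x <= c * (y - x).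
Proof.
move=> intf cf x0 xy yt; rewrite -(primitive_cst c x0 xy yt).
by apply: le_primitive => //; exact: integrable_cst_itv.
Qed.

Lemma ae_derive_primitive t f : mu.-integrable `[0, t] (EFin \o f) ->
  {ae mu, forall s, 0 < s < t -> is_derive s 1 (primitive t f) (f s)}.
Proof.
move=> intf; have locf := integrable_locally_restrict (measurable_itv _) intf.
have := @FTC1 R (f \_ `[0, t]) (BLeft 0) _ locf.
move=> /(_ (fun y => integrable_restrict y intf)).
apply: ae_sub => s h /andP[s0 st].
have [|dP DP] := h; first by rewrite /= lte_fin.
apply: DeriveDef => //; rewrite -derive1E DP patchE mem_set//= in_itv/=.
by rewrite !ltW.
Qed.

Lemma integrable_min_cst t f (C N : R) : measurable_fun `[0, t] f ->
  (forall z, 0 <= z <= t -> - C <= f z) ->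
  mu.-integrable `[0, t] (EFin \o (fun z => Num.min (f z) N)).
Proof.
move=> mf fC; apply: measurable_bounded_integrable => //.
- by rewrite /= lebesgue_measure_itv/=; case: ifP => // _; rewrite -EFinB ltry.
- by apply: measurable_minr => //; exact: measurable_cst.
- exists (`|C| + `|N|); split=> // M cM z /=; rewrite in_itv/= => /fC Cz.
  apply/(le_trans _ (ltW cM)); rewrite ler_norml.
  rewrite le_min ge_min; have := ler_norm C; have := ler_norm N.
  have := ler_norm (- N); rewrite normrN.
  have := normr_ge0 C; have := normr_ge0 N.
  move=> ? ? ? ? ?; apply/andP; split; last by apply/orP; right; lra.
  by apply/andP; split; lra.
Qed.

Lemma primitive_cvg t (f_ : nat -> R -> R) f g s :
  (forall k, measurable_fun `[0, t] (f_ k)) ->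
  (forall z, 0 <= z <= t -> f_ k z @[k --> \oo] --> f z) ->
  mu.-integrable `[0, t] (EFin \o g) ->
  (forall k z, 0 <= z <= t -> `|f_ k z| <= g z) -> 0 <= s <= t ->
  mu.-integrable `[0, t] (EFin \o f) /\
  primitive t (f_ k) s @[k --> \oo] --> primitive t f s.
Proof.
move=> mf_ cvf intg fg /andP[s0 st].
have st' : `[0, s] `<=` `[0, t].
  by move=> z /=; rewrite !in_itv/= => /andP[? ?]; apply/andP; split; lra.
have dom r : 0 <= r <= t -> mu.-integrable `[0, r] (EFin \o f) /\
    (fun k => \int[mu]_(z in `[0%R, r]) (f_ k z)%:E)%E @ \oo -->
    (\int[mu]_(z in `[0%R, r]) (f z)%:E)%E.
  move=> /andP[r0 rt].
  have rt' : `[0, r] `<=` `[0, t].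
    by move=> z /=; rewrite !in_itv/= => /andP[? ?]; apply/andP; split; lra.
  have mfr k : measurable_fun `[0, r] (f_ k) by apply: (measurable_funS _ rt' (mf_ k)).
  have [] := @dominated_convergence _ _ _ mu `[0, r] (measurable_itv _)
    (fun k => EFin \o f_ k) (EFin \o f) (EFin \o g).
  - by move=> k; apply/measurable_EFinP; exact: mfr.
  - apply/measurable_EFinP; apply: (measurable_fun_cvg mfr) => z /rt' /=.
    by rewrite in_itv/= => /cvf.
  - apply: aeW => z /rt' /=; rewrite in_itv/= => /cvf cvz.
    by apply: cvg_EFin => //; apply: nearW.
  - exact: integrableS intg.
  - by apply: aeW => z k /rt' /=; rewrite in_itv/= lee_fin => /fg.
  by move=> ? _ ?; split.
split; first by apply: (dom t _).1; apply/andP; split=> //; exact: le_trans st.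
have PE h : (\int[mu]_(z in `[0%R, s]) ((h \_ `[0, t]) z)%:E =
     \int[mu]_(z in `[0%R, s]) (h z)%:E)%E.
  by apply: eq_integral => z zs; rewrite patchE mem_set//; apply: st'; rewrite inE in zs.
have [intf cv] := dom s ltac:(by rewrite s0 st).
rewrite /primitive /Rintegral; apply: fine_cvg; rewrite fineK; last first.
  by rewrite PE; exact: integrable_fin_num intf.
rewrite PE; apply: cvg_trans cv; apply: near_eq_cvg; apply: nearW => k.
by rewrite PE.
Qed.

Lemma truncation_cvg t f (C e : R) : mu.-integrable `[0, t] (EFin \o f) ->
  (forall z, 0 <= z <= t -> - C <= f z) -> 0 < e -> 0 <= t ->
  exists N : nat, primitive t f t - primitive t (fun z => Num.min (f z) N%:R) t < e.
Proof.
move=> intf fC e0 t0.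
have mf : measurable_fun `[0, t] f by case/integrableP : intf => /measurable_EFinP.
have [|||||_ cv] := @primitive_cvg t (fun n z => Num.min (f z) n%:R) f
  (fun z => `|f z| + `|C|) t.
- by move=> n; apply: measurable_minr => //; exact: measurable_cst.
- move=> z _; apply: cvg_near_cst; near=> n; rewrite min_l//.
  by near: n; exact: nbhs_infty_ger.
- rewrite (_ : _ \o _ =
      ((EFin \o (fun z => `|f z|)%R) \+ (EFin \o cst `|C|%R))%E)//.
  apply: integrableD => //; last exact: integrable_cst_itv.
  exact: integrable_norm intf.
- move=> n z /fC Cz; have n0 : 0 <= n%:R :> R by [].
  rewrite ler_norml le_min ge_min.
  have := ler_norm (- f z); rewrite normrN; have := ler_norm (f z).
  have := ler_norm C; have := normr_ge0 C; have := normr_ge0 (f z).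
  move=> ? ? ? ? ?; apply/andP; split; last by apply/orP; left; lra.
  by apply/andP; split; lra.
- by rewrite t0 lexx.
move/cvgrPdist_lt : cv => /(_ _ e0)[N _ /(_ N (leqnn _))].
by move=> /(le_lt_trans (ler_norm _)) h; exists N.
Unshelve. all: by end_near. Qed.

(** Truncation at a high level [N] leaves a bounded function, whose primitive is Lipschitz, and a
    nonnegative remainder, whose primitive is nondecreasing with total increment below e / 2 and so
    contributes less than that on any family. *)
Lemma primitive_ac t f (C : R) : 0 <= t -> mu.-integrable `[0, t] (EFin \o f) ->
  (forall z, 0 <= z <= t -> - C <= f z) -> ac_on 0 t (primitive t f).
Proof.
move=> t0 intf fC e e0.
have e20 : 0 < e / 2 by lra.
have mf : measurable_fun `[0, t] f by case/integrableP : intf => /measurable_EFinP.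
have [N HN] := truncation_cvg intf fC e20 t0.
set g := fun z => _ in HN.
have intg : mu.-integrable `[0, t] (EFin \o g) by exact: integrable_min_cst mf fC.
have gf z : 0 <= z <= t -> g z <= f z by move=> _; rewrite /g ge_min lexx.
have gN z : 0 <= z <= t -> g z <= N%:R by move=> _; rewrite /g ge_min lexx orbT.
have N0 : 0 <= N%:R :> R by [].
have C0 := normr_ge0 C; have CC := ler_norm C.
have gC z : 0 <= z <= t -> - (N%:R + `|C| + 1) <= g z.
  by move=> /fC Cz; rewrite /g le_min; apply/andP; split; lra.
have K0 : 0 < N%:R + `|C| + 1 by lra.
exists (e / 2 / (N%:R + `|C| + 1)) => [|S famS Sd]; first by rewrite divr_gt0.
pose h s := primitive t f s - primitive t g s.
have hle : increments h S <= h t - h 0.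
  apply: increments_le famS => // x y x0 xy yt; rewrite /h.
  by have := le_primitive intg intf gf x0 xy yt; lra.
apply: (@le_lt_trans _ _ ((N%:R + `|C| + 1) * increments idfun S + increments h S)).
  rewrite /increments mulr_sumr -big_split/= big_seq [leRHS]big_seq.
  apply: ler_sum => p pS.
  case/andP: famS => /allP /(_ _ pS) /and3P[p1 /ltW p2 p3] _.
  have := le_primitive intg intf gf p1 p2 p3.
  have := primitive_le intg gN p1 p2 p3; have := primitive_ge intg gC p1 p2 p3.
  have : 0 <= (`|C| + 1) * (p.2 - p.1) by rewrite mulr_ge0//; lra.
  by rewrite /h ler_norml => *; apply/andP; split; lra.
move: Sd; rewrite ltr_pdivlMr// mulrC => Sd.
by move: hle; rewrite /h !primitive0; lra.
Qed.

End primitive.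

Section ae_eq_integral_nonmeasurable.
Import HBSimple HBNNSimple.
Local Open Scope ereal_scope.
Context d (T : measurableType d) (R : realType) (mu : {measure set T -> \bar R}).

Let ge0_le_integral_ae (D N : set T) (f g : T -> \bar R) :
  measurable N -> mu N = 0 -> (forall x, D x -> 0 <= f x) ->
  (forall x, D x -> 0 <= g x) ->
  (forall x, D x -> ~ N x -> f x = g x) ->
  \int[mu]_(x in D) f x <= \int[mu]_(x in D) g x.
Proof.
move=> mN N0 f0 g0 fg; rewrite !ge0_integralE//.
apply: ge_ereal_sup => /= _ [h hf <-].
have mNC : measurable (~` N) by exact: measurableC.
apply: ereal_sup_ubound; exists (proj_nnsfun h mNC) => [x|].
  rewrite -mrestrict !patchE; case: ifPn => [|_].
    rewrite inE => nNx; have := hf x; rewrite patchE; case: ifPn => //.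
    by rewrite inE => Dx; rewrite fg.
  by case: ifPn => // /set_mem Dx; exact: g0.
rewrite -!integralT_nnsfun.
rewrite [RHS](@ge0_negligible_integral _ _ _ mu setT N)//; last 2 first.
- by apply/measurable_EFinP; exact: measurable_funP.
- by move=> x _; rewrite lee_fin.
rewrite setTD [RHS]integral_mkcond; apply: eq_integral => x _.
by rewrite -mrestrict !patchE; case: ifP.
Qed.

Let ge0_eq_integral_ae (D N : set T) (f g : T -> \bar R) :
  measurable N -> mu N = 0 -> (forall x, D x -> 0 <= f x) ->
  (forall x, D x -> 0 <= g x) ->
  (forall x, D x -> ~ N x -> f x = g x) ->
  \int[mu]_(x in D) f x = \int[mu]_(x in D) g x.
Proof.
move=> mN N0 f0 g0 fg; apply/eqP; rewrite eq_le !(@ge0_le_integral_ae D N)//.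
by move=> x Dx Nx; rewrite fg.
Qed.

(* Neither function needs to be measurable: simple functions below one of them
   lie below the other after being cut off on the null set. *)
Lemma eq_integral_off_null (D N : set T) (f g : T -> \bar R) :
  measurable N -> mu N = 0 -> (forall x, D x -> ~ N x -> f x = g x) ->
  \int[mu]_(x in D) f x = \int[mu]_(x in D) g x.
Proof.
move=> mN N0 fg; rewrite [LHS]integralE [RHS]integralE; congr (_ - _).
  by apply: (@ge0_eq_integral_ae D N) => // x Dx Nx; rewrite !funeposE fg.
by apply: (@ge0_eq_integral_ae D N) => // x Dx Nx; rewrite !funenegE fg.
Qed.

End ae_eq_integral_nonmeasurable.

(** * Integral bounds from straddling quotients *)

Section straddle_integral.
Context {R : realType}.
Implicit Types (a b c d s t x y : R) (f g : R -> R).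
Local Notation mu := (@lebesgue_measure R).

Lemma lower_ac_lipschitz a b g c :
  (forall x y, a <= x -> x <= y -> y <= b -> - c * (y - x) <= g y - g x) ->
  lower_ac a b g.
Proof.
move=> gc e e0; have c0 := normr_ge0 c; have c1 : 0 < `|c| + 1 by lra.
exists (e / (`|c| + 1)) => [|S famS]; first by rewrite divr_gt0.
rewrite ltr_pdivlMr// => Sd.
have S0 := increments_ge0 famS.
have : - c * increments idfun S <= increments g S.
  rewrite /increments mulr_sumr big_seq [leRHS]big_seq; apply: ler_sum => p pS.
  by case/andP: famS => /allP /(_ _ pS) /and3P[? /ltW ? ?] _; exact: gc.
have : c * increments idfun S <= `|c| * increments idfun S.
  by rewrite ler_wpM2r// ler_norm.
by rewrite mulrDr mulr1 mulrC in Sd *; nra.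
Qed.

Lemma straddle_geW g s c c' : c' <= c -> straddle_ge g s c -> straddle_ge g s c'.
Proof.
move=> cc' h e e0; have [d d0 H] := h _ e0; exists d => // x y x1 x2 y1 y2.
apply: le_trans (H x y x1 x2 y1 y2); rewrite ler_wpM2r//; lra.
Qed.

Lemma straddle_diff_ge (P : R -> R) s D : straddle_diff P s D -> straddle_ge P s D.
Proof.
move=> h e e0; have [d d0 H] := h _ e0; exists d => // x y x1 x2 y1 y2.
have := H x y x1 x2 y1 y2; rewrite ler_norml /GRing.scale/= => /andP[? _]; lra.
Qed.

Lemma straddle_ge_sub g (P : R -> R) s c D : straddle_ge g s c -> straddle_diff P s D ->
  straddle_ge (fun s => g s - P s) s (c - D).
Proof.
move=> h h' e e0; have e20 : 0 < e / 2 by lra.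
have [d1 d10 H1] := h _ e20; have [d2 d20 H2] := h' _ e20.
exists (Num.min d1 d2) => [|x y]; first by rewrite lt_min d10.
have : Num.min d1 d2 <= d1 by rewrite ge_min lexx.
have : Num.min d1 d2 <= d2 by rewrite ge_min lexx orbT.
move=> m2 m1 x1 x2 y1 y2.
have := H1 x y ltac:(lra) x2 y1 ltac:(lra).
have := H2 x y ltac:(lra) x2 y1 ltac:(lra).
by rewrite ler_norml /GRing.scale/= => /andP[_ ?] ?; lra.
Qed.

Lemma ae_increment_ge a b (g : R -> R) c : a <= b -> ac_on a b g ->
  {ae mu, forall s, a < s < b -> exists2 D, is_derive s 1 g D & c <= D} ->
  c * (b - a) <= g b - g a.
Proof.
move=> ab acg ae.
have aci : ac_on a b (fun s => g s - c * s).
  apply: (@ac_on_dominated _ _ _ _ a b g idfun _ (1 + `|c|)) => //; last exact: ac_on_id.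
  move=> x y _ _ _ /=.
  rewrite (_ : _ - _ = (g y - g x) - c * (y - x)); last by lra.
  apply: le_trans (ler_normB _ _) _; rewrite normrM.
  have := normr_ge0 c; have := normr_ge0 (g y - g x); have := normr_ge0 (y - x).
  by nra.
have := ae_straddle_ge0 ab (ac_on_lower aci) _.
move=> /(_ _)/wrap[]; last by lra.
apply: ae_sub ae => s h /h[D /straddle_diffP gD cD].
have : straddle_diff (fun s => c * s) s c.
  move=> e e0; exists 1 => // x y _ ? ? _.
  rewrite /GRing.scale/= (_ : _ - _ = 0) ?normr0; last by lra.
  by rewrite mulr_ge0//; lra.
move=> /(straddle_ge_sub (straddle_diff_ge gD)); apply: straddle_geW; lra.
Qed.

(** The upper bound on [f] makes [G] minus the primitive decrease at most linearly, which yields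
    [lower_ac]; an unbounded [f] has to be truncated first. *)
Lemma ae_straddle_primitive_le t f (G : R -> R) (C : R) x y :
  mu.-integrable `[0, t] (EFin \o f) ->
  (exists N, forall z, 0 <= z <= t -> f z <= N) ->
  (forall x y, 0 <= x -> x <= y -> y <= t -> - C * (y - x) <= G y - G x) ->
  {ae mu, forall s, 0 < s < t -> straddle_ge G s (f s)} ->
  0 <= x -> x <= y -> y <= t ->
  primitive t f y - primitive t f x <= G y - G x.
Proof.
move=> intf [N fN] GC ae x0 xy yt.
suff : G x - primitive t f x <= G y - primitive t f y by lra.
apply: (@ae_straddle_ge0 _ x y (fun s => G s - primitive t f s) xy).
  apply: (@lower_ac_lipschitz _ _ _ (C + N)) => x' y' x1 x2 x3.
  have xt : 0 <= x' by lra.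
  have yt' : y' <= t by lra.
  have := primitive_le intf fN xt x2 yt'; have := GC x' y' xt x2 yt'; lra.
have := ae_and ae (ae_derive_primitive intf); apply: ae_sub => s [h1 h2] /andP[s1 s2].
have st : 0 < s < t by apply/andP; split; lra.
rewrite -(subrr (f s)); apply: straddle_ge_sub; first exact: h1.
by apply/straddle_diffP; exact: h2.
Qed.

(** Integrability of [f] is a conclusion: the primitive of each truncation grows no faster than [G],
    and monotone convergence hands this bound to [f]. A supersolution thus makes the running cost
    integrable. *)
Lemma ae_straddle_integrable t f (G : R -> R) (C C' : R) :
  0 <= t -> measurable_fun `[0, t] f ->
  (forall z, 0 <= z <= t -> - C <= f z) ->
  (forall x y, 0 <= x -> x <= y -> y <= t -> - C' * (y - x) <= G y - G x) ->
  {ae mu, forall s, 0 < s < t -> straddle_ge G s (f s)} ->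
  mu.-integrable `[0, t] (EFin \o f) /\
  forall x y, 0 <= x -> x <= y -> y <= t ->
    primitive t f y - primitive t f x <= G y - G x.
Proof.
move=> t0 mf fC GC ae.
pose g (n : nat) z := Num.min (f z) n%:R.
have intg n : mu.-integrable `[0, t] (EFin \o g n) by exact: integrable_min_cst mf fC.
have gG n x y : 0 <= x -> x <= y -> y <= t ->
    primitive t (g n) y - primitive t (g n) x <= G y - G x.
  apply: (@ae_straddle_primitive_le _ _ _ C') => //.
    by exists n%:R => z _; rewrite /g ge_min lexx orbT.
  apply: ae_sub ae => s h /h; apply: straddle_geW.
  by rewrite /g ge_min lexx.
have intf : mu.-integrable `[0, t] (EFin \o f).
  have C0 : 0 <= `|C| by [].
  have fC' z : 0 <= z <= t -> - `|C| <= f z by move=> /fC; have := ler_norm C; lra.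
  (* Adding [|C|] makes the truncations nonnegative, as monotone convergence requires. *)
  have intgC n : mu.-integrable `[0, t] (EFin \o (fun z => g n z + `|C|)).
    rewrite (_ : _ \o _ = ((EFin \o g n) \+ (EFin \o cst `|C|%R))%E)//.
    by apply: integrableD => //; exact: integrable_cst_itv.
  have bnd n : (\int[mu]_(z in `[0%R, t]) (g n z + `|C|)%:E <= (G t - G 0 + `|C| * t)%:E)%E.
    have /integrable_fin_num : mu.-integrable `[0, t] (EFin \o (fun z => g n z + `|C|)) by [].
    move=> /(_ (measurable_itv _)) fn.
    rewrite -[X in (X <= _)%E]fineK// lee_fin.
    rewrite [X in X <= _](_ : _ = \int[mu]_(z in `[0, t]) (g n z + cst `|C| z))//.
    rewrite RintegralD//; last exact: integrable_cst_itv.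
    apply: lerD.
      have := gG n 0 t (lexx _) t0 (lexx _).
      rewrite primitive0 subr0 /primitive; apply: le_trans.
      by rewrite le_eqVlt; apply/orP; left; apply/eqP; apply: eq_Rintegral => z zt; rewrite patchE zt.
    rewrite Rintegral_cst//= lebesgue_measure_itv/= lte_fin.
    case: ltP => // t00 /=; last by rewrite mulr0 mulr_ge0.
    by rewrite subr0.
  apply/integrableP; split; first exact/measurable_EFinP.
  have mfC : measurable_fun `[0, t] (fun z => f z + `|C|).
    by apply: measurable_funD => //; exact: measurable_cst.
  apply: (@le_lt_trans _ _ (\int[mu]_(z in `[0%R, t]) ((f z + `|C|)%:E + `|C|%:E))%E).
    apply: ge0_le_integral => //.
    - by apply: measurableT_comp => //; exact/measurable_EFinP.
    - by apply: emeasurable_funD => //; exact/measurable_EFinP.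
    - move=> z; rewrite /= in_itv/= => /fC' fz.
      by rewrite -EFinD lee_fin ler_norml; apply/andP; split; lra.
  rewrite ge0_integralD//; last 2 first.
  - by move=> z; rewrite /= in_itv/= => /fC' fz; rewrite lee_fin; lra.
  - exact/measurable_EFinP.
  rewrite integral_cst//= lte_add_pinfty//; last first.
    rewrite lebesgue_measure_itv/=; case: ifP => // _.
      by rewrite -EFinB -EFinM ltry.
    by rewrite mule0.
  have cv := @cvg_monotone_convergence _ _ _ mu `[0, t] (measurable_itv _)
    (fun n z => (g n z + `|C|)%:E).
  have -> : (\int[mu]_(z in `[0%R, t]) (f z + `|C|)%:E =
      \int[mu]_(z in `[0%R, t]) limn (fun n => (g n z + `|C|)%:E))%E.
    apply: eq_integral => z _; apply/esym/cvg_lim => //.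
    apply: cvg_near_cst; near=> n; rewrite /g min_l//.
    by near: n; exact: nbhs_infty_ger.
  rewrite monotone_convergence//.
  - apply: (@le_lt_trans _ _ (G t - G 0 + `|C| * t)%:E); last exact: ltry.
    apply: lime_le; last by apply: nearW.
    apply/cvg_ex; eexists; apply: cv => //.
    + by move=> n; case/integrableP : (intgC n).
    + move=> n z; rewrite /= in_itv/= => /fC' fz.
      have : 0 <= n%:R :> R by [].
      by rewrite lee_fin /g -lerBlDr sub0r le_min fz/=; lra.
    + move=> z _ m n mn; rewrite lee_fin lerD2r /g le_min !ge_min lexx/=.
      by apply/orP; right; rewrite ler_nat.
  - by move=> n; case/integrableP : (intgC n).
  - move=> n z; rewrite /= in_itv/= => /fC' fz.
    have : 0 <= n%:R :> R by [].
    by rewrite lee_fin /g -lerBlDr sub0r le_min fz/=; lra.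
  - move=> z _ m n mn; rewrite lee_fin lerD2r /g le_min !ge_min lexx/=.
    by apply/orP; right; rewrite ler_nat.
split=> // x y x0 xy yt.
(* The primitive of [f] minus that of a truncation is nondecreasing, so its increment over [x, y] is
   at most the total one, which is below [e]. *)
apply/ler_addgt0Pr => e e0.
have [n Hn] := truncation_cvg intf fC e0 t0.
have gf z : 0 <= z <= t -> g n z <= f z by move=> _; rewrite /g ge_min lexx.
have yt0 : 0 <= y by lra.
have := le_primitive (intg n) intf gf (lexx 0) x0 (le_trans xy yt).
have := le_primitive (intg n) intf gf yt0 yt (lexx t).
have := gG n x y x0 xy yt; rewrite !primitive0.
move: Hn; rewrite -/(g n); lra.
Unshelve. all: by end_near. Qed.

(** One inequality is the preceding lemma with [u] as its own supersolution; for the other, the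
    primitive minus [u] is absolutely continuous with derivative 0 almost everywhere. *)
Lemma ac_integral t (u f : R -> R) (C : R) : 0 <= t -> ac_on 0 t u ->
  measurable_fun `[0, t] f -> (forall z, 0 <= z <= t -> - C <= f z) ->
  {ae mu, forall s, 0 < s < t -> is_derive s 1 u (f s)} ->
  primitive t f t = u t - u 0.
Proof.
move=> t0 acu mf fC ae.
have uC x y : 0 <= x -> x <= y -> y <= t -> - C * (y - x) <= u y - u x.
  move=> x0 xy yt; apply: ae_increment_ge => //; first exact: ac_onS acu.
  apply: ae_sub ae => s h /andP[s1 s2]; exists (f s).
    by apply: h; apply/andP; split; lra.
  by apply: fC; apply/andP; split; lra.
have [|intf uf] := ae_straddle_integrable t0 mf fC uC.
  by apply: ae_sub ae => s h /h /straddle_diffP; exact: straddle_diff_ge.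
apply/eqP; rewrite eq_le; apply/andP; split.
  by have := uf 0 t (lexx _) t0 (lexx _); rewrite primitive0 subr0.
have acP := primitive_ac t0 intf fC.
have acPu : ac_on 0 t (fun s => primitive t f s - u s).
  apply: (@ac_on_dominated _ _ _ _ 0 t _ _ _ 1 _ acP acu) => x y _ _ _.
  rewrite mul1r (_ : _ - _ = (primitive t f y - primitive t f x) - (u y - u x)).
    exact: ler_normB.
  by lra.
suff : primitive t f 0 - u 0 <= primitive t f t - u t by rewrite primitive0; lra.
apply: (@ae_straddle_ge0 _ 0 t (fun s => primitive t f s - u s) t0 (ac_on_lower acPu)).
have := ae_and ae (ae_derive_primitive intf); apply: ae_sub => s [h1 h2] st.
rewrite -(subrr (f s)); apply: straddle_ge_sub; last by apply/straddle_diffP; exact: h1.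
by apply: straddle_diff_ge; apply/straddle_diffP; exact: h2.
Qed.

End straddle_integral.

(** * Extension to the line and measurability along curves *)

Section clamp.
Context {R : realType}.
Implicit Types (t s x y : R).
Local Notation mu := (@lebesgue_measure R).

(** Retraction onto [0, t]: composing with it turns a curve known only on [0, t] into a continuous
    function on the line. *)
Definition clamp t s : R := Num.max 0 (Num.min s t).

Lemma clamp_id t s : 0 <= s <= t -> clamp t s = s.
Proof. by move=> /andP[s0 st]; rewrite /clamp min_l// max_r. Qed.

Lemma clamp_itv t s : 0 <= t -> 0 <= clamp t s <= t.
Proof. by move=> t0; rewrite /clamp le_max lexx/= ge_max t0/= ge_min lexx orbT. Qed.

Lemma clamp_lip t x y : 0 <= t -> `|clamp t y - clamp t x| <= `|y - x|.
Proof.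
move=> t0; wlog xy : x y / x <= y.
  by move=> H; have [/H//|/ltW/H] := leP x y; rewrite distrC [leRHS]distrC.
rewrite [leRHS]ger0_norm; last lra.
rewrite /clamp; case: (leP x t) => ?; case: (leP y t) => ?;
  rewrite ?(max_r t0) //; [| |lra|rewrite subrr normr0; lra];
  case: (leP 0 x) => ?; case: (leP 0 y) => ?; rewrite ler_norml; apply/andP; split; lra.
Qed.

Lemma continuous_clamp {V : normedModType R} t (f : R -> V) : 0 <= t ->
  ac_on 0 t f -> continuous (f \o clamp t).
Proof.
move=> t0 acf s; apply/cvgrPdist_lt => e e0.
have [d d0 Hd] := ac_on_uniform acf e0.
near=> z.
have zd : `|clamp t s - clamp t z| < d.
  by apply: le_lt_trans (clamp_lip _ _ t0) _; near: z; exact: cvgr_dist_lt.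
have /andP[s0 st] := clamp_itv s t0; have /andP[z0 zt] := clamp_itv z t0.
have [sz|zs] := leP (clamp t s) (clamp t z).
  rewrite distrC; apply: Hd => //; apply: le_lt_trans zd.
  by rewrite distrC ler_norm.
by apply: Hd => //; [exact: ltW|apply: le_lt_trans zd; rewrite ler_norm].
Unshelve. all: by end_near. Qed.

Lemma ac_on_bounded {V : normedModType R} t (f : R -> V) : 0 <= t ->
  ac_on 0 t f -> exists2 B : R, 0 <= B & forall s, 0 <= s <= t -> `|f s| <= B.
Proof.
move=> t0 acf.
have cf : {within `[0, t], continuous (fun s => `|f (clamp t s)|)}.
  apply: continuous_subspaceT => s.
  by apply: continuous_comp; [exact: continuous_clamp|exact: norm_continuous].
have [c _ H] := EVT_max t0 cf.
exists `|f (clamp t c)| => // s st.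
by rewrite -[in leLHS](clamp_id st); apply: H; rewrite in_itv.
Qed.

End clamp.

Lemma cvg_quadruple {T : Type} {F : set_system T} {FF : Filter F}
    {U1 U2 U3 U4 : topologicalType} (f1 : T -> U1) (f2 : T -> U2) (f3 : T -> U3)
    (f4 : T -> U4) (l1 : U1) (l2 : U2) (l3 : U3) (l4 : U4) :
  f1 x @[x --> F] --> l1 -> f2 x @[x --> F] --> l2 ->
  f3 x @[x --> F] --> l3 -> f4 x @[x --> F] --> l4 ->
  (f1 x, f2 x, f3 x, f4 x) @[x --> F] --> (l1, l2, l3, l4).
Proof. by move=> h1 h2 h3 h4; exact: (cvg_pair (cvg_pair (cvg_pair h1 h2) h3) h4). Qed.

Section curves.
Context {R : realType} {n : nat}.
Implicit Types (t s : R) (xi : R -> 'rV[R]_n).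
Local Notation mu := (@lebesgue_measure R).

Lemma cvg_difference_quotient (V W : normedModType R) (f : V -> W) a v :
  derivable f a v ->
  k.+1%:R *: (f (k.+1%:R^-1 *: v + a) - f a) @[k --> \oo] --> 'D_v f a.
Proof.
move=> /cvgrPdist_lt H; apply/cvgrPdist_lt => e /H [d /= d0 Hd].
near=> k; have := Hd k.+1%:R^-1; rewrite /ball_/= sub0r normrN invrK.
apply; last by rewrite invr_eq0.
by rewrite gtr0_norm//; near: k; exact: (near_infty_natSinv_lt (PosNum d0)).
Unshelve. all: by end_near. Qed.

(** Off [N] the derivative is the limit of the continuous quotients [q k], so the composite is a
    limit of measurable functions. On [N], where [derive1] may be meaningless, it is replaced by the
    default value. *)
Lemma measurable_along t (M : R -> 'rV[R]_n -> R -> 'rV[R]_n -> R) xi : 0 <= t ->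
  continuous (fun p : R * 'rV[R]_n * R * 'rV[R]_n => M p.1.1.1 p.1.1.2 p.1.2 p.2) ->
  ac_on 0 t xi ->
  exists N : set R, [/\ measurable N, mu N = 0%E,
    forall s, 0 <= s <= t -> ~ N s -> 0 < s < t /\ derivable xi s 1 &
    forall y : R -> R, continuous y -> measurable_fun `[0, t]
     ((fun s => M s (xi s) (y s) (derive1 xi s)) \_ (~` N))].
Proof.
move=> t0 Mc acxi; have [N0 [mN0 N00 HN0]] := ac_row_ae_derivable acxi.
(* With the endpoints removed, s + 1 / (k + 1) lies in [0, t] for large [k], so that [clamp]
   disappears from the quotients. *)
pose N := N0 `|` [set 0] `|` [set t].
have mN : measurable N by apply: measurableU => //; exact: measurableU.
have HN s : 0 <= s <= t -> ~ N s -> 0 < s < t /\ derivable xi s 1.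
  move=> /andP[s0 st] Ns.
  have st' : 0 < s < t.
    rewrite !lt_neqAle s0 st !andbT; apply/andP; split; apply/eqP => h; apply: Ns.
      by left; right.
    by right.
  split=> //; apply: contrapT => h; apply: Ns; left; left; apply: HN0 => /= H.
  by apply: h; exact: H.
exists N; split=> //.
  have neg1 (r : R) : mu.-negligible [set r].
    by exists [set r]; split=> //; exact: lebesgue_measure_set1.
  apply: measure_negligible => //; apply: negligibleU => //.
  by apply: negligibleU => //; exists N0; split.
move=> y cy.
pose q k s := k.+1%:R *: (xi (clamp t (s + k.+1%:R^-1)) - xi (clamp t s)).
pose f k s := M s (xi (clamp t s)) (y s) (q k s).
have cxi : continuous (xi \o clamp t) by exact: continuous_clamp.
have cq k : continuous (q k).
  move=> s; apply: cvgZ; first exact: cvg_cst.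
  apply: cvgB; last exact: cxi.
  apply: (@continuous_comp _ _ _ (fun s => s + k.+1%:R^-1) (xi \o clamp t)).
    by apply: continuousD => //; exact: cvg_cst.
  exact: cxi.
have cf k : continuous (f k).
  move=> s.
  apply: (@continuous_comp _ _ _ (fun s => (s, xi (clamp t s), y s, q k s))
    (fun p : R * 'rV[R]_n * R * 'rV[R]_n => M p.1.1.1 p.1.1.2 p.1.2 p.2)); last exact: Mc.
  apply: cvg_quadruple; [exact: cvg_id|exact: cxi|exact: cy|exact: cq].
apply: (@measurable_fun_cvg _ _ _ `[0, t] (fun k => f k \_ (~` N))).
  move=> k; apply: measurable_funTS.
  apply/(measurable_restrictT _ _).1; first exact: measurableC.
  by apply: measurable_funTS; exact: continuous_measurable_fun.
move=> s; rewrite /= in_itv/= => st.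
rewrite patchE; case: ifPn => [|Ns]; last first.
  by apply: cvg_near_cst; apply: nearW => k; rewrite patchE (negbTE Ns).
rewrite inE /= => Ns; have [st' ds] := HN _ st Ns.
have E k : (f k \_ (~` N)) s = M s (xi s) (y s) (q k s).
  by rewrite patchE mem_set// /f clamp_id.
rewrite (_ : (fun k => _) = (fun k => M s (xi s) (y s) (q k s))); last exact/funext.
apply: (@cvg_comp _ _ _ (fun k => (s, xi s, y s, q k s))
  (fun p : R * 'rV[R]_n * R * 'rV[R]_n => M p.1.1.1 p.1.1.2 p.1.2 p.2) _ _ _ _
  (Mc (s, xi s, y s, derive1 xi s))).
apply: cvg_quadruple; [exact: cvg_cst|exact: cvg_cst|exact: cvg_cst|].
have ts : 0 < t - s by case/andP: st' => _; rewrite subr_gt0.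
rewrite derive1E; apply: cvg_trans (cvg_difference_quotient ds).
apply: near_eq_cvg; near=> k.
rewrite /q !clamp_id//; first by rewrite [_^-1 *: 1]mulr1 [s + _]addrC.
case/andP: st' => s0 st1; apply/andP; split; first by rewrite addr_ge0// ltW.
rewrite -lerBrDl; apply: ltW; near: k.
exact: (near_infty_natSinv_lt (PosNum ts)).
Unshelve. all: by end_near. Qed.

End curves.

(** * Differential equations with monotone right-hand side *)

Section ode.
Context {R : realType}.
Implicit Types (t s x y : R) (f g G : R -> R) (H : R -> R -> R).
Local Notation mu := (@lebesgue_measure R).

Lemma is_derive_lipschitz (y y' : R -> R) (C a b : R) :
  (forall s, is_derive s 1 y (y' s)) -> (forall s, a <= s <= b -> `|y' s| <= C) ->
  a <= b -> `|y b - y a| <= C * `|b - a|.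
Proof.
move=> dy yC ab.
have [|c] := MVT_segment ab (fun s _ => dy s).
  apply: continuous_subspaceT => s; apply: differentiable_continuous.
  by apply/derivable1_diffP; case: (dy s).
by rewrite in_itv/= => cab ->; rewrite normrM ler_wpM2r//; exact: yC.
Qed.

(** [H] is the Lagrangian along a fixed curve. Measurability is that of the composites with
    continuous [y], which are the ones the iteration meets. *)
Definition ode_rhs t H (K : R) :=
  [/\ forall s r r', 0 <= s <= t -> r <= r' -> H s r <= H s r',
      forall s r r', 0 <= s <= t -> r <= r' -> H s r' - H s r <= K * (r' - r) &
      forall y : R -> R, continuous y -> measurable_fun `[0, t] (fun s => H s (y s))].

(* Iterate [y |-> y00 + int_0^s H(z, y(z)) dz], which is monotone, from below: the
   start [- A exp ((K + 1) s)] is a subsolution and [G] stays above all iterates. *)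
Lemma monotone_ode t H (K c A B C' y00 : R) G :
  0 < t -> 0 <= K -> ode_rhs t H K ->
  0 <= c -> (forall s, 0 <= s <= t -> - c <= H s 0) ->
  c <= A -> - A <= y00 ->
  (forall s, 0 <= s <= t -> - A <= G s <= B) ->
  (forall x y, 0 <= x -> x <= y -> y <= t -> - C' * (y - x) <= G y - G x) ->
  {ae mu, forall s, 0 < s < t -> straddle_ge G s (H s (G s))} ->
  y00 <= G 0 ->
  exists y : R -> R, [/\ ac_on 0 t y, y 0 = y00,
    {ae mu, forall s, 0 < s < t -> is_derive s 1 y (H s (y s))} &
    forall s, 0 <= s <= t -> y s <= G s].
Proof.
move=> t0 K0 [Hmono Hlip Hmeas] c0 Hc cA Ay GAB GC' aeG yG.
have t00 := ltW t0.
pose y0 s : R := - A * expR ((K + 1) * s).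
have A0 : 0 <= A by lra.
have exp1 s : 0 <= s -> 1 <= expR ((K + 1) * s).
  by move=> s0; rewrite -[X in X <= _]expR0 ler_expR mulr_ge0//; lra.
have dy0 s : is_derive s 1 y0 ((K + 1) * y0 s).
  rewrite /y0; apply: is_derive_eq.
  by rewrite /GRing.scale/=; ring.
have y0A s : 0 <= s -> y0 s <= - A.
  by move=> /exp1 h; rewrite /y0; nra.
have cy0 : continuous y0.
  move=> s; apply: differentiable_continuous.
  by apply/derivable1_diffP; case: (dy0 s).
pose Y := A * expR ((K + 1) * t).
have yY s : 0 <= s <= t -> - Y <= y0 s.
  move=> /andP[s0 st]; rewrite /Y /y0 mulNr lerN2 ler_wpM2l// ler_expR.
  by rewrite ler_wpM2l//; lra.
have Y0 : 0 <= Y by rewrite mulr_ge0// expR_ge0.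
(* Since y0 <= - A <= - c, the Lipschitz bound gives H(s, y0) >= - c + K y0 >= (K + 1) y0: the start
   is a subsolution. *)
have Hy0 s : 0 <= s <= t -> (K + 1) * y0 s <= H s (y0 s).
  move=> st; have := Hc _ st; have y0s : y0 s <= - A by apply: y0A; case/andP: st.
  have := Hlip s (y0 s) 0 st ltac:(lra); nra.
pose Cl := (K + 1) * Y.
have HCl s r : 0 <= s <= t -> y0 s <= r -> - Cl <= H s r.
  move=> st sr; apply: le_trans (Hmono _ _ _ st sr); apply: le_trans (Hy0 _ st).
  by have := yY _ st; rewrite /Cl; nra.
pose P (y : R -> R) := continuous y /\ forall s, 0 <= s <= t -> y0 s <= y s <= G s.
pose T (y : R -> R) s : R := y00 + primitive t (fun s => H s (y s)) (clamp t s).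
(* Integrability comes from [G]: by monotonicity H(s, y) <= H(s, G), so [G] is a supersolution for
   this integrand and also lies above the new iterate. *)
have PT (y : R -> R) : P y -> mu.-integrable `[0, t] (EFin \o (fun s => H s (y s))) /\ P (T y).
  move=> [cy yb].
  have fC z : 0 <= z <= t -> - Cl <= H z (y z).
    by move=> zt; apply: HCl => //; case/andP: (yb _ zt).
  have [|intf fG] := ae_straddle_integrable t00 (Hmeas _ cy) fC GC'.
    apply: ae_sub aeG => s h st; apply: straddle_geW (h st).
    have st' : 0 <= s <= t by case/andP: st => ? ?; rewrite !ltW.
    by apply: Hmono => //; case/andP: (yb _ st').
  split=> //; split=> [s|s st].
    apply: cvgD; first exact: cvg_cst.
    by apply: continuous_clamp => //; exact: primitive_ac intf fC.
  rewrite /T clamp_id//; apply/andP; split; last first.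
    case/andP: st => s0 st; have := fG 0 s (lexx _) s0 st.
    by rewrite primitive0; lra.
  case/andP: st => s0 st.
  have acP := primitive_ac t00 intf fC.
  have ac0 : ac_on 0 t y0.
    apply: (ac_on_lipschitz (C := Cl) _ (ac_on_id 0 t)).
    move=> a b a0 ab bt; apply: (is_derive_lipschitz dy0) => // z /andP[az zb].
    have zt : 0 <= z <= t by apply/andP; split; lra.
    rewrite ler_norml /Cl; have := yY _ zt; have := y0A z ltac:(by case/andP: zt).
    by move=> ? ?; apply/andP; split; nra.
  have acPy : ac_on 0 t (fun z => primitive t (fun s => H s (y s)) z - y0 z).
    apply: (@ac_on_dominated _ _ _ _ 0 t _ _ _ 1 _ acP ac0) => a b _ _ _.
    rewrite mul1r -[_ - _ - _]addrA opprB [- y0 b + _]addrC.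
    rewrite (_ : _ + _ = (primitive t (fun s => H s (y s)) b - primitive t (fun s => H s (y s)) a) - (y0 b - y0 a)).
      exact: ler_normB.
    by lra.
  have := @ae_increment_ge _ 0 s _ 0 s0 (ac_onS (lexx _) st acPy).
  move=> /(_ _)/wrap[].
    have := ae_derive_primitive intf; apply: ae_sub => z hz /andP[z0 zs].
    have zt : 0 < z < t by apply/andP; split; lra.
    have zt' : 0 <= z <= t by apply/andP; split; lra.
    exists (H z (y z) - (K + 1) * y0 z).
      by apply: is_deriveB; exact: hz.
    rewrite subr_ge0; apply: le_trans (Hy0 _ zt') _.
    by apply: Hmono => //; case/andP: (yb _ zt').
  rewrite mul0r primitive0 {2}/y0 mulr0 expR0; lra.
pose Yk k := iter k T y0.
have Py0 : P y0.
  split=> // s st; rewrite lexx/=; have /andP[s0 _] := st.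
  by have := y0A _ s0; have /andP[? _] := GAB _ st; lra.
have PY k : P (Yk k) by elim: k => [//|k IH]; have [] := PT _ IH.
have YS k s : 0 <= s <= t -> Yk k s <= Yk k.+1 s.
  elim: k s => [|k IH] s st; first by have [_ /(_ _ st)/andP[]] := PY 1%N.
  rewrite /Yk iterS [in leRHS]iterS -/(Yk k) -/(Yk k.+1) /T lerD2l clamp_id//.
  case/andP: st => s0 st.
  have := @le_primitive _ t _ _ 0 s (PT _ (PY k)).1 (PT _ (PY k.+1)).1 _ (lexx _) s0 st.
  rewrite !primitive0 !subr0; apply=> z zt; apply: Hmono => //; exact: IH.
have Ynd s : 0 <= s <= t -> {homo (fun k => Yk k s) : k m / (k <= m)%N >-> k <= m}.
  move=> st; apply/nondecreasing_seqP => k; exact: YS.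
have Ycvg s : 0 <= s <= t -> cvg (Yk k s @[k --> \oo]).
  move=> st; apply: nondecreasing_is_cvgn; first exact: Ynd.
  by exists (G s) => _ [k _ <-]; have [_ /(_ _ st)/andP[]] := PY k.
pose yl s : R := lim (Yk k s @[k --> \oo]).
have ylY k s : 0 <= s <= t -> Yk k s <= yl s.
  by move=> st; apply: nondecreasing_cvgn_le; [exact: Ynd|exact: Ycvg].
have ylG s : 0 <= s <= t -> yl s <= G s.
  move=> st; apply: limr_le; first exact: Ycvg.
  by apply: nearW => k; have [_ /(_ _ st)/andP[]] := PY k.
have Hcvg s : 0 <= s <= t -> H s (Yk k s) @[k --> \oo] --> H s (yl s).
  move=> st; apply/cvgrPdist_le => e e0.
  have K1 : 0 < K + 1 by lra.
  have eK : 0 < e / (K + 1) by rewrite divr_gt0.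
  have /cvgrPdist_lt/(_ _ eK) : Yk k s @[k --> \oo] --> yl s by exact: Ycvg.
  apply: filterS => k; have yk := ylY k s st.
  rewrite !ger0_norm ?subr_ge0//; last exact: Hmono.
  rewrite ltr_pdivlMr// => h; apply: le_trans (Hlip _ _ _ st yk) _; nra.
pose f s := H s (yl s).
have Gint := (PT _ Py0).1.
(* Dominating function: the iterates lie between [y0] and [G], at most [B + Y] above [y0]. *)
pose g s := `|H s (y0 s)| + K * (B + Y).
have intg : mu.-integrable `[0, t] (EFin \o g).
  rewrite (_ : _ \o _ =
      ((EFin \o (fun z => `|H z (y0 z)|)%R) \+ (EFin \o cst (K * (B + Y))%R))%E)//.
  apply: integrableD => //; last exact: integrable_cst_itv.
  exact: integrable_norm Gint.
have fg k z : 0 <= z <= t -> `|H z (Yk k z)| <= g z.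
  move=> zt; have [_ /(_ _ zt)/andP[h1 h2]] := PY k.
  have h3 := Hmono _ _ _ zt h1; have h4 := Hlip _ _ _ zt h1.
  have /andP[_ h5] := GAB _ zt; have h6 := yY _ zt.
  have h7 : K * (Yk k z - y0 z) <= K * (B + Y) by rewrite ler_wpM2l//; lra.
  have h8 : 0 <= K * (Yk k z - y0 z) by rewrite mulr_ge0//; lra.
  have := ler_norm (H z (y0 z)); have := ler_norm (- H z (y0 z)); rewrite normrN.
  by rewrite /g ler_norml => *; apply/andP; split; lra.
have mk k : measurable_fun `[0, t] (fun s => H s (Yk k s)).
  by apply: Hmeas; have [] := PY k.
have lims s : 0 <= s <= t -> mu.-integrable `[0, t] (EFin \o f) /\
    primitive t (fun s => H s (Yk k s)) s @[k --> \oo] --> primitive t f s.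
  by move=> st; exact: (primitive_cvg mk Hcvg intg fg st).
have intf : mu.-integrable `[0, t] (EFin \o f) by apply: (lims 0 _).1; rewrite lexx.
have ylE s : 0 <= s <= t -> yl s = y00 + primitive t f s.
  move=> st.
  have cvl : y00 + primitive t (fun s => H s (Yk k s)) s @[k --> \oo] --> y00 + primitive t f s.
    by apply: cvgD; [exact: cvg_cst|exact: (lims s st).2].
  have YE : (fun k => Yk k.+1 s) = (fun k => y00 + primitive t (fun s => H s (Yk k s)) s).
    by apply/funext => k; rewrite /Yk iterS -/(Yk k) /T clamp_id.
  have : Yk k.+1 s @[k --> \oo] --> y00 + primitive t f s by rewrite YE.
  move=> cvS; have := cvg_shiftS (fun k => Yk k s) (nbhs (y00 + primitive t f s)).
  by move=> E; apply: cvg_lim => //; rewrite -E.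
have fC z : 0 <= z <= t -> - Cl <= f z.
  by move=> zt; apply: HCl => //; exact: (ylY 0%N).
exists (fun s => y00 + primitive t f s); split.
- apply: (ac_on_lipschitz (C := 1) _ (primitive_ac t00 intf fC)) => a b _ _ _.
  by rewrite mul1r opprD addrACA subrr add0r.
- by rewrite primitive0 addr0.
- have := ae_derive_primitive intf; apply: ae_sub => s h st.
  have st' : 0 <= s <= t by case/andP: st => ? ?; rewrite !ltW.
  have hs := h st; rewrite -ylE//.
  by have := is_deriveD (is_derive_cst y00 s 1) hs; rewrite add0r.
- by move=> s st; rewrite -ylE//; exact: ylG.
Qed.

End ode.

(** * A priori bounds through the inverse hyperbolic sine *)

Section arsinh.
Context {R : realType}.
Implicit Types (t s x y r : R).
Local Notation mu := (@lebesgue_measure R).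

Definition arsinh r : R := ln (r + Num.sqrt (1 + r ^+ 2)).

Lemma sqrt1D_gt0 r : 0 < Num.sqrt (1 + r ^+ 2).
Proof. by rewrite sqrtr_gt0; have := sqr_ge0 r; lra. Qed.

Lemma sqrt1D_ge r : 1 <= Num.sqrt (1 + r ^+ 2) /\ `|r| <= Num.sqrt (1 + r ^+ 2).
Proof.
have r2 := sqr_ge0 r; split.
  by rewrite -[X in X <= _]sqrtr1 ler_sqrt; lra.
by rewrite -sqrtr_sqr ler_sqrt; lra.
Qed.

Lemma sqrt1D_sqr r : Num.sqrt (1 + r ^+ 2) ^+ 2 = 1 + r ^+ 2.
Proof. by rewrite sqr_sqrtr//; have := sqr_ge0 r; lra. Qed.

Lemma arsinh_arg_gt0 r : 0 < r + Num.sqrt (1 + r ^+ 2).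
Proof.
have := sqrt1D_sqr r; have := sqrt1D_gt0 r; have := sqr_ge0 r.
have [_] := sqrt1D_ge r; rewrite ler_norml => /andP[h _].
set q := Num.sqrt _ in h * => r2 q0 q2.
rewrite lt_neqAle; apply/andP; split; last by lra.
apply/eqP => h0; have qr : q = - r by lra.
by move: q2; rewrite qr sqrrN; lra.
Qed.

Lemma is_derive_arsinh r : is_derive r 1 arsinh (Num.sqrt (1 + r ^+ 2))^-1.
Proof.
have E0 := arsinh_arg_gt0 r; have q0 := sqrt1D_gt0 r.
have r20 : 0 < 1 + r ^+ 2 by have := sqr_ge0 r; lra.
have dsq := is_derive1_sqrt r20.
have dln := is_derive1_ln E0.
have d1 : is_derive r 1 (fun r : R => 1 + r ^+ 2) (2 * r).
  by apply: is_derive_eq; rewrite /GRing.scale/=; ring.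
have d2 := @is_derive1_comp _ Num.sqrt (fun r : R => 1 + r ^+ 2) _ _ _ dsq d1.
have d3 : is_derive r 1 (fun r : R => r + Num.sqrt (1 + r ^+ 2))
    (1 + (2 * Num.sqrt (1 + r ^+ 2))^-1 * (2 * r)).
  by apply: is_deriveD; exact: d2.
have d4 := @is_derive1_comp _ (@ln R) (fun r : R => r + Num.sqrt (1 + r ^+ 2)) _ _ _ dln d3.
rewrite (_ : (Num.sqrt (1 + r ^+ 2))^-1 = (r + Num.sqrt (1 + r ^+ 2))^-1 *
    (1 + (2 * Num.sqrt (1 + r ^+ 2))^-1 * (2 * r))); first exact: d4.
set q := Num.sqrt _ in E0 q0 *; field.
by rewrite !gt_eqF.
Qed.

Lemma arsinh_lip a b : a <= b -> `|arsinh b - arsinh a| <= 1 * `|b - a|.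
Proof.
move=> ab; apply: (is_derive_lipschitz is_derive_arsinh) => // s _.
have q0 := sqrt1D_gt0 s; rewrite ger0_norm; last by rewrite invr_ge0 ltW.
rewrite invf_le1//; by have [] := sqrt1D_ge s.
Qed.

Lemma arsinh_le a b : a <= b -> arsinh a <= arsinh b.
Proof.
move=> ab; have [|c _ H] := MVT_segment ab (fun s _ => is_derive_arsinh s).
  apply: continuous_subspaceT => s; apply: differentiable_continuous.
  by apply/derivable1_diffP; case: (is_derive_arsinh s).
by rewrite -subr_ge0 H mulr_ge0 ?subr_ge0// invr_ge0 ltW// sqrt1D_gt0.
Qed.

Lemma arsinhN r : arsinh (- r) = - arsinh r.
Proof.
rewrite /arsinh sqrrN -lnV ?posrE ?arsinh_arg_gt0//; congr ln.
have E0 := arsinh_arg_gt0 r; have := sqrt1D_sqr r.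
set q := Num.sqrt _ in E0 * => q2.
apply: (mulIf (lt0r_neq0 E0)); rewrite mulVf ?lt0r_neq0//.
by rewrite mulrDl !mulrDr; rewrite -!expr2 q2; ring.
Qed.

Lemma le_expR_arsinh r : r <= expR (arsinh r).
Proof.
rewrite /arsinh lnK ?posrE ?arsinh_arg_gt0// lerDl.
exact/ltW/sqrt1D_gt0.
Qed.

(* [arsinh] is smooth with derivative comparable to 1 / (1 + |r|), which turns the
   inequality [y' >= - c - K |y|] into monotonicity up to a linear term. *)
Lemma arsinh_increment_ge t (y : R -> R) (c K : R) : 0 <= c -> 0 <= K ->
  ac_on 0 t y ->
  {ae mu, forall s, 0 < s < t -> exists2 D, is_derive s 1 y D & - c - K * `|y s| <= D} ->
  forall a b, 0 <= a -> a <= b -> b <= t ->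
    - (c + K) * (b - a) <= arsinh (y b) - arsinh (y a).
Proof.
move=> c0 K0 acy ae a b a0 ab bt.
have acpsi : ac_on 0 t (arsinh \o y).
  apply: (ac_on_lipschitz (C := 1) _ acy) => u v _ _ _ /=.
  have [uv|/ltW vu] := leP (y u) (y v); first exact: arsinh_lip.
  by rewrite distrC [ `|y v - _|]distrC; exact: arsinh_lip.
apply: (ae_increment_ge ab (ac_onS a0 bt acpsi)).
apply: ae_sub ae => s h /andP[sa sb].
have [|D dD hD] := h; first by apply/andP; split; lra.
have q0 := sqrt1D_gt0 (y s); have [q1 qy] := sqrt1D_ge (y s).
exists ((Num.sqrt (1 + y s ^+ 2))^-1 * D).
  by apply: is_derive1_comp; exact: is_derive_arsinh.
rewrite mulrC ler_pdivlMr//; apply: le_trans hD.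
have : K * `|y s| <= K * Num.sqrt (1 + y s ^+ 2) by rewrite ler_wpM2l.
have : c * 1 <= c * Num.sqrt (1 + y s ^+ 2) by rewrite ler_wpM2l.
lra.
Qed.

(** The differential inequality goes one way: followed backwards from the final value it bounds
    [y s] from above, followed forwards from the initial value it bounds [y s] from below.
    [le_expR_arsinh] then removes [arsinh]. *)
Lemma growth_bound t (y : R -> R) (c K m : R) : 0 <= t -> 0 <= c -> 0 <= K ->
  ac_on 0 t y ->
  {ae mu, forall s, 0 < s < t -> exists2 D, is_derive s 1 y D & - c - K * `|y s| <= D} ->
  y t <= m -> forall s, 0 <= s <= t ->
  `|y s| <= expR (arsinh m + (c + K) * t) + expR (- arsinh (y 0) + (c + K) * t).
Proof.
move=> t0 c0 K0 acy ae ytm s /andP[s0 st].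
have h1 := arsinh_increment_ge c0 K0 acy ae s0 st (lexx t).
have h2 := arsinh_increment_ge c0 K0 acy ae (lexx 0) s0 st.
have h3 := arsinh_le ytm.
have e1 := expR_ge0 (arsinh m + (c + K) * t).
have e2 := expR_ge0 (- arsinh (y 0) + (c + K) * t).
have cs : (c + K) * s <= (c + K) * t by rewrite ler_wpM2l//; lra.
have cs' : 0 <= (c + K) * s by rewrite mulr_ge0//; lra.
have h4 : y s <= expR (arsinh m + (c + K) * t).
  by apply: le_trans (le_expR_arsinh _) _; rewrite ler_expR; lra.
have h5 : - y s <= expR (- arsinh (y 0) + (c + K) * t).
  by apply: le_trans (le_expR_arsinh _) _; rewrite ler_expR arsinhN; lra.
rewrite ler_norml; apply/andP; split; lra.
Qed.

End arsinh.

(** * Tonelli problems with nondecreasing dependence on the state *)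

Section linear_functional.
Context {R : realType} {n : nat}.
Implicit Types (v w : 'rV[R]_n) (p : 'rV[R]_n -> R).

Lemma coord_le_norm v (j : 'I_n) : `|v ord0 j| <= `|v|.
Proof.
rewrite [leRHS]/Num.Def.normr/= mx_normrE.
exact: (le_bigmax _ _ (ord0, j)).
Qed.

Lemma norm_le_coord v (C : R) : 0 <= C -> (forall j, `|v ord0 j| <= C) -> `|v| <= C.
Proof.
move=> C0 H; rewrite [leLHS]/Num.Def.normr/= mx_normrE.
by apply: bigmax_le => // -[i j] _ /=; rewrite (ord1 i).
Qed.

(** Stated with subtraction, the form in which increments of curves and differences [v - w]
    enter. *)
Definition lin_form p :=
  (forall v w, p (v - w) = p v - p w) /\ (forall a v, p (a *: v) = a * p v).

Lemma lin_form_bounded p : lin_form p -> exists2 C : R, 0 <= C & forall v, `|p v| <= C * `|v|.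
Proof.
move=> [pB pZ].
have p0 : p 0 = 0 by rewrite -[0](subrr 0) pB subrr.
have pN w : p (- w) = - p w by rewrite -[- w]sub0r pB p0 sub0r.
have pD v w : p (v + w) = p v + p w by rewrite -{1}[w]opprK pB pN opprK.
exists (\sum_(j < n) `|p (delta_mx 0 j)|); first exact: sumr_ge0.
move=> v; rewrite {1}[v]row_sum_delta (big_morph p pD p0).
apply: le_trans (ler_norm_sum _ _ _) _; rewrite mulr_suml; apply: ler_sum => j _.
by rewrite pZ normrM mulrC ler_wpM2l//; exact: coord_le_norm.
Qed.

Lemma lin_form_derive p (xi : R -> 'rV[R]_n) (s : R) w : lin_form p -> is_derive s 1 xi w ->
  is_derive s 1 (fun s => p (xi s)) (p w).
Proof.
move=> plin /straddle_diffP dxi; apply/straddle_diffP => e e0.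
have [C C0 pC] := lin_form_bounded plin; case: plin => pB pZ.
have C1 : 0 < C + 1 by lra.
have e1 : 0 < e / (C + 1) by rewrite divr_gt0.
have [d d0 H] := dxi _ e1; exists d => // x y x1 x2 y1 y2.
have h := H x y x1 x2 y1 y2.
rewrite (_ : _ - _ = p (xi y - xi x - (y - x) *: w)); last by rewrite !pB pZ.
apply: le_trans (pC _) _; apply: (@le_trans _ _ ((C + 1) * `|xi y - xi x - (y - x) *: w|)).
  by rewrite ler_wpM2r//; lra.
by rewrite -ler_pdivlMl// mulrA [_^-1 * _]mulrC.
Qed.

Lemma lin_form_ac p (xi : R -> 'rV[R]_n) a b : lin_form p -> ac_on a b xi ->
  ac_on a b (fun s => p (xi s)).
Proof.
move=> plin; have [C _ pC] := lin_form_bounded plin; case: plin => pB pZ.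
by apply: (ac_on_lipschitz (C := C)) => x y _ _ _; rewrite -pB; exact: pC.
Qed.

Lemma lin_form_coord (c : R) (j : 'I_n) : lin_form (fun v => c * v ord0 j).
Proof. by split=> [v w|a v]; rewrite !mxE; ring. Qed.

Lemma lin_form0 : lin_form (fun=> 0).
Proof. by split=> *; rewrite ?subrr ?mulr0. Qed.

End linear_functional.

Section tonelli.
Context {R : realType} {n : nat}.
Implicit Types (t s r a b m : R) (v w x : 'rV[R]_n) (xi : R -> 'rV[R]_n) (y : R -> R).
Implicit Types (M : R -> 'rV[R]_n -> R -> 'rV[R]_n -> R).
Local Notation mu := (@lebesgue_measure R).

(** What the direct method uses of the rescaled Lagrangian: convexity enters as affine support in
    [v], and superlinearity at state 0 spreads to other states by the Lipschitz bound. *)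
Record tonelli t M (K : R) : Prop := Tonelli {
  tonelli_cont : continuous (fun p : R * 'rV[R]_n * R * 'rV[R]_n =>
     M p.1.1.1 p.1.1.2 p.1.2 p.2);
  tonelli_mono : forall s x r r' v, r <= r' -> M s x r v <= M s x r' v;
  tonelli_lip : forall s x r r' v, r <= r' -> M s x r' v - M s x r v <= K * (r' - r);
  tonelli_support : forall s x r w, exists2 p, lin_form p &
     forall v, M s x r w + p (v - w) <= M s x r v;
  tonelli_superlinear : forall Q, 0 <= Q -> exists2 C, 0 <= C &
     forall s x v, 0 <= s <= t -> Q * `|v| - C <= M s x 0 v;
  tonelli_gt0 : 0 <= K }.

Record tonelli_solution t M x0 x (y0 : R) xi y : Prop := TonelliSolution {
  sol_ac_curve : ac_on 0 t xi;
  sol_start : xi 0 = x0;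
  sol_end : xi t = x;
  sol_ac : ac_on 0 t y;
  sol_init : y 0 = y0;
  sol_eq : {ae mu, forall s, 0 < s < t ->
     is_derive s 1 y (M s (xi s) (y s) (derive1 xi s))} }.

Lemma tonelli_lipN t M K s x r r' v : tonelli t M K ->
  M s x r v - K * `|r' - r| <= M s x r' v.
Proof.
move=> tM; have K0 := tonelli_gt0 tM.
have [rr'|r'r] := leP r r'.
  have := tonelli_mono tM s x v rr'.
  have : 0 <= K * `|r' - r| by rewrite mulr_ge0.
  lra.
have := tonelli_lip tM s x v (ltW r'r).
by rewrite ler0_norm; [lra|lra].
Qed.

Lemma tonelli_lower t M K Q : tonelli t M K -> 0 <= Q -> exists2 C, 0 <= C &
  forall s x r v, 0 <= s <= t -> Q * `|v| - C - K * `|r| <= M s x r v.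
Proof.
move=> tM /(tonelli_superlinear tM)[C C0 HC]; exists C => // s x r v st.
have := tonelli_lipN s x 0 r v tM; rewrite subr0.
by have := HC s x v st; lra.
Qed.

(** The derivative of y - p(xi) is at least [k], so an affine minorant integrates to a quantity that
    sees the curve only at [a] and [b]. This stands in for weak convergence of derivatives. *)
Lemma sol_increment t M x0 x (y0 : R) xi y p (k : R) a b :
  tonelli_solution t M x0 x y0 xi y -> lin_form p ->
  0 <= a -> a <= b -> b <= t ->
  (forall s v, a < s < b -> k + p v <= M s (xi s) (y s) v) ->
  k * (b - a) + p (xi b - xi a) <= y b - y a.
Proof.
move=> sol plin a0 ab bt H.
have acp := lin_form_ac plin (sol_ac_curve sol).
have acg : ac_on 0 t (fun s => y s - p (xi s)).
  apply: (@ac_on_dominated _ _ _ _ 0 t _ _ _ 1 _ (sol_ac sol) acp) => u v _ _ _.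
  rewrite mul1r (_ : _ - _ = (y v - y u) - (p (xi v) - p (xi u))); last by ring.
  exact: ler_normB.
suff : k * (b - a) <= (y b - p (xi b)) - (y a - p (xi a)).
  by case: plin => -> _; lra.
apply: (@ae_increment_ge _ a b (fun s => y s - p (xi s)) k ab (ac_onS a0 bt acg)).
have := ae_and (sol_eq sol) (ac_row_ae_derivable (sol_ac_curve sol)).
apply: ae_sub => s [h1 h2] /andP[sa sb].
have st : 0 < s < t by apply/andP; split; lra.
have dxi : is_derive s 1 xi (derive1 xi s).
  by apply: DeriveDef; [exact: h2|rewrite derive1E].
exists (M s (xi s) (y s) (derive1 xi s) - p (derive1 xi s)).
  by apply: is_deriveB; [exact: h1|exact: lin_form_derive].
by have := H s (derive1 xi s); rewrite sa sb => /(_ isT); lra.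
Qed.

Lemma sol_bounded t M K x0 x (y0 m : R) : 0 <= t -> tonelli t M K ->
  exists2 B, 0 <= B & forall xi y, tonelli_solution t M x0 x y0 xi y -> y t <= m ->
    forall s, 0 <= s <= t -> `|y s| <= B.
Proof.
move=> t0 tM; have [C C0 HC] := tonelli_lower tM (lexx 0).
have K0 := tonelli_gt0 tM.
exists (expR (arsinh m + (C + K) * t) + expR (- arsinh y0 + (C + K) * t)).
  by rewrite addr_ge0// expR_ge0.
move=> xi y sol ym s st; rewrite -(sol_init sol).
apply: (growth_bound t0 C0 K0 (sol_ac sol)) => //.
have := sol_eq sol; apply: ae_sub => z h zt; exists (M z (xi z) (y z) (derive1 xi z)).
  exact: h.
have := HC z (xi z) (y z) (derive1 xi z); rewrite mul0r sub0r; apply.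
by case/andP: zt => ? ?; rewrite !ltW.
Qed.

(** The norm is the largest absolute value of a coordinate, so [sol_increment] is applied with plus
    and minus [Q] times a coordinate; the zero form shows the right side to be nonnegative. Large
    [Q] gives uniform absolute continuity. *)
Lemma sol_estimate t M K (B Q : R) : tonelli t M K -> 0 <= Q ->
  exists2 C, 0 <= C & forall x0 x (y0 : R) xi y, tonelli_solution t M x0 x y0 xi y ->
    (forall s, 0 <= s <= t -> `|y s| <= B) ->
    forall a b, 0 <= a -> a <= b -> b <= t ->
    Q * `|xi b - xi a| <= y b - y a + C * (b - a).
Proof.
move=> tM Q0; have [C C0 HC] := tonelli_lower tM Q0; have K0 := tonelli_gt0 tM.
exists (C + K * `|B|); first by rewrite addr_ge0// mulr_ge0.
move=> x0 x y0 xi y sol yB a b a0 ab bt.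
have key p : lin_form p -> (forall v, p v <= Q * `|v|) ->
    p (xi b - xi a) <= y b - y a + (C + K * `|B|) * (b - a).
  move=> plin pQ.
  suff : - (C + K * `|B|) * (b - a) + p (xi b - xi a) <= y b - y a by lra.
  apply: (sol_increment sol plin a0 ab bt) => s v /andP[sa sb].
  have st : 0 <= s <= t by apply/andP; split; lra.
  have := HC s (xi s) (y s) v st; have := pQ v.
  have : K * `|y s| <= K * `|B|.
    by rewrite ler_wpM2l//; apply: le_trans (yB _ st) _; exact: ler_norm.
  lra.
have RHS0 : 0 <= y b - y a + (C + K * `|B|) * (b - a).
  by apply: (key (fun=> 0) lin_form0) => v; rewrite mulr_ge0.
move: Q0; rewrite le_eqVlt => /predU1P[<-|Q0]; first by rewrite mul0r.
rewrite -ler_pdivlMl//; apply: norm_le_coord => [|j].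
  by rewrite mulr_ge0// invr_ge0 ltW.
rewrite ler_pdivlMl//.
have hj v : Q * `|v ord0 j| <= Q * `|v| by rewrite ler_wpM2l ?coord_le_norm// ltW.
have h1 := key _ (lin_form_coord Q j) (fun v => le_trans (ler_wpM2l (ltW Q0) (ler_norm _)) (hj v)).
have h2 := key _ (lin_form_coord (- Q) j).
move: h2 => /(_ _)/wrap[v|]; last first.
  move: h1; set z := (xi b - xi a) ord0 j => h1 h2.
  rewrite -[X in X * _ <= _](gtr0_norm Q0) -normrM ler_norml; apply/andP; split; lra.
apply: le_trans (hj v); rewrite mulNr -mulrN ler_wpM2l//; first exact: ltW.
by rewrite -normrN ler_norm.
Qed.

End tonelli.

(** * Solutions along a given curve and stability of affine support *)

Section existence.
Context {R : realType} {n : nat}.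
Implicit Types (t s r a b m : R) (v w x : 'rV[R]_n) (xi : R -> 'rV[R]_n) (y : R -> R).
Implicit Types (M : R -> 'rV[R]_n -> R -> 'rV[R]_n -> R).
Local Notation mu := (@lebesgue_measure R).

(** Putting 0 for the right-hand side on the exceptional null set gives monotonicity and the
    Lipschitz bound at every time, as [monotone_ode] demands. *)
Lemma solve_along t M K xi (G : R -> R) (A B C' y0 : R) :
  0 < t -> tonelli t M K -> ac_on 0 t xi -> - A <= y0 ->
  (forall s, 0 <= s <= t -> - A <= G s <= B) ->
  (forall a b, 0 <= a -> a <= b -> b <= t -> - C' * (b - a) <= G b - G a) ->
  {ae mu, forall s, 0 < s < t -> straddle_ge G s (M s (xi s) (G s) (derive1 xi s))} ->
  y0 <= G 0 ->
  exists y, [/\ ac_on 0 t y, y 0 = y0,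
    {ae mu, forall s, 0 < s < t -> is_derive s 1 y (M s (xi s) (y s) (derive1 xi s))} &
    forall s, 0 <= s <= t -> y s <= G s].
Proof.
move=> t0 tM acxi Ay GAB GC' aeG yG; have K0 := tonelli_gt0 tM.
have [N [mN N0 HN mH]] := measurable_along (ltW t0) (tonelli_cont tM) acxi.
have [C C0 HC] := tonelli_lower tM (lexx 0).
pose H s r := ((fun s => M s (xi s) r (derive1 xi s)) \_ (~` N)) s.
have HM s r : ~ N s -> H s r = M s (xi s) r (derive1 xi s).
  by move=> Ns; rewrite /H patchE mem_set.
have H0 s r : N s -> H s r = 0.
  by move=> Ns; rewrite /H patchE memNset//= => /(_ Ns).
have aeN : {ae mu, forall s, ~ N s}.
  by exists N; split=> // s /= /contrapT.
(* [monotone_ode] needs a bound that also dominates [C], hence [|A| + C]. *)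
have [||||||y [acy y0E dy yG']] := @monotone_ode R t H K C (`|A| + C) B C' y0 G t0 K0 _ C0 _ _ _ _ GC' _ yG.
- split.
  + move=> s r r' st rr'; case: (pselect (N s)) => Ns; first by rewrite !H0.
    by rewrite !HM//; exact: (tonelli_mono tM).
  + move=> s r r' st rr'; case: (pselect (N s)) => Ns.
      by rewrite !H0// subrr mulr_ge0// subr_ge0.
    by rewrite !HM//; exact: (tonelli_lip tM).
  + exact: mH.
- move=> s st; case: (pselect (N s)) => Ns; first by rewrite H0//; lra.
  rewrite HM//; have := HC s (xi s) 0 (derive1 xi s) st.
  by rewrite mul0r normr0 mulr0 sub0r subr0.
- by have := normr_ge0 A; lra.
- by have := ler_norm A; lra.
- move=> s st; have := GAB s st; have := ler_norm A => ? /andP[? ?].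
  by apply/andP; split; lra.
- have := ae_and aeN aeG; apply: ae_sub => s [Ns h] st.
  by rewrite HM//; exact: h.
exists y; split=> //.
have := ae_and aeN dy; apply: ae_sub => s [Ns h] st.
by have := h st; rewrite HM.
Qed.

(** On the straight segment, G(s) = A exp((K + 1) s) is a supersolution: G' = K G + G >= K G + A >=
    M(s, xi, G, w), as [A] bounds M(s, xi, 0, w). *)
Lemma solution_exists t M K (x0 x : 'rV[R]_n) (y0 : R) : 0 < t -> tonelli t M K ->
  exists xi y, tonelli_solution t M x0 x y0 xi y.
Proof.
move=> t0 tM; have K0 := tonelli_gt0 tM; have t00 := ltW t0.
pose w := t^-1 *: (x - x0).
pose xi s := x0 + s *: w.
have acxi : ac_on 0 t xi.
  apply: (ac_on_lipschitz (C := `|w|) _ (ac_on_id 0 t)) => a b _ _ _.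
  by rewrite /xi opprD addrACA subrr add0r -scalerBl normrZ mulrC.
have dxi s : is_derive s 1 xi w.
  apply/straddle_diffP => e e0; exists 1 => // a b _ ? ? _.
  rewrite /xi opprD addrACA subrr add0r -scalerBl subrr normr0.
  by rewrite mulr_ge0//; lra.
have dE s : derive1 xi s = w by rewrite derive1E; case: (dxi s).
have cxi : continuous xi.
  by move=> s; apply: differentiable_continuous; apply/derivable1_diffP; case: (dxi s).
have [c0 _ Hc0] : exists2 c : R, c \in `[0, t]%R & forall s, s \in `[0, t]%R ->
    M s (xi s) 0 w <= M c (xi c) 0 w.
  apply: (@EVT_max R (fun s => M s (xi s) 0 w)) => //.
  apply: continuous_subspaceT => s.
  apply: (@continuous_comp _ _ _ (fun s => (s, xi s, 0 : R, w))
    (fun p : R * 'rV[R]_n * R * 'rV[R]_n => M p.1.1.1 p.1.1.2 p.1.2 p.2)).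
    by apply: cvg_quadruple; [exact: cvg_id|exact: cxi|exact: cvg_cst|exact: cvg_cst].
  exact: (tonelli_cont tM).
pose A := `|M c0 (xi c0) 0 w| + `|y0|.
have A0 : 0 <= A by rewrite addr_ge0.
pose G s := A * expR ((K + 1) * s).
have dG s : is_derive s 1 G ((K + 1) * G s).
  by rewrite /G; apply: is_derive_eq; rewrite /GRing.scale/=; ring.
have exp1 s : 0 <= s -> 1 <= expR ((K + 1) * s).
  by move=> s0; rewrite -[X in X <= _]expR0 ler_expR mulr_ge0//; lra.
have GA s : 0 <= s -> A <= G s by move=> /exp1 h; rewrite /G; nra.
have Gnd a b : a <= b -> G a <= G b.
  move=> ab; rewrite /G ler_wpM2l// ler_expR ler_wpM2l//; lra.
have yA : `|y0| <= A by rewrite /A lerDr.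
have [|||||y [acy y0E dy _]] := @solve_along t M K xi G A (G t) 0 y0 t0 tM acxi.
- by have := ler_norm (- y0); rewrite normrN; lra.
- move=> s /andP[s0 st]; have := GA _ s0; have := Gnd _ _ st => ? ?.
  by apply/andP; split; lra.
- by move=> a b _ ab _; rewrite oppr0 mul0r subr_ge0; exact: Gnd.
- apply: aeW => s /andP[s0 st]; rewrite dE.
  have := dG s => /straddle_diffP/straddle_diff_ge; apply: straddle_geW.
  have Gs := GA s (ltW s0).
  have G0 : 0 <= G s by lra.
  have h1 := tonelli_lip tM s (xi s) w G0.
  have h2 : M s (xi s) 0 w <= A.
    apply: le_trans (Hc0 s _) _; first by rewrite in_itv/= !ltW.
    by apply: le_trans (ler_norm _) _; rewrite /A lerDl.
  lra.
- by have := ler_norm y0; have := GA 0 (lexx _); lra.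
exists xi, y; split=> //.
- by rewrite /xi scale0r addr0.
- by rewrite /xi /w scalerA divff ?gt_eqF// scale1r subrKC.
Qed.

(** The radius [d] has to serve all [v] at once. For large [v], superlinearity with slope [Cp + 1]
    beats [p]; the remaining [v] form a compact ball, over which continuity is uniform. *)
Lemma support_stable t M K s0 x0 r w p e : tonelli t M K -> 0 < e -> lin_form p ->
  (forall v, M s0 x0 r w + p (v - w) <= M s0 x0 r v) ->
  exists2 d, 0 < d & forall s x v, 0 <= s <= t -> `|s - s0| < d -> `|x - x0| < d ->
    M s0 x0 r w + p (v - w) - e <= M s x r v.
Proof.
move=> tM e0 plin sup; have K0 := tonelli_gt0 tM.
have [Cp Cp0 pC] := lin_form_bounded plin; have [pB pZ] := plin.
have Q0 : 0 <= Cp + 1 by lra.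
have [C C0 HC] := tonelli_lower tM Q0.
(* Beyond this radius the surplus slope 1 pays for all the constants. *)
pose V := C + K * `|r| + `|M s0 x0 r w| + Cp * `|w|.
have V0 : 0 <= V by rewrite !addr_ge0// mulr_ge0.
have cK : compact [set v : 'rV[R]_n | `|v| <= V].
  apply: bounded_closed_compact.
    exists V; split=> [|z Vz v /= vV]; first exact: num_real.
    exact: le_trans (ltW Vz).
  apply: (@closed_comp _ _ (fun v : 'rV[R]_n => `|v|) [set z : R | z <= V]).
    by move=> v _; exact: norm_continuous.
  exact: closed_le.
have cp : continuous p.
  move=> v; apply/(@cvgrPdist_lt _ _ _ (nbhs v) (nbhs_filter v)) => k k0.
  have C1 : 0 < Cp + 1 by lra.
  have kC : 0 < k / (Cp + 1) by rewrite divr_gt0.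
  have : \forall z \near v, `|v - z| < k / (Cp + 1).
    by have := nbhsx_ballx v _ kC; rewrite -ball_normE.
  apply: (@filterS _ _ (nbhs_filter v)) => z; rewrite ltr_pdivlMr// mulrC => vz.
  rewrite -pB; apply: le_lt_trans (pC _) _; apply: le_lt_trans vz.
  by rewrite ler_wpM2r//; lra.
have /compact_near_coveringP cover := cK.
have [] := cover (R * 'rV[R]_n)%type (nbhs (s0, x0))
  (fun q v => M s0 x0 r w + p (v - w) - e < M q.1 q.2 r v) _ _.
  move=> v _.
  have cM : {for ((s0, x0), v), continuous (fun q : R * 'rV[R]_n * 'rV[R]_n =>
      M q.1.1 q.1.2 r q.2 - p q.2)}.
    apply: cvgB; last first.
      by apply: (@continuous_comp _ _ _ (fun q : R * 'rV[R]_n * 'rV[R]_n => q.2) p);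
        [exact: cvg_snd|exact: cp].
    apply: (@continuous_comp _ _ _ (fun q : R * 'rV[R]_n * 'rV[R]_n => (q.1.1, q.1.2, r, q.2))
      (fun p : R * 'rV[R]_n * R * 'rV[R]_n => M p.1.1.1 p.1.1.2 p.1.2 p.2)); last exact: (tonelli_cont tM).
    apply: cvg_quadruple.
    - by apply: cvg_comp; [exact: cvg_fst|exact: cvg_fst].
    - by apply: cvg_comp; [exact: cvg_fst|exact: cvg_snd].
    - exact: cvg_cst.
    - exact: cvg_snd.
  have : \forall q \near ((s0, x0), v), M s0 x0 r w - p w - e < M q.1.1 q.1.2 r q.2 - p q.2.
    apply: (cvgr_gt _ cM) => /=.
    by have := sup v; rewrite pB; lra.
  move=> [[A1 A2] /= [nA1 nA2] A12]; exists (A2, A1) => //= -[v' q] [/= Av Aq].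
  by have := A12 (q, v') (conj Aq Av); rewrite pB /=; lra.
move=> [A1 A2] /= [/nbhs_ballP[d1 /= d10 HA1] /nbhs_ballP[d2 /= d20 HA2]] HA.
exists (Num.min d1 d2) => [|s x v st]; first by rewrite lt_min d10.
rewrite !lt_min => /andP[sd _] /andP[_ xd].
have [vV|Vv] := leP `|v| V.
  apply/ltW; apply: (HA (s, x)) => //; split; [apply: HA1|apply: HA2].
    by rewrite /ball/= distrC.
  by rewrite -ball_normE /ball_/= distrC.
apply: le_trans (HC s x r v st).
have := pC v; have := pC w; rewrite pB !ler_norml => /andP[? ?] /andP[? ?].
have := ler_norm (M s0 x0 r w); move: Vv; rewrite /V; lra.
Qed.

End existence.

(** * Compactness of minimizing sequences *)

Lemma subr_split (V : zmodType) (a b c d : V) :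
  b - a = (d - c) + ((b - d) - (a - c)).
Proof. by rewrite opprB addrACA [d + _]addrC subrK addKr. Qed.

Lemma pos_lower_bound {R : realDomainType} (s : seq R) : all (fun x => 0 < x) s ->
  exists2 d : R, 0 < d & all (fun x => d <= x) s.
Proof.
elim: s => [|x s IH] /=; first by exists 1.
move=> /andP[x0 /IH[d d0 ds]]; exists (Num.min x d); first by rewrite lt_min x0.
rewrite ge_min lexx/=; apply: sub_all ds => z dz.
by rewrite ge_min dz orbT.
Qed.

Section compactness.
Context {R : realType} {n : nat}.
Implicit Types (t s r a b m : R) (v w x : 'rV[R]_n) (xi : R -> 'rV[R]_n) (y : R -> R).
Implicit Types (M : R -> 'rV[R]_n -> R -> 'rV[R]_n -> R).
Local Notation mu := (@lebesgue_measure R).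

(** Compactness gives a cluster point, and it is a limit because an ultrafilter contains every set
    or its complement. *)
Lemma ultra_limit (U : set_system nat) (f : nat -> R) (B : R) : UltraFilter U ->
  (forall k, `|f k| <= B) ->
  exists l : R, forall e, 0 < e -> U [set k | `|f k - l| < e].
Proof.
move=> UU fB; have PU : ProperFilter U by exact: ultra_proper.
have cB := @segment_compact R (- B) B.
have FB : (f @ U) `[- B, B].
  have H : [set: nat] `<=` f @^-1` `[- B, B].
    by move=> k _; rewrite /= in_itv/= -ler_norml.
  exact: (filterS H filterT).
have [l [_ cl]] := cB _ _ FB.
exists l => e e0.
have [//|UC] := in_ultra_setVsetC [set k | `|f k - l| < e] UU.
exfalso.
have [||z [/= Az Bz]] := cl [set z | ~ (`|z - l| < e)] [set z | `|z - l| < e].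
- exact: UC.
- have := nbhsx_ballx l _ e0; rewrite -ball_normE.
  by apply: filterS => z /=; rewrite distrC.
exact: Az Bz.
Qed.

Lemma ultra_limit_row (U : set_system nat) (f : nat -> 'rV[R]_n) (B : R) : UltraFilter U ->
  (forall k, `|f k| <= B) ->
  exists l, forall e, 0 < e -> U [set k | `|f k - l| < e].
Proof.
move=> UU fB; have PU : ProperFilter U by exact: ultra_proper.
have H (j : 'I_n) : exists l : R, forall e, 0 < e -> U [set k | `|f k ord0 j - l| < e].
  apply: (@ultra_limit U (fun k => f k ord0 j) B) => // k.
  exact: le_trans (coord_le_norm _ _) (fB k).
have [l Hl] := choice H; exists (\row_j l j) => e e0.
have e20 : 0 < e / 2 by lra.
have : \forall k \near U, forall j, `|f k ord0 j - l j| < e / 2.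
  by apply: filter_forall => j; exact: Hl.
apply: filterS => k Hk /=.
apply: (@le_lt_trans _ _ (e / 2)); last by lra.
apply: norm_le_coord => [|j]; first exact: ltW.
by rewrite !mxE ltW.
Qed.

(** The increment [D] to be bounded below also occurs in the error term. If it were less than (Mb -
    e) h, that error would be of second order in [h], below e h / 4, and the last hypothesis would
    contradict this. *)
Lemma straddle_bootstrap (K C h D Mb e : R) : 0 <= K -> 0 < h -> 0 < e ->
  K * h * (2 * C + `|Mb - e| + 1) <= e / 4 ->
  h * (Mb - 3 * (e / 4) - K * (D + 2 * C * h)) <= D -> (Mb - e) * h <= D.
Proof.
move=> K0 h0 e0 KL main; rewrite leNgt; apply/negP => Dlt.
have : h * (K * D) <= h * (K * (h * `|Mb - e|)).
  apply: ler_wpM2l; first exact: ltW.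
  apply: ler_wpM2l => //; apply: le_trans (ltW Dlt) _.
  by rewrite mulrC; apply: ler_wpM2l; [exact: ltW|exact: ler_norm].
have : h * (K * h * (2 * C + `|Mb - e| + 1)) <= h * (e / 4) by rewrite ler_wpM2l// ltW.
have : 0 <= h * (K * h) by rewrite !mulr_ge0// ltW.
have : 0 < h * e by rewrite mulr_gt0.
lra.
Qed.

(** As y + C s is nondecreasing, the variation of the state on [a, b] is controlled by its own
    increment: replacing [y s] by [rb] inside [M] costs at most [K * Dk]. *)
Lemma sol_straddle_increment t M K (x0 x : 'rV[R]_n) (y0 : R) xi y q
    (xb w : 'rV[R]_n) (s0 rb Mb C e d eta a b : R) :
  tonelli t M K -> tonelli_solution t M x0 x y0 xi y -> lin_form q ->
  (forall s x v, 0 <= s <= t -> `|s - s0| < d -> `|x - xb| < d ->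
    Mb + q (v - w) - e <= M s x rb v) ->
  0 <= a -> a <= s0 -> s0 <= b -> b <= t -> b - a < d -> 0 <= C ->
  (forall s, a < s < b -> `|xi s - xb| < d) ->
  (forall u v : R, a <= u -> u <= v -> v <= b -> - C * (v - u) <= y v - y u) ->
  `|y s0 - rb| <= eta ->
  (Mb - e - K * (y b - y a + 2 * C * (b - a) + eta)) * (b - a) +
    (q (xi b - xi a) - (b - a) * q w) <= y b - y a.
Proof.
move=> tM sol qlin Hd a0 a2 b1 bt bad C0 near_s up yeta.
have K0 := tonelli_gt0 tM; have [qB qZ] := qlin.
set Dk := y b - y a + 2 * C * (b - a) + eta.
have ynear s : a <= s <= b -> `|y s - rb| <= Dk.
  move=> /andP[as1 sb1].
  rewrite -(subrKA (y s0)); apply: le_trans (ler_normD _ _) _.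
  apply: lerD => //.
  have u1 := up a s (lexx _) as1 sb1; have u2 := up s b as1 sb1 (lexx _).
  have u3 := up a s0 (lexx _) a2 b1; have u4 := up s0 b a2 b1 (lexx _).
  have u5 : 0 <= C * (b - s) by rewrite mulr_ge0// subr_ge0.
  have u6 : 0 <= C * (s - a) by rewrite mulr_ge0// subr_ge0.
  have u7 : 0 <= C * (b - s0) by rewrite mulr_ge0// subr_ge0.
  have u8 : 0 <= C * (s0 - a) by rewrite mulr_ge0// subr_ge0.
  clear - u1 u2 u3 u4 u5 u6 u7 u8.
  rewrite ler_norml; apply/andP; split; lra.
have := @sol_increment _ _ _ _ _ _ _ _ _ q (Mb - q w - e - K * Dk) a b sol qlin a0 (le_trans a2 b1) bt.
move=> /(_ _)/wrap[s v sab|].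
  have st : 0 <= s <= t by case/andP: sab => ? ?; apply/andP; split; lra.
  have ss0 : `|s - s0| < d.
    by clear - sab bad a2 b1; case/andP: sab => ? ?; rewrite ltr_norml; apply/andP; split; lra.
  have h1 := Hd s (xi s) v st ss0 (near_s s sab).
  have h2 := tonelli_lipN s (xi s) rb (y s) v tM.
  have h3 : K * `|y s - rb| <= K * Dk.
    by rewrite ler_wpM2l//; apply: ynear; case/andP: sab => ? ?; rewrite !ltW.
  by clear - h1 h2 h3 qB; rewrite qB in h1; lra.
by clear; lra.
Qed.

Lemma sol_oscillation (V : normedModType R) (xi : R -> V) (y : R -> R) (B C Q d u v : R) : 0 < Q ->
  Q * `|xi v - xi u| <= y v - y u + C * (v - u) ->
  y v - y u <= 2 * B -> C * (v - u) <= 1 -> 2 * B + 1 < Q * d -> `|xi v - xi u| < d.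
Proof.
move=> Q0 h1 h2 h3 h4; rewrite -(ltr_pM2l Q0).
by apply: le_lt_trans h4; apply: le_trans h1 _; exact: lerD.
Qed.

(** Three losses of e / 4 are added up: from the stability of the support, from the derivative of
    the limit curve, and from replacing approximate values by limits up to [eta]. *)
Lemma limit_inequality (h Mb e K C eta qx qxk qw Dk D Cp : R) :
  0 <= h -> 0 <= K -> 0 <= e ->
  (Mb - e / 4 - K * (Dk + 2 * C * h + eta)) * h + (qxk - h * qw) <= Dk ->
  - (e / 4 * h) <= qx - h * qw -> qx - 2 * Cp * eta <= qxk -> Dk <= D + 2 * eta ->
  eta * (2 + 3 * K * h + 2 * Cp) <= h * (e / 4) ->
  h * (Mb - 3 * (e / 4) - K * (D + 2 * C * h)) <= D.
Proof.
move=> h0 K0 e0 key hq hqk hD heta.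
have : K * (Dk + 2 * C * h + eta) <= K * (D + 2 * C * h + 3 * eta) by rewrite ler_wpM2l//; lra.
move=> /(ler_wpM2l h0); lra.
Qed.

(** The order of choices is [e], [d], then [a] and [b], then [eta], then [k]: the ultrafilter
    controls the approximating curve at [a], [s0] and [b] only, with precision [eta] small relative
    to b - a, and between these times [sol_estimate] controls it uniformly in [k]. *)
Lemma limit_straddle (U : set_system nat) t M K (x0 x : 'rV[R]_n) (y0 B : R)
    (xk : nat -> R -> 'rV[R]_n) (yk : nat -> R -> R) xi y s0 :
  ProperFilter U -> tonelli t M K ->
  (forall k, tonelli_solution t M x0 x y0 (xk k) (yk k)) ->
  (forall k s, 0 <= s <= t -> `|yk k s| <= B) ->
  (forall s e, 0 <= s <= t -> 0 < e ->
    U [set k | `|xk k s - xi s| < e /\ `|yk k s - y s| < e]) ->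
  0 < s0 < t -> derivable xi s0 1 ->
  straddle_ge y s0 (M s0 (xi s0) (y s0) (derive1 xi s0)).
Proof.
move=> PU tM sol yB cv s0t dxi.
have FU : Filter U by exact: filter_filter.
have [s00 s0t'] := andP s0t.
have s0i : 0 <= s0 <= t by rewrite !ltW.
have B0 : 0 <= B by exact: le_trans (yB 0%N s0 s0i).
have diffB k a b : 0 <= a <= t -> 0 <= b <= t -> yk k b - yk k a <= 2 * B.
  move=> /(yB k) + /(yB k); rewrite !ler_norml => /andP[h1 h2] /andP[h3 h4].
  by clear - h1 h2 h3 h4; lra.
have est Q : 0 <= Q -> exists2 C, 0 <= C & forall k a b, 0 <= a -> a <= b -> b <= t ->
    Q * `|xk k b - xk k a| <= yk k b - yk k a + C * (b - a).
  move=> Q0; have [C C0 HC] := sol_estimate B tM Q0; exists C => // k a b a0 ab bt.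
  by apply: (HC x0 x y0 _ _ (sol k)) => // s; exact: yB.
have [C1 C10 est1] := est 0 (lexx 0).
have up k (u v : R) : 0 <= u -> u <= v -> v <= t -> - C1 * (v - u) <= yk k v - yk k u.
  move=> u0 uv vt; have := est1 k u v u0 uv vt.
  by rewrite mul0r mulNr -lerBlDr sub0r.
have K0 := tonelli_gt0 tM.
set w := derive1 xi s0.
have [q qlin qsup] := tonelli_support tM s0 (xi s0) (y s0) w.
have [Cp Cp0 qC] := lin_form_bounded qlin; have [qB qZ] := qlin.
set Mb := M s0 (xi s0) (y s0) w in qsup *.
move=> e e0.
have e40 : 0 < e / 4 by rewrite divr_gt0.
have [d1 d10 Hd1] := support_stable tM e40 qlin qsup.
have Cp1 : 0 < Cp + 1 by rewrite ltr_wpDl.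
have eC0 : 0 < e / 4 / (Cp + 1) by rewrite divr_gt0.
have dxi' : is_derive s0 1 xi w by apply: DeriveDef; [exact: dxi|rewrite -derive1E].
have [d2 d20 Hd2] := (straddle_diffP _ _ _).1 dxi' _ eC0.
(* equicontinuity of the approximating curves at the scale [d1] *)
have [Q Q0 QE] : exists2 Q : R, 0 < Q & Q * (d1 / 2) = 4 * B + 2.
  clear - B0 d10; exists ((8 * B + 4) / d1); first by rewrite divr_gt0//; lra.
  by field; rewrite gt_eqF.
have [C2 C20 est2] := est _ (ltW Q0).
have [d3 d30 d3E] : exists2 d3 : R, 0 < d3 & C2 * d3 <= 1.
  clear - C20; exists (C2 + 1)^-1; first by rewrite invr_gt0; lra.
  by rewrite ler_pdivrMr; lra.
(* For b - a <= d4 the smallness hypothesis of [straddle_bootstrap] holds. *)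
pose L0 := 2 * C1 + `|Mb - e| + 1.
have L00 : 0 < L0 by rewrite ltr_wpDl// addr_ge0// mulr_ge0.
have KL0 : 0 < 4 * (K + 1) * L0 by rewrite !mulr_gt0// ltr_wpDl.
have [d4 d40 d4E] : exists2 d4 : R, 0 < d4 & d4 * (4 * (K + 1) * L0) = e.
  by exists (e / (4 * (K + 1) * L0)); [rewrite divr_gt0|rewrite divfK// gt_eqF].
have [|d d0 /and5P[dd1 dd2 dd3 dd4 /and3P[dd5 dd6 _]]] :=
  @pos_lower_bound R [:: d1 / 4; d2; d3 / 2; d4 / 2; s0; t - s0].
  by rewrite /= d20 s00 subr_gt0 s0t' !divr_gt0.
exists d => // a b a1 a2 b1 b2.
have [->|/eqP ab] := eqVneq a b; first by rewrite !subrr mulr0.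
have ab' : a <= b by exact: le_trans b1.
have h0 : 0 < b - a by rewrite subr_gt0 lt_neqAle ab' andbT; exact/eqP.
have a0 : 0 <= a by clear - a1 dd5; lra.
have bt : b <= t by clear - b2 dd6; lra.
have at0 : 0 <= a <= t by rewrite a0 (le_trans ab').
have bt0 : 0 <= b <= t by rewrite bt (le_trans a0).
have hd : b - a <= 2 * d by clear - a1 b2; lra.
have hd1 : b - a < d1 by clear - hd dd1 d10; lra.
have hd3 : b - a <= d3 by clear - hd dd3; lra.
have hd4 : b - a <= d4 by clear - hd dd4; lra.
have Z0 : 0 < 2 + 3 * K * (b - a) + 2 * Cp.
  by rewrite ltr_wpDr ?mulr_ge0// ltr_wpDr// mulr_ge0 ?mulr_ge0// ltW.
have [|eta eta0 /and3P[etad etaZ _]] :=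
  @pos_lower_bound R [:: d1 / 2; (b - a) * (e / 4) / (2 + 3 * K * (b - a) + 2 * Cp)].
  by rewrite /= !divr_gt0// mulr_gt0.
rewrite ler_pdivlMr// in etaZ.
have H1 := @filterI nat U FU _ _ (cv a eta at0 eta0) (cv b eta bt0 eta0).
have H2 := @filterI nat U FU _ _ H1 (cv s0 eta s0i eta0).
have [k [[[ka1 ka2] [kb1 kb2]] [ks1 ks2]]] := @filter_ex nat U PU _ H2.
have osc (u v : R) : a <= u -> u <= v -> v <= b -> `|xk k v - xk k u| < d1 / 2.
  move=> au uv vb; have u0 := le_trans a0 au; have vt := le_trans vb bt.
  apply: (sol_oscillation Q0 (est2 k u v u0 uv vt) (B := B)).
  - by apply: diffB; rewrite ?u0 ?vt ?(le_trans uv) ?(le_trans u0).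
  - apply: le_trans d3E; apply: ler_wpM2l => //; apply: le_trans hd3.
    by clear - au vb; lra.
  - by rewrite QE; clear - B0; lra.
have near_s s : a < s < b -> `|xk k s - xi s0| < d1.
  move=> /andP[/ltW as1 /ltW sb1].
  have h1 : `|xk k s - xk k s0| < d1 / 2.
    have [ss0|/ltW s0s] := leP s s0; last by apply: osc.
    by rewrite distrC; apply: osc.
  rewrite -(subrKA (xk k s0)); apply: le_lt_trans (ler_normD _ _) _.
  by clear - h1 ks1 etad; lra.
have upk (u v : R) : a <= u -> u <= v -> v <= b -> - C1 * (v - u) <= yk k v - yk k u.
  by move=> au uv vb; apply: up => //; [exact: le_trans au|exact: le_trans bt].
have key := sol_straddle_increment tM (sol k) qlin Hd1 a0 a2 b1 bt hd1 C10 near_s upk (ltW ks2).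
apply: (@straddle_bootstrap K C1) => //.
  have K1 : (b - a) * (4 * (K + 1) * L0) <= e by rewrite -d4E ler_wpM2r// ltW.
  have : 0 <= (b - a) * L0 by rewrite mulr_ge0// ltW.
  by move: K1; rewrite /L0; clear; lra.
apply: (limit_inequality (ltW h0) K0 (ltW e0) key _ _ _ etaZ).
- have hh := Hd2 a b ltac:(clear - a1 dd2; lra) a2 b1 ltac:(clear - b2 dd2; lra).
  have hq := qC (xi b - xi a - (b - a) *: w); rewrite qB qZ in hq.
  have : Cp * `|xi b - xi a - (b - a) *: w| <= e / 4 * (b - a).
    apply: (@le_trans _ _ ((Cp + 1) * `|xi b - xi a - (b - a) *: w|)).
      by rewrite ler_wpM2r// lerDl.
    by rewrite -ler_pdivlMl// mulrA [_^-1 * _]mulrC.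
  move: hq; rewrite ler_norml => /andP[h1 _] h2; apply: le_trans h1.
  by rewrite lerN2.
- have hq := qC (xi b - xi a - (xk k b - xk k a)); rewrite qB in hq.
  have hx : `|xi b - xi a - (xk k b - xk k a)| <= 2 * eta.
    rewrite (subr_split (xi a) (xi b) (xk k a) (xk k b)) addrC addKr.
    apply: le_trans (ler_normB _ _) _.
    by rewrite mulr_natl mulr2n; apply: lerD; rewrite distrC ltW.
  have hq2 := ler_wpM2l Cp0 hx.
  have hq3 := ler_norm (q (xi b - xi a) - q (xk k b - xk k a)).
  move: (le_trans hq3 (le_trans hq hq2)).
  by move: (q (xi b - xi a)) (q (xk k b - xk k a)) => A1 A2; clear; lra.
- move: ka2 kb2; rewrite !ltr_norml => /andP[h1 h2] /andP[h3 h4].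
  by clear - h1 h2 h3 h4; lra.
Qed.

Lemma solution_compact (U : set_system nat) t M K (x0 x : 'rV[R]_n) (y0 B : R)
    (xk : nat -> R -> 'rV[R]_n) (yk : nat -> R -> R) :
  UltraFilter U -> 0 < t -> tonelli t M K ->
  (forall k, tonelli_solution t M x0 x y0 (xk k) (yk k)) ->
  (forall k s, 0 <= s <= t -> `|yk k s| <= B) ->
  exists xi y, [/\ forall s e, 0 <= s <= t -> 0 < e ->
        U [set k | `|xk k s - xi s| < e /\ `|yk k s - y s| < e],
    ac_on 0 t xi, xi 0 = x0 /\ xi t = x,
    (forall s, 0 <= s <= t -> `|y s| <= B) /\
    (exists C, forall a b, 0 <= a -> a <= b -> b <= t -> - C * (b - a) <= y b - y a) &
    forall s, 0 < s < t -> derivable xi s 1 ->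
      straddle_ge y s (M s (xi s) (y s) (derive1 xi s))].
Proof.
move=> UU t0 tM sol yB; have PU : ProperFilter U by exact: ultra_proper.
have FU : Filter U by exact: filter_filter.
have K0 := tonelli_gt0 tM; have t00 := ltW t0.
have B0 : 0 <= B by apply: le_trans (yB 0%N 0 _); rewrite ?normr_ge0// lexx.
have est Q : 0 <= Q -> exists2 C, 0 <= C & forall k a b, 0 <= a -> a <= b -> b <= t ->
    Q * `|xk k b - xk k a| <= yk k b - yk k a + C * (b - a).
  move=> Q0; have [C C0 HC] := sol_estimate B tM Q0; exists C => // k a b a0 ab bt.
  by apply: (HC x0 x y0 _ _ (sol k)) => // s; exact: yB.
have diffB k a b : 0 <= a <= t -> 0 <= b <= t -> yk k b - yk k a <= 2 * B.
  by move=> /(yB k) + /(yB k); rewrite !ler_norml => /andP[? ?] /andP[? ?]; lra.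
have [C1 C10 est1] := est 1 ler01.
have lim s : exists p : 'rV[R]_n * R, 0 <= s <= t -> forall e, 0 < e ->
    U [set k | `|xk k s - p.1| < e /\ `|yk k s - p.2| < e].
  have [st|nst] := boolP (0 <= s <= t); last by exists (x0, y0).
  have [l Hl] := ultra_limit UU (fun k => yB k s st).
  have [|l' Hl'] := @ultra_limit_row U (fun k => xk k s) (`|x0| + (2 * B + C1 * t)) UU.
    move=> k; rewrite -{1}(subrK x0 (xk k s)) addrC.
    apply: le_trans (ler_normD _ _) _; rewrite lerD2l -(sol_start (sol k)).
    have /andP[s0 st'] := st.
    have := est1 k 0 s (lexx _) s0 st'; rewrite mul1r => /le_trans; apply.
    apply: lerD; first by apply: diffB => //; rewrite lexx.
    by rewrite subr0 ler_wpM2l.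
  exists (l', l) => _ e e0; apply: filterI; [exact: Hl'|exact: Hl].
have [p Hp] := choice lim.
pose xi s := (p s).1; pose y s := (p s).2.
have cv s e : 0 <= s <= t -> 0 < e -> U [set k | `|xk k s - xi s| < e /\ `|yk k s - y s| < e].
  by move=> st e0; exact: Hp.
have pick2 a b e : 0 <= a <= t -> 0 <= b <= t -> 0 < e -> exists k,
    [/\ `|xk k a - xi a| < e, `|yk k a - y a| < e, `|xk k b - xi b| < e & `|yk k b - y b| < e].
  move=> at0 bt e0.
  have h := @filterI nat U FU _ _ (cv a e at0 e0) (cv b e bt e0).
  have [k [[? ?] [? ?]]] := @filter_ex nat U PU _ h.
  by exists k; split.
have xi_fix s v : 0 <= s <= t -> (forall k, xk k s = v) -> xi s = v.
  move=> st kv; apply/eqP; rewrite -subr_eq0 -normr_eq0 eq_le normr_ge0 andbT.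
  apply/ler_addgt0Pr => e e0; have [k [h _ _ _]] := pick2 s s e st st e0.
  by rewrite add0r distrC -(kv k) ltW.
have yBl s : 0 <= s <= t -> `|y s| <= B.
  move=> st; apply/ler_addgt0Pr => e e0; have [k [_ h _ _]] := pick2 s s e st st e0.
  rewrite -(subrK (yk k s) (y s)) addrC; apply: le_trans (ler_normD _ _) _.
  by apply: lerD; [exact: yB|rewrite distrC ltW].
have estl Q C : 0 <= Q -> (forall k a b, 0 <= a -> a <= b -> b <= t ->
      Q * `|xk k b - xk k a| <= yk k b - yk k a + C * (b - a)) ->
    forall a b, 0 <= a -> a <= b -> b <= t -> Q * `|xi b - xi a| <= y b - y a + C * (b - a).
  move=> Q0 H a b a0 ab bt; apply/ler_addgt0Pr => e e0.
  have [E e1 eE] : exists2 E : R, 0 < E & (2 + 2 * Q) * E = e.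
    exists (e / (2 + 2 * Q)); first by rewrite divr_gt0//; lra.
    by field; rewrite gt_eqF//; lra.
  have at0 : 0 <= a <= t by apply/andP; split; lra.
  have bt0 : 0 <= b <= t by apply/andP; split; lra.
  have [k [h1 h2 h3 h4]] := pick2 a b _ at0 bt0 e1.
  have := H k a b a0 ab bt.
  have : Q * `|xi b - xi a| <= Q * (`|xk k b - xk k a| + 2 * E).
    rewrite ler_wpM2l// (subr_split (xi a) (xi b) (xk k a) (xk k b)).
    apply: le_trans (ler_normD _ _) _; rewrite lerD2l.
    by apply: le_trans (ler_normB _ _) _; rewrite distrC [X in _ + X]distrC; lra.
  move: h2 h4; rewrite !ltr_norml => /andP[? ?] /andP[? ?].
  lra.
have mono a b : 0 <= a -> a <= b -> b <= t -> - C1 * (b - a) <= y b - y a.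
  move=> a0 ab bt; have := estl 1 C1 ler01 est1 a b a0 ab bt.
  by rewrite mul1r; have := normr_ge0 (xi b - xi a); lra.
exists xi, y; split=> //.
(* [W] exceeds the total increment of y + C1 s on [0, t]. With Q = 2 W / e, a family shorter than W
   / (C + 1) satisfies Q times the sum of the increments of [xi] below 2 W, so that sum is below
   [e]. *)
- move=> e e0; pose W := 2 * B + C1 * t + 1.
  have C1t : 0 <= C1 * t by rewrite mulr_ge0.
  have W0 : 0 < W by rewrite /W; lra.
  have Q0 : 0 < 2 * W / e by rewrite divr_gt0//; lra.
  have [C C0 HC] := est _ (ltW Q0); have C2 : 0 < C + 1 by lra.
  exists (W / (C + 1)) => [|S famS]; first by rewrite divr_gt0.
  rewrite ltr_pdivlMr// => Sd.
  have S0 := increments_ge0 famS.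
  have h1 : 2 * W / e * (\sum_(q <- S) `|xi q.2 - xi q.1|) <= increments y S + C * increments idfun S.
    rewrite /increments !mulr_sumr -big_split/= big_seq [leRHS]big_seq.
    apply: ler_sum => q qS; case/andP: famS => /allP /(_ _ qS) /and3P[q1 /ltW q2 q3] _.
    exact: estl (ltW Q0) HC _ _ q1 q2 q3.
  have h2 : increments y S + C1 * increments idfun S <= 2 * B + C1 * t.
    have -> : increments y S + C1 * increments idfun S = increments (fun s => y s + C1 * s) S.
      by rewrite /increments mulr_sumr -big_split/=; apply: eq_bigr => q _; ring.
    have fam2 := increments_le (f := fun s => y s + C1 * s) t00 _ famS.
    apply: le_trans (fam2 _) _.
      by move=> a b a0 ab bt; have := mono a b a0 ab bt; lra.
    have := yBl t; have := yBl 0; rewrite !lexx t00 !ler_norml => /(_ isT)/andP[? ?] /(_ isT)/andP[? ?].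
    by rewrite mulr0; lra.
  have h3 : 0 <= C1 * increments idfun S by rewrite mulr_ge0.
  have : 2 * W / e * (\sum_(q <- S) `|xi q.2 - xi q.1|) < 2 * W.
    have WE : W = 2 * B + C1 * t + 1 by [].
    apply: (le_lt_trans h1); move: Sd WE; clearbody W => Sd WE; lra.
  rewrite -ltr_pdivlMl// (_ : (2 * W / e)^-1 * (2 * W) = e)//.
  by field; rewrite !gt_eqF.
- split; [apply: xi_fix => [|k]|apply: xi_fix => [|k]]; rewrite ?lexx ?t00//.
  + exact: sol_start (sol k).
  + exact: sol_end (sol k).
- by split=> //; exists C1.
- by move=> s0 s0t dxi; exact: (limit_straddle PU tM sol yB cv s0t dxi).
Qed.

End compactness.

(** * Existence of a minimizer for the Tonelli problem *)

Section minimizer.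
Context {R : realType} {n : nat}.

Theorem tonelli_minimizer (t : R) (M : R -> 'rV[R]_n -> R -> 'rV[R]_n -> R) (K : R)
    (x0 x : 'rV[R]_n) (y0 : R) :
  0 < t -> tonelli t M K ->
  exists xi y, tonelli_solution t M x0 x y0 xi y /\
    forall eta z, tonelli_solution t M x0 x y0 eta z -> y t <= z t.
Proof.
move=> t0 tM; have t00 := ltW t0.
pose V := [set r : R | exists xi y, tonelli_solution t M x0 x y0 xi y /\ r = y t].
(* A final value that is at most 0 is at least - B1, so - B1 is a lower bound for all final
   values. *)
have [B1 B10 HB1] := sol_bounded x0 x y0 0 t00 tM.
have tt : 0 <= t <= t by rewrite t00 lexx.
have V0 : V !=set0.
  have [xi [y sol]] := solution_exists x0 x y0 t0 tM.
  by exists (y t), xi, y.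
have Vlb : lbound V (- B1).
  move=> _ [xi [y [sol ->]]]; have [y0t|/ltW y0t] := leP (y t) 0.
    by have := HB1 _ _ sol y0t t tt; rewrite ler_norml => /andP[].
  by apply: le_trans y0t; rewrite oppr_le0.
have infV : has_inf V by split; [exact: V0|exists (- B1)].
pose m := inf V.
have mV r : V r -> m <= r by move=> Vr; apply: ge_inf => //; exists (- B1).
have /choice[p Hp] : forall k : nat, exists p : (R -> 'rV[R]_n) * (R -> R),
    tonelli_solution t M x0 x y0 p.1 p.2 /\ p.2 t < m + k.+1%:R^-1.
  move=> k; have e0 : 0 < k.+1%:R^-1 :> R by rewrite invr_gt0.
  by have [_ [xi [y [sol ->]]] ym] := inf_adherent e0 infV; exists (xi, y).
clearbody m.
have [B B0 HB] := sol_bounded x0 x y0 (m + 1) t00 tM.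
(* The ultrafilter refines [\oo], so final values along the minimizing sequence still tend to
   [m]. *)
have [U [UU oU]] := @ultraFilterLemma nat (\oo : set_system nat) _.
have PU : ProperFilter U by exact: ultra_proper.
have FU : Filter U by exact: filter_filter.
have yB k s : 0 <= s <= t -> `|(p k).2 s| <= B.
  move=> st; have [sol pm] := Hp k; apply: (HB _ _ sol) => //.
  apply: le_trans (ltW pm) _; rewrite lerD2l invf_le1//.
  by rewrite ler1n.
have [xi [y [cv acxi [xi0 xit] [yBl [C' yC']] dini]]] :=
  solution_compact UU t0 tM (fun k => (Hp k).1) yB.
have ym : y t <= m.
  apply/ler_addgt0Pr => e e0; have e20 : 0 < e / 2 by rewrite divr_gt0.
  have H1 := cv t _ tt e20.
  have H2 : U [set k | k.+1%:R^-1 < e / 2 :> R].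
    by apply: oU; exact: (near_infty_natSinv_lt (PosNum e20)).
  have [k [[_ h1] /= h2]] := @filter_ex nat U PU _ (@filterI nat U FU _ _ H1 H2).
  have [_ h3] := Hp k.
  move: h1; rewrite ltr_norml => /andP[h4 _].
  have {}h3 := lt_trans h3 (ler_ltD (lexx m) h2).
  by clear - h3 h4; lra.
have y0E : y0 <= y 0.
  apply/ler_addgt0Pr => e e0; have t0t : 0 <= (0 : R) <= t by rewrite lexx t00.
  have [k [_ h1]] := @filter_ex nat U PU _ (cv 0 e t0t e0).
  move: h1; rewrite (sol_init (Hp k).1) ltr_norml => /andP[_ h]; clear - h; lra.
have By0 : - B <= y0.
  have := yB 0%N 0; rewrite lexx t00 (sol_init (Hp 0%N).1) => /(_ isT).
  by rewrite ler_norml => /andP[].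
(* The limit [y] is only a supersolution; the solution [z] below it has z(t) <= y(t) <= m. *)
have [||z [acz z0 dz zy]] := @solve_along R n t M K xi y B B C' y0 t0 tM acxi By0 _ yC' _ y0E.
- by move=> s /yBl; rewrite ler_norml.
- have := ac_row_ae_derivable acxi; apply: ae_sub => s h st.
  by apply: dini => //; exact: h.
exists xi, z; split=> // eta z' sol'.
by apply: le_trans (zy t tt) _; apply: le_trans ym _; apply: mV; exists eta, z'.
Qed.

End minimizer.

(** * Reduction of the Herglotz problem *)

Section lagrangian.
Context {R : realType} {n : nat}.
Implicit Types (t s r : R) (v w x : 'rV[R]_n) (xi : R -> 'rV[R]_n) (u : R -> R).
Implicit Types (L : 'rV[R]_n -> R -> 'rV[R]_n -> R).
Local Notation mu := (@lebesgue_measure R).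

Lemma norm_le_enorm v : `|v| <= enorm v.
Proof.
apply: norm_le_coord => [|j]; first exact: sqrtr_ge0.
rewrite -sqrtr_sqr ler_sqrt ?sumr_ge0//; last by move=> i _; exact: sqr_ge0.
by rewrite (bigD1 j)//= lerDl sumr_ge0// => i _; exact: sqr_ge0.
Qed.

(** Where theta(rho) / rho may still be below [Q], rho is bounded and the constant absorbs Q rho. *)
Lemma superlinear_lower (theta : R -> R) (Q : R) : superlinear_nondecreasing theta ->
  0 <= Q -> exists2 C, 0 <= C & forall rho, 0 <= rho -> Q * rho - C <= theta rho.
Proof.
move=> [t0 _ /cvgryPge /(_ Q)[A [_ HA]]] Q0.
have A0 := normr_ge0 A.
exists (Q * `|A|) => [|rho rho0]; first by rewrite mulr_ge0.
have [rA|Ar] := leP rho `|A|.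
  by apply: le_trans (t0 _ rho0); rewrite subr_le0 ler_wpM2l.
have rho1 : 0 < rho by exact: le_lt_trans Ar.
have := HA rho (le_lt_trans (ler_norm A) Ar); rewrite /= ler_pdivlMr// => h.
apply: le_trans h; rewrite lerBlDr lerDl mulr_ge0//.
Qed.

Definition uncurry_lagrangian L (p : 'rV[R]_n * R * 'rV[R]_n) : R := L p.1.1 p.1.2 p.2.

(** The slope is the partial differential in [v] at [w]: convexity on the segment towards [v] bounds
    the difference quotients by L(x, r, v) - L(x, r, w), and they converge to the slope applied to v
    - w. *)
Lemma convex_support L x r w :
  (forall p, differentiable (uncurry_lagrangian L) p) -> strictly_convex (L x r) ->
  exists2 p, lin_form p & forall v, L x r w + p (v - w) <= L x r v.
Proof.
move=> dL convL; set F := uncurry_lagrangian L in dL.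
pose D := 'd F (x, r, w) : {linear _ -> _}.
exists (fun v => D (0, 0, v)).
  split=> [v1 v2|a v].
    by rewrite -linearB; congr (D _); congr (_, _); rewrite /= subr0.
  by rewrite -[RHS]/(a *: D (0, 0, v)) -linearZ; congr (D _); congr (_, _); rewrite /= scaler0.
move=> v; have [->|vw] := eqVneq v w.
  rewrite subrr; have -> : D (0, 0, 0) = 0 by exact: linear0.
  by rewrite addr0.
have df : derivable F (x, r, w) (0, 0, v - w) by exact: diff_derivable.
have cv := cvg_difference_quotient df.
rewrite deriveE// -/D in cv.
suff : D (0, 0, v - w) <= L x r v - L x r w by lra.
apply: (cvgr_to_le cv); near=> k.
have k0 : 0 < k.+1%:R :> R by rewrite ltr0n.
rewrite [leLHS]mulrC -ler_pdivlMr//.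
rewrite (_ : _ + (x, r, w) = (x, r, k.+1%:R^-1 *: v + (1 - k.+1%:R^-1) *: w)); last first.
  by congr (_, _, _); rewrite /= ?scaler0 ?add0r// scalerBr scalerBl scale1r addrAC -addrA.
have := convL v w k.+1%:R^-1 vw.
(* [strictly_convex] takes weights strictly below 1, which excludes k = 0. *)
have k1 : (0 < k)%N by near: k; exact: nbhs_infty_gt.
rewrite invr_gt0 k0 /= invf_lt1// ltr1n ltnS k1 => /(_ isT) h.
 rewrite /F /uncurry_lagrangian/= lerBlDr.
apply: le_trans (ltW h) _.
by move: (L x r v) (L x r w) (k.+1%:R^-1 : R) => A1 A2 g; clear; lra.
Unshelve. all: by end_near. Qed.

Lemma lagrangian_lipschitz L (K : R) x v r r' :
  (forall p, differentiable (uncurry_lagrangian L) p) ->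
  (forall x r v, `|derive1 (fun r' => L x r' v) r| <= K) ->
  `|L x r' v - L x r v| <= K * `|r' - r|.
Proof.
move=> dL LK.
have dr s : is_derive s 1 (fun r => L x r v) (derive1 (fun r => L x r v) s).
  apply: DeriveDef; last by rewrite derive1E.
  apply/derivable1_diffP.
  apply: (@differentiable_comp _ _ _ _ (fun r => (x, r, v)) (uncurry_lagrangian L)) => //.
  by apply: differentiable_pair => //; apply: differentiable_pair.
wlog rr' : r r' / r <= r'.
  move=> H; have [/H//|/ltW/H] := leP r r'.
  by rewrite distrC [ `|r - r'|]distrC.
exact: (is_derive_lipschitz dr (fun s _ => LK x s v) rr').
Qed.

Lemma lagrangian_time_continuous L : continuous (uncurry_lagrangian L) ->
  continuous (fun p : R * 'rV[R]_n * R * 'rV[R]_n => L p.1.1.2 p.1.2 p.2).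
Proof.
pose T := (R * 'rV[R]_n * R * 'rV[R]_n)%type.
move=> cL p0.
have h4 : p.2 @[p --> (p0 : T)] --> p0.2 by exact: cvg_snd.
have h3 : p.1.2 @[p --> (p0 : T)] --> p0.1.2.
  by apply: cvg_comp; [exact: cvg_fst|exact: cvg_snd].
have h11 : p.1.1 @[p --> (p0 : T)] --> p0.1.1.
  by apply: cvg_comp; [exact: cvg_fst|exact: cvg_fst].
have h2 : p.1.1.2 @[p --> (p0 : T)] --> p0.1.1.2.
  by apply: (cvg_comp _ _ h11); exact: cvg_snd.
apply: (@continuous_comp _ _ _ (fun p : T => (p.1.1.2, p.1.2, p.2))
  (uncurry_lagrangian L)); last exact: cL.
exact: (cvg_pair (cvg_pair h2 h3) h4).
Qed.

End lagrangian.

Section herglotz.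
Context {R : realType} {n : nat}.
Implicit Types (t s r : R) (v w x : 'rV[R]_n) (xi : R -> 'rV[R]_n) (u : R -> R).
Implicit Types (L : 'rV[R]_n -> R -> 'rV[R]_n -> R).
Local Notation mu := (@lebesgue_measure R).

(* If [u] solves the equation of [L] then [exp (K s) u] solves that of
   [scaled_lagrangian K L], which is nondecreasing in its second variable. *)
Definition scaled_lagrangian (K : R) L s x r v : R :=
  expR (K * s) * L x (expR (- (K * s)) * r) v + K * r.

(** The two exponentials cancel, so the first term is [K]-Lipschitz in [r] at every time; adding K r
    makes the sum nondecreasing and gives the constant 2 K. As 1 <= exp(K s) <= exp(K t), the
    superlinear slope survives and the constant is multiplied by exp(K t). *)
Lemma scaled_tonelli (K t : R) L : 0 <= t -> 0 < K ->
  (forall p, differentiable (uncurry_lagrangian L) p) ->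
  (forall x r, strictly_convex (L x r)) -> growth_condition L ->
  (forall x r v, `|derive1 (fun r' => L x r' v) r| <= K) ->
  tonelli t (scaled_lagrangian K L) (2 * K).
Proof.
move=> t0 K0 dL L1 [thb [th [c0 [_ sth _ c00 hth]]]] LK.
have lip x v r r' := @lagrangian_lipschitz R n L K x v r r' dL LK.
have cL : continuous (uncurry_lagrangian L).
  by move=> p; apply: differentiable_continuous.
have lip_scaled s x r r' v : r <= r' ->
    `|expR (K * s) * (L x (expR (- (K * s)) * r') v - L x (expR (- (K * s)) * r) v)|
      <= K * (r' - r).
  move=> rr'; rewrite normrM gtr0_norm ?expR_gt0//.
  apply: (@le_trans _ _ (expR (K * s) * (K * `|expR (- (K * s)) * r' - expR (- (K * s)) * r|))).
    by rewrite ler_wpM2l ?expR_ge0.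
  rewrite -mulrBr normrM gtr0_norm ?expR_gt0// ger0_norm ?subr_ge0//.
  by rewrite mulrCA (mulrA (expR _)) -expRD subrr expR0 mul1r.
split.
- move=> p0; pose T := (R * 'rV[R]_n * R * 'rV[R]_n)%type.
  have h11 : p.1.1 @[p --> (p0 : T)] --> p0.1.1.
    by apply: cvg_comp; [exact: cvg_fst|exact: cvg_fst].
  have h1 : p.1.1.1 @[p --> (p0 : T)] --> p0.1.1.1.
    by apply: (cvg_comp _ _ h11); exact: cvg_fst.
  have h2 : p.1.1.2 @[p --> (p0 : T)] --> p0.1.1.2.
    by apply: (cvg_comp _ _ h11); exact: cvg_snd.
  have h3 : p.1.2 @[p --> (p0 : T)] --> p0.1.2.
    by apply: cvg_comp; [exact: cvg_fst|exact: cvg_snd].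
  have h4 : p.2 @[p --> (p0 : T)] --> p0.2 by exact: cvg_snd.
  have hK : K * p.1.1.1 @[p --> (p0 : T)] --> K * p0.1.1.1.
    by apply: cvgM => //; exact: cvg_cst.
  have hE : expR (K * p.1.1.1) @[p --> (p0 : T)] --> expR (K * p0.1.1.1).
    by apply: (cvg_comp _ _ hK); exact: continuous_expR.
  have hN : expR (- (K * p.1.1.1)) @[p --> (p0 : T)] --> expR (- (K * p0.1.1.1)).
    by apply: (cvg_comp _ _ (cvgN hK)); exact: continuous_expR.
  have hr : expR (- (K * p.1.1.1)) * p.1.2 @[p --> (p0 : T)] --> expR (- (K * p0.1.1.1)) * p0.1.2.
    exact: cvgM.
  apply: cvgD; last by apply: cvgM => //; exact: cvg_cst.
  apply: cvgM => //.
  have hp : (p.1.1.2, expR (- (K * p.1.1.1)) * p.1.2, p.2) @[p --> (p0 : T)] -->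
    (p0.1.1.2, expR (- (K * p0.1.1.1)) * p0.1.2, p0.2).
    exact: (cvg_pair (cvg_pair h2 hr) h4).
  exact: (cvg_comp _ (uncurry_lagrangian L) hp (cL _)).
- move=> s x r r' v rr'; have := lip_scaled s x r r' v rr'.
  by rewrite /scaled_lagrangian ler_norml mulrBr => /andP[h _]; lra.
- move=> s x r r' v rr'; have := lip_scaled s x r r' v rr'.
  by rewrite /scaled_lagrangian ler_norml mulrBr => /andP[_ h]; lra.
- move=> s x r w.
  have [p [pB pZ] hp] := @convex_support R n L x (expR (- (K * s)) * r) w dL (L1 _ _).
  exists (fun v => expR (K * s) * p v).
    by split=> [v1 v2|a v]; rewrite ?pB ?pZ; [rewrite mulrBr|rewrite mulrCA].
  move=> v; rewrite /scaled_lagrangian addrAC lerD2r -mulrDr.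
  by rewrite ler_wpM2l ?expR_ge0.
- move=> Q Q0; have [C C0 HC] := superlinear_lower sth Q0.
  exists (expR (K * t) * (C + c0)); first by rewrite mulr_ge0 ?expR_ge0// addr_ge0// ltW.
  move=> s x v /andP[s0 st]; rewrite /scaled_lagrangian !mulr0 addr0.
  have h1 : Q * `|v| - (C + c0) <= L x 0 v.
    have /andP[+ _] := hth x v; apply: le_trans.
    have h2 := HC (enorm v) (sqrtr_ge0 _).
    have h3 : Q * `|v| <= Q * enorm v by rewrite ler_wpM2l// norm_le_enorm.
    by clear - h2 h3; lra.
  have e1 : 1 <= expR (K * s).
    by rewrite -[X in X <= _]expR0 ler_expR mulr_ge0// ltW.
  have e2 : expR (K * s) <= expR (K * t) by rewrite ler_expR ler_wpM2l// ltW.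
  apply: le_trans (ler_wpM2l (expR_ge0 _) h1).
  have h4 : 0 <= (expR (K * s) - 1) * (Q * `|v|) by rewrite mulr_ge0 ?subr_ge0// mulr_ge0.
  have h5 : 0 <= (expR (K * t) - expR (K * s)) * (C + c0).
    by rewrite mulr_ge0 ?subr_ge0// addr_ge0// ltW.
  by clear - h4 h5; lra.
- by rewrite mulr_ge0// ltW.
Qed.

Lemma expRM_ac (c t : R) u : 0 <= t -> ac_on 0 t u ->
  ac_on 0 t (fun s => expR (c * s) * u s).
Proof.
move=> t0 acu; have [B B0 HB] := ac_on_bounded t0 acu.
have de s : is_derive s 1 (fun s : R => expR (c * s)) (c * expR (c * s)).
  by apply: is_derive_eq; rewrite /GRing.scale/=; ring.
pose E := expR (`|c| * t).
have E1 : 0 <= E by exact: expR_ge0.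
have eE s : 0 <= s <= t -> expR (c * s) <= E.
  move=> /andP[s0 st]; rewrite /E ler_expR.
  apply: (@le_trans _ _ (`|c| * s)); first by rewrite ler_wpM2r// ler_norm.
  by rewrite ler_wpM2l.
apply: (@ac_on_dominated _ _ _ _ 0 t u idfun _ (E + `|c| * E * B)) => //; last exact: ac_on_id.
move=> a b a0 ab bt /=.
have at0 : 0 <= a <= t by rewrite a0 (le_trans ab).
have bt0 : 0 <= b <= t by rewrite bt (le_trans a0).
have -> : expR (c * b) * u b - expR (c * a) * u a =
    expR (c * b) * (u b - u a) + (expR (c * b) - expR (c * a)) * u a by ring.
have h1 : `|expR (c * b) * (u b - u a)| <= E * `|u b - u a|.
  by rewrite normrM gtr0_norm ?expR_gt0// ler_wpM2r// eE.
have h2 : `|(expR (c * b) - expR (c * a)) * u a| <= `|c| * E * B * `|b - a|.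
  rewrite normrM [leRHS]mulrAC; apply: ler_pM => //; last exact: HB.
  apply: (is_derive_lipschitz de) => // s /andP[sa sb].
  rewrite normrM ler_wpM2l// gtr0_norm ?expR_gt0//; apply: eE.
  by rewrite (le_trans a0 sa) (le_trans sb bt).
apply: le_trans (ler_normD _ _) _.
have h3 : 0 <= `|c| * E * B * `|u b - u a| by rewrite !mulr_ge0.
have h4 : 0 <= E * `|b - a| by rewrite mulr_ge0.
by clear - h1 h2 h3 h4; lra.
Qed.

Lemma ae_interior t (P : R -> Prop) : {ae mu, forall s, 0 < s < t -> P s} ->
  {ae mu, forall s, s \in `[0, t] -> P s}.
Proof.
have neq (c : R) : {ae mu, forall s, s <> c}.
  exists [set c]; split=> //; first exact: lebesgue_measure_set1.
  by move=> s /= /contrapT.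
move=> h; have := ae_and (neq 0) (ae_and (neq t) h); apply: ae_sub.
move=> s [s0 [st hs]]; rewrite inE/= in_itv/= => /andP[h1 h2]; apply: hs.
by rewrite !lt_neqAle h1 h2 !andbT; apply/andP; split; [rewrite eq_sym|]; exact/eqP.
Qed.

Lemma ae_closed t (P : R -> Prop) : {ae mu, forall s, s \in `[0, t] -> P s} ->
  {ae mu, forall s, 0 < s < t -> P s}.
Proof.
apply: ae_sub => s h /andP[s0 st]; apply: h.
by rewrite inE/= in_itv/= !ltW.
Qed.

End herglotz.

(** * Carathéodory solutions and the value of [J] *)

Section caratheodory.
Context {R : realType} {n : nat}.
Implicit Types (t s r : R) (v w x : 'rV[R]_n) (xi : R -> 'rV[R]_n) (u : R -> R).
Implicit Types (L : 'rV[R]_n -> R -> 'rV[R]_n -> R).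
Local Notation mu := (@lebesgue_measure R).

Lemma caratheodory_scaled L (K t : R) (x0 x : 'rV[R]_n) (u0 : R) xi u : 0 <= t ->
  Gamma t x0 x xi -> caratheodory_solution L t u0 xi u ->
  tonelli_solution t (scaled_lagrangian K L) x0 x u0 xi (fun s => expR (K * s) * u s).
Proof.
move=> t0 [/abs_continuousP acxi xi0 xit] [/abs_continuousP acu du uu0].
split=> //; first exact: expRM_ac.
  by rewrite mulr0 expR0 mul1r.
have := ae_closed du; apply: ae_sub => s h st.
have de : is_derive s 1 (fun s : R => expR (K * s)) (K * expR (K * s)).
  by apply: is_derive_eq; rewrite /GRing.scale/=; ring.
have := is_deriveM de (h st).
rewrite /scaled_lagrangian mulrA -expRD addNr expR0 mul1r.
rewrite (_ : expR (K * s) *: _ + _ = expR (K * s) * L (xi s) (u s) (derive1 xi s) +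
  K * (expR (K * s) * u s))//.
by rewrite /GRing.scale/=; ring.
Qed.

Lemma scaled_caratheodory L (K t : R) (x0 x : 'rV[R]_n) (u0 : R) xi y : 0 <= t ->
  tonelli_solution t (scaled_lagrangian K L) x0 x u0 xi y ->
  Gamma t x0 x xi /\ caratheodory_solution L t u0 xi (fun s => expR (- K * s) * y s).
Proof.
move=> t0 [acxi xi0 xit acy y0 dy]; split; first by split=> //; apply/abs_continuousP.
split.
- by apply/abs_continuousP; exact: expRM_ac.
- apply: ae_interior; apply: ae_sub dy => s h st.
  have de : is_derive s 1 (fun s : R => expR (- K * s)) (- K * expR (- K * s)).
    by apply: is_derive_eq; rewrite /GRing.scale/=; ring.
  have := is_deriveM de (h st).
  rewrite /scaled_lagrangian -mulNr.
  rewrite (_ : expR (- K * s) *: _ + _ =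
    (expR (- K * s) * expR (K * s)) * L (xi s) (expR (- K * s) * y s) (derive1 xi s)).
    by rewrite -expRD mulNr addNr expR0 mul1r.
  by rewrite /GRing.scale/=; ring.
- by rewrite mulr0 expR0 mul1r.
Qed.

(** With w = (u2 - u1) / d, the inequality w' >= - K |w| is invariant under scaling, while the bound
    - w(t) <= exp(K t) that [arsinh] yields is not. Hence u1(t) - u2(t) <= d exp(K t) for every d >
    0. *)
Lemma caratheodory_unique L (K t u0 : R) xi u1 u2 : 0 <= t -> 0 <= K ->
  (forall x v r r', `|L x r' v - L x r v| <= K * `|r' - r|) ->
  caratheodory_solution L t u0 xi u1 -> caratheodory_solution L t u0 xi u2 ->
  u1 t <= u2 t.
Proof.
move=> t0 K0 lip [/abs_continuousP ac1 d1 u10] [/abs_continuousP ac2 d2 u20].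
suff H d : 0 < d -> u1 t - u2 t <= d * expR (K * t).
  rewrite -subr_le0; apply/ler_addgt0Pr => e e0; rewrite add0r.
  have E0 := expR_gt0 (K * t).
  by have := H (e / expR (K * t)) (divr_gt0 e0 E0); rewrite divfK ?gt_eqF.
move=> d0; have di : 0 <= d^-1 by rewrite invr_ge0 ltW.
pose w s := d^-1 * (u2 s - u1 s).
have acw : ac_on 0 t w.
  apply: (@ac_on_dominated _ _ _ _ 0 t u2 u1 _ d^-1 _ ac2 ac1) => a b _ _ _.
  rewrite /w -mulrBr normrM gtr0_norm ?invr_gt0// ler_wpM2l//.
  have -> : u2 b - u1 b - (u2 a - u1 a) = (u2 b - u2 a) - (u1 b - u1 a) by ring.
  exact: ler_normB.
have dw : {ae mu, forall s, 0 < s < t -> exists2 D, is_derive s 1 w D & - 0 - K * `|w s| <= D}.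
  have := ae_and (ae_closed d1) (ae_closed d2); apply: ae_sub => s [h1 h2] st.
  exists (d^-1 * (L (xi s) (u2 s) (derive1 xi s) - L (xi s) (u1 s) (derive1 xi s))).
    exact: is_deriveZ (is_deriveB (h2 st) (h1 st)).
  rewrite oppr0 sub0r normrM [ `|d^-1|]gtr0_norm ?invr_gt0// mulrCA -mulrN ler_wpM2l//.
  by have := lip (xi s) (derive1 xi s) (u1 s) (u2 s); rewrite ler_norml => /andP[].
have := arsinh_increment_ge (lexx 0) K0 acw dw (lexx 0) t0 (lexx t).
have arsinh0 : arsinh (0 : R) = 0 by rewrite /arsinh expr0n/= addr0 add0r sqrtr1 ln1.
rewrite {2}/w u10 u20 subrr mulr0 arsinh0 !subr0 add0r => h.
have : - w t <= expR (K * t).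
  by apply: le_trans (le_expR_arsinh _) _; rewrite ler_expR arsinhN lerNl -mulNr.
by rewrite /w -mulrN opprB mulrC ler_pdivrMr// mulrC.
Qed.

(** The integrand is not known to be measurable, because of [derive1] on the null set [N]; it is
    exchanged for a function measurable on [0, t] that agrees with it off [N], and [ac_integral]
    evaluates the integral. *)
Lemma caratheodory_integral L (K c t u0 : R) xi u : 0 <= t -> 0 <= K ->
  continuous (uncurry_lagrangian L) ->
  (forall x v r r', `|L x r' v - L x r v| <= K * `|r' - r|) ->
  (forall x v, - c <= L x 0 v) ->
  ac_on 0 t xi -> caratheodory_solution L t u0 xi u ->
  \int[mu]_(s in `[0, t]) L (xi s) (u s) (derive1 xi s) = u t - u0.
Proof.
move=> t0 K0 cL lip Lc acxi [/abs_continuousP acu du uu0].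
have [B B0 HB] := ac_on_bounded t0 acu.
have cuc : continuous (u \o clamp t) by exact: continuous_clamp.
have [N [mN N0 HN mH]] := @measurable_along R n t (fun=> L) xi t0 (lagrangian_time_continuous cL) acxi.
pose f := (fun s => L (xi s) ((u \o clamp t) s) (derive1 xi s)) \_ (~` N).
have fE s : 0 <= s <= t -> ~ N s -> f s = L (xi s) (u s) (derive1 xi s).
  by move=> st Ns; rewrite /f patchE mem_set//= clamp_id.
have fC s : 0 <= s <= t -> - (`|c| + K * B) <= f s.
  move=> st; have cc := ler_norm c; have KB : 0 <= K * B by rewrite mulr_ge0.
  case: (pselect (N s)) => Ns.
    rewrite /f patchE memNset//=.
    by rewrite (_ : point = 0 :> R)// oppr_le0 addr_ge0.
  rewrite fE//; have h1 := Lc (xi s) (derive1 xi s).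
  have := lip (xi s) (derive1 xi s) 0 (u s); rewrite subr0 ler_norml => /andP[h2 _].
  have h3 : K * `|u s| <= K * B by rewrite ler_wpM2l// HB.
  by clear - cc h1 h2 h3; lra.
rewrite -uu0 -(@ac_integral _ t u f _ t0 acu (mH _ cuc) fC); last first.
  have aeN : {ae mu, forall s, ~ N s} by exists N; split=> // s /= /contrapT.
  have := ae_and aeN (ae_closed du); apply: ae_sub => s [Ns h] st.
  by rewrite fE//; [exact: h|case/andP: (st) => ? ?; rewrite !ltW].
rewrite /primitive /Rintegral; congr fine.
apply: (@eq_integral_off_null _ _ _ mu _ N) => // s; rewrite /= in_itv/= => st Ns.
by rewrite patchE mem_set/= ?in_itv//= -/f fE.
Qed.

End caratheodory.

Theorem proposition1 (R : realType) (n : nat)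
    (L : 'rV[R]_n -> R -> 'rV[R]_n -> R)
    (L_C2 : Ck 2 (fun p : 'rV[R]_n * R * 'rV[R]_n => L p.1.1 p.1.2 p.2))
    (L1 : forall (x : 'rV[R]_n) (r : R), strictly_convex (L x r))
    (L2 : growth_condition L)
    (L3 : bounded_r_derivative L)
    (x0 x : 'rV[R]_n) (t u0 : R) (t_gt0 : 0 < t) :
  exists2 xi : R -> 'rV[R]_n, admissible L t x0 x u0 xi &
    forall eta : R -> 'rV[R]_n, admissible L t x0 x u0 eta ->
      J L t u0 xi <= J L t u0 eta.
Proof.
have t0 := ltW t_gt0.
have dL : forall p, differentiable (uncurry_lagrangian L) p by case: L_C2.
have cL : continuous (uncurry_lagrangian L).
  by move=> p; apply: differentiable_continuous.
have [K K0 LK] := L3.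
have lip x' v r r' := @lagrangian_lipschitz R n L K x' v r r' dL LK.
have [c Lc] : exists c, forall x' v, - c <= L x' 0 v.
  have [thb [th [c [_ [th0 _ _] _ _ hth]]]] := L2; exists c => x' v.
  have /andP[h1 _] := hth x' v; apply: le_trans h1.
  by rewrite lerBrDr addNr th0// sqrtr_ge0.
have JE eta : admissible L t x0 x u0 eta ->
    caratheodory_solution L t u0 eta (u_sol L t u0 eta) /\
    J L t u0 eta = u_sol L t u0 eta t - u0.
  move=> [[/abs_continuousP aceta _ _] ex].
  have sol : caratheodory_solution L t u0 eta (u_sol L t u0 eta) by exact: getPex.
  by split=> //; apply: (caratheodory_integral t0 (ltW K0) cL lip Lc aceta sol).
have tM := scaled_tonelli t0 K0 dL L1 L2 LK.
have [xi [y [sol ymin]]] := tonelli_minimizer x0 x u0 t_gt0 tM.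
have [Gxi cary] := scaled_caratheodory t0 sol.
have adm : admissible L t x0 x u0 xi by split=> //; exists (fun s => expR (- K * s) * y s).
exists xi; [exact: adm|move=> eta admeta].
have [carxi Jxi] := JE xi adm; have [careta Jeta] := JE eta admeta.
rewrite Jxi Jeta.
rewrite lerD2r.
(* [u_sol] is whatever solution [get] returns, so its final value is compared with that of the
   solution constructed here. *)
apply: le_trans (caratheodory_unique t0 (ltW K0) lip carxi cary) _.
have [Geta _] := admeta.
have yle := ymin _ _ (caratheodory_scaled K t0 Geta careta).
(* At time [t] both final values carry the same factor exp(K t), so the rescaling preserves their
   order. *)
by rewrite mulNr expRN mulrC ler_pdivrMr ?expR_gt0// mulrC.
Qed.
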